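(* For all $n\in\mathbb{N}$ let $z_n^0\in\mathrm{L}^2(\mathbb{T}^N)$ be non-negative, let $\mu_n,R_n\in\mathrm{L}^\infty(Q_T)$, and let $z_n\in\mathrm{L}^2(Q_T)$ be a non-negative solution of $$\partial_t z_n-\Delta(\mu_n z_n)=R_n z_n,\qquad z_n(0,\cdot)=z_n^0 .$$ Assume that $\inf_n\inf_{Q_T}\mu_n>0$ and $\sup_n\sup_{Q_T}R_n<\infty$ (essential infimum and supremum), that $(z_n^0)_n$ is bounded in $\mathrm{L}^2(\mathbb{T}^N)$, that $(R_n)_n$ is bounded in $\mathrm{L}^2(Q_T)$, and that $(\mu_n)_n$ admits a subsequence converging in $\mathrm{L}^1(Q_T)$ to a limit belonging to $\mathrm{L}^\infty(Q_T)$. Then $(z_n)_n$ admits a subsequence converging (strongly) in $\mathrm{L}^2(Q_T)$.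
   Context: $T>0$ and an integer $N\ge1$ are fixed, $\mathbb{T}^N$ is the flat torus, $Q_T:=[0,T)\times\mathbb{T}^N$, and $\mathscr{D}(Q_T)$ denotes the smooth functions with compact support in $[0,T)\times\mathbb{T}^N$ (they may be non-zero at $t=0$). Notion of solution: for $G\in\mathrm{L}^1(Q_T)$, $z^0\in\mathrm{L}^1(\mathbb{T}^N)$ and $\mu$ measurable on $Q_T$, a function $z\in\mathrm{L}^1(Q_T)$ is a (distributional) solution of $\partial_t z-\Delta(\mu z)=G$, $z(0,\cdot)=z^0$, if $z\mu\in\mathrm{L}^1(Q_T)$ and $$\forall\varphi\in\mathscr{D}(Q_T),\qquad -\int_{Q_T}z(\partial_t\varphi+\mu\Delta\varphi)=\int_{\mathbb{T}^N}z^0\varphi(0,\cdot)+\int_{Q_T}G\varphi.$$ Here this is used with $\mu=\mu_n$ and $G=R_nz_n$. *)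

(* Defs.v *)
From HB Require Import structures.
From mathcomp Require Import all_boot all_order all_algebra.
From mathcomp Require Import all_classical all_reals all_analysis.

Set Implicit Arguments.
Unset Strict Implicit.
Unset Printing Implicit Defensive.

Import Order.TTheory GRing.Theory Num.Theory.
Import numFieldNormedType.Exports.

Local Open Scope classical_set_scope.
Local Open Scope ring_scope.

Section interval_measure.
Local Open Scope ereal_scope.
Context {R : realType}.
Variable T : R.

Lemma lebesgue_measure_itv0_lty :
  @lebesgue_measure R `[0%R, T[%classic < +oo.
Proof. by rewrite lebesgue_measure_itv; case: ifP => // _; rewrite ltry. Qed.

Definition interval_measure :
    {finite_measure set (measurableTypeR R) -> \bar R} :=
  @mfrestr _ (measurableTypeR R) R _ lebesgue_measure (measurable_itv `[0%R, T[)
    lebesgue_measure_itv0_lty.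

End interval_measure.

Section finite_prod.
Local Open Scope ereal_scope.
Context d1 d2 (T1 : measurableType d1) (T2 : measurableType d2) {R : realType}.
Variables (m1 : {finite_measure set T1 -> \bar R})
          (m2 : {finite_measure set T2 -> \bar R}).

Definition finite_prod : set (T1 * T2) -> \bar R := m1 \x m2.

HB.instance Definition _ := Measure.on finite_prod.

Let finite_prod_fin : fin_num_fun finite_prod.
Proof.
apply: lty_fin_num_fun; rewrite /finite_prod -setXTT [ltLHS]product_measure1E//.
by rewrite lte_mul_pinfty// ?fin_num_measure// ltey_eq fin_num_measure.
Qed.

HB.instance Definition _ :=
  Measure_isFinite.Build _ _ _ finite_prod finite_prod_fin.

End finite_prod.

Section tuple_cons_measure.
Local Open Scope ereal_scope.
Context {R : realType} (n : nat).
Variables (m1 : {finite_measure set (measurableTypeR R) -> \bar R})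
          (m : {finite_measure set (n.-tuple (measurableTypeR R)) -> \bar R}).

Definition tuple_cons (p : measurableTypeR R * n.-tuple (measurableTypeR R)) :
  n.+1.-tuple (measurableTypeR R) := [tuple of p.1 :: p.2].

Lemma measurable_tuple_cons : measurable_fun setT tuple_cons.
Proof. exact: measurable_cons. Qed.

Definition tuple_cons_measure : set (n.+1.-tuple (measurableTypeR R)) -> \bar R :=
  pushforward (finite_prod m1 m) tuple_cons.

HB.instance Definition _ := Measure.copy tuple_cons_measure
  (measure_function_pushforward__canonical__measure_function_Measure
     (finite_prod m1 m) measurable_tuple_cons).

Let tuple_cons_measure_fin : fin_num_fun tuple_cons_measure.
Proof.
apply: lty_fin_num_fun.
suff : finite_prod m1 m setT < +oo by [].
by rewrite ltey_eq fin_num_measure.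
Qed.

HB.instance Definition _ :=
  Measure_isFinite.Build _ _ _ tuple_cons_measure tuple_cons_measure_fin.

End tuple_cons_measure.

(* The torus T^N = R^N / Z^N (unit side) is represented by its fundamental cell
   [0, 1[^N, as a measure on R^N that vanishes off the cell.  A class of
   functions on T^N modulo a.e. equality is then the same thing as a class of
   functions on R^N modulo a.e. equality for this measure, so that no
   periodicity is asked of the functions in L^p. *)
Fixpoint torus_measure (R : realType) (N : nat) :
    {finite_measure set (N.-tuple (measurableTypeR R)) -> \bar R} :=
  if N is n.+1 then tuple_cons_measure (interval_measure 1) (torus_measure R n)
  else \d_[tuple].

Lemma torus_measure_box (R : realType) (N : nat)
    (A : 'I_N -> set (measurableTypeR R)) :
  (forall i, measurable (A i)) ->
  torus_measure R N [set x | forall i, A i (tnth x i)] =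
  (\prod_(i < N) @lebesgue_measure R (A i `&` `[0%R, 1%R[%classic))%E.
Proof.
elim: N A => [|n IHn] A mA.
  rewrite big_ord0 /= diracE mem_set//; by case.
rewrite big_ord_recl -(IHn (fun i => A (lift ord0 i)))// /=.
rewrite -(@product_measure1E _ _ _ _ _ (interval_measure 1) (torus_measure R n))//.
- transitivity ((interval_measure 1 \x torus_measure R n)%E
      (@tuple_cons R n @^-1` [set x | forall i, A i (tnth x i)])) => //.
  congr (product_measure1 _ _ _).
  apply/seteqP; split=> [[a x] /= h|[a x] /= [Aa h] i].
    split; first by have := h ord0; rewrite (tnth_nth 0)//.
    by move=> i; have := h (lift ord0 i); rewrite tnthS.
  have [j ->|->] := unliftP ord0 i; first by rewrite tnthS.
  by rewrite (tnth_nth 0).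
- rewrite (_ : [set _ | _] = \bigcap_(i in [set: 'I_n])
     ((fun x : n.-tuple _ => tnth x i) @^-1` A (lift ord0 i))); last first.
    by apply/seteqP; split=> [x h i _|x h i]; exact: h.
  apply: fin_bigcap_measurable => [|i _]; first exact: finite_finset.
  rewrite -[X in measurable X]setTI; exact: measurable_tnth.
Qed.

Notation torus R N := (N.-tuple (measurableTypeR R)) (only parsing).

(* Q_T = [0, T[ x T^N, with the same convention as for the torus. *)
Notation spacetime R N :=
  (measurableTypeR R * N.-tuple (measurableTypeR R))%type (only parsing).

Definition spacetime_measure (R : realType) (T : R) (N : nat) :
    {finite_measure set (spacetime R N) -> \bar R} :=
  finite_prod (interval_measure T) (torus_measure R N).

Fixpoint iter_derive (R : realType) (V : normedModType R) (f : V -> R)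
    (vs : seq V) : V -> R :=
  if vs is v :: vs' then 'D_v (iter_derive f vs') else f.

Definition smooth (R : realType) (V : normedModType R) (f : V -> R) : Prop :=
  forall vs : seq V, continuous (iter_derive f vs) /\
    forall x v, derivable (iter_derive f vs) x v.

Section test_functions.
Context {R : realType} {N : nat}.
Implicit Types phi : R * 'rV[R]_N -> R.

(* The smooth functions with compact support in [0, T[ x T^N.  As usual on a
   set which is not open, smooth means: restriction of a smooth function, here
   of a function on R x T^N, i.e. of a function on R x R^N which is 1-periodic
   in each space variable.  Its values outside [0, T[ are irrelevant.  Since T^N
   is compact, compactness of the support only concerns the time variable. *)
Definition test_function (T : R) phi : Prop :=
  [/\ smooth phi,
      forall t x i, phi (t, x + delta_mx 0 i) = phi (t, x) &
      exists2 K : set R, compact K /\ K `<=` `[0, T[%classic &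
        forall t x, `[0, T[%classic t -> ~ K t -> phi (t, x) = 0].

Definition dt phi : R * 'rV[R]_N -> R := 'D_((1, 0) : R * 'rV[R]_N) phi.

Definition dx phi (i : 'I_N) : R * 'rV[R]_N -> R :=
  'D_((0, delta_mx 0 i) : R * 'rV[R]_N) phi.

Definition laplacian phi : R * 'rV[R]_N -> R :=
  fun p => \sum_(i < N) dx (dx phi i) i p.

Definition to_row (x : torus R N) : 'rV[R]_N := \row_i tnth x i.

Definition to_row_st (p : spacetime R N) : R * 'rV[R]_N := (p.1, to_row p.2).

End test_functions.

(* z is a distributional solution on Q_T of
   dt z - laplacian (mu z) = G, z(0, .) = z0.
   Meant for G and z0 integrable and mu measurable: otherwise the integrals on
   the right-hand side may take default values. *)
Definition is_solution (R : realType) (T : R) (N : nat)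
    (mu G : spacetime R N -> R) (z0 : torus R N -> R) (z : spacetime R N -> R) :
    Prop :=
  let Q := spacetime_measure T N in
  [/\ z \in Lfun Q 1%E,
      (fun p => z p * mu p) \in Lfun Q 1%E &
      forall phi : R * 'rV[R]_N -> R, test_function T phi ->
        - (\int[Q]_p (z p * (dt phi (to_row_st p)
                             + mu p * laplacian phi (to_row_st p)))) =
        (\int[torus_measure R N]_x (z0 x * phi (0, to_row x)))
        + (\int[Q]_p (G p * phi (to_row_st p)))].

Definition extraction (s : nat -> nat) : Prop := {homo s : m n / (m < n)%N}.

(* Main.v *)
(* With K an upper bound of all the R_n, put w = e^(-Kt) z, g = mu w and
   f = (K - R) w, so that d_t w - Laplacian g = - f with w, g, f >= 0.  Expand in
   a trigonometric basis of the torus, with eigenvalues lam_k.  Testing the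
   equation from time s on with the time integral of g gives, for almost every s,
     int_(s < t' < t) w g + (1/2) sum_k lam_k (int_s^t g_k)^2
       <= sum_k w_k(s) int_s^t g_k,
   because f and g are non-negative.  Starting at s = 0 it bounds (w_n) in L^2
   (mu_n is bounded away from 0 and bounded in L^1) and makes the high modes
   of the primitive of g_n uniformly small; extract w_n -> w weakly.  Averaging
   the inequality over windows t = s + h, only finitely many modes matter; there
   the window integrals of g_n converge strongly and pair with the weak limit.
   Letting h tend to 0, limsup int mu_n w_n^2 <= int mu w^2.  As sqrt(mu_n) w_n
   tends weakly to sqrt(mu) w, this forces strong convergence. *)

Require Import Defs.
From mathcomp Require Import all_boot all_order all_algebra.
From mathcomp Require Import all_classical all_reals all_analysis.
From mathcomp Require Import measurable_realfun ess_sup_inf.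
From mathcomp Require Import zify ring lra.

Set Implicit Arguments.
Unset Strict Implicit.
Unset Printing Implicit Defensive.

Import Order.TTheory GRing.Theory Num.Theory.
Import numFieldNormedType.Exports.

Local Open Scope classical_set_scope.
Local Open Scope ring_scope.

(** * Real-valued integrals and square-integrable functions *)

(** The obstacle: the coefficients mu_n are bounded uniformly only from below and in L^1. The flux
    g_n = mu_n w_n is therefore controlled in L^1 only, its limit can be identified against bounded
    functions only, and in the energy it multiplies a w_n that converges only weakly. Hence the
    factor sqrt(mu_n) w_n: its squared L^2 norm is the energy, and it has a weak limit because
    sqrt(mu_n) converges strongly in L^2. Positivity replaces missing bounds: since g >= 0, each
    mode of its primitive is bounded by the L^1 norm of g. No time derivative and no trace is taken.
    The equation is read mode by mode as an identity between time primitives, valid at almost every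
    time, so that almost every s can serve as initial time. Windows ]s, s + h[ with s >= 0 give full
    weight to times t >= h only; the layer ]0, h[ is estimated separately from the initial datum.
    The number of modes kept depends on h, hence a tail estimate uniform in h is needed for the
    limits of the windowed modes. *)

Section real_integral.
Context d (X : measurableType d) (R : realType).
Variable mu : {measure set X -> \bar R}.
Implicit Types (f g h : X -> R).

Definition intg f := mu.-integrable setT (EFin \o f).

Definition rint f : R := \int[mu]_x f x.

Lemma intg_measurable f : intg f -> measurable_fun setT f.
Proof. by move=> /(measurable_int mu)/measurable_EFinP. Qed.

Lemma intg_dom f g : measurable_fun setT f -> intg g ->
  (forall x, `|f x| <= g x) -> intg f.
Proof.
move=> mf ig fg; apply: (le_integrable measurableT _ _ ig).
  exact/measurable_EFinP.
by move=> x _; rewrite /= lee_fin (le_trans (fg x))// ler_norm.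
Qed.

Lemma intgD f g : intg f -> intg g -> intg (fun x => f x + g x).
Proof.
move=> i1 i2; have := integrableD measurableT i1 i2.
by apply: eq_integrable => // x _; rewrite /= EFinD.
Qed.

Lemma intgZ a f : intg f -> intg (fun x => a * f x).
Proof.
move=> i1; have := integrableZl measurableT a i1.
by apply: eq_integrable => // x _; rewrite /= EFinM.
Qed.

Lemma intgN f : intg f -> intg (fun x => - f x).
Proof.
move=> /(intgZ (-1)); congr intg; apply/funext => x; by rewrite mulN1r.
Qed.

Lemma intgB f g : intg f -> intg g -> intg (fun x => f x - g x).
Proof. by move=> i1 /intgN; exact: intgD. Qed.

Lemma intg0 : intg (fun=> 0).
Proof.
have := @integrable0 _ X R mu setT.
by apply: eq_integrable.
Qed.

Lemma intg_sum (I : Type) (s : seq I) (P : pred I) (F : I -> X -> R) :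
  (forall i, intg (F i)) -> intg (fun x => \sum_(i <- s | P i) F i x).
Proof.
move=> iF; elim: s => [|i s IHs].
  by under eq_fun do rewrite big_nil; exact: intg0.
under eq_fun do rewrite big_cons.
by case: (P i) => //; exact: intgD.
Qed.

Lemma intg_norm f : intg f -> intg (fun x => `|f x|).
Proof.
by move=> /integrable_norm; apply: eq_integrable.
Qed.

Lemma intg_ae f g : measurable_fun setT g -> (\forall x \ae mu, f x = g x) ->
  intg f -> intg g.
Proof.
move=> mg fg /integrableP[mf fi]; apply/integrableP; split.
  exact/measurable_EFinP.
suff -> : (\int[mu]_x `|(EFin \o g) x| = \int[mu]_x `|(EFin \o f) x|)%E by [].
apply: ae_eq_integral => //.
- by apply: measurableT_comp => //; exact/measurable_EFinP.
- exact: measurableT_comp.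
- by apply: filterS fg => x /= -> _.
Qed.

Lemma intgM f g M : intg f -> measurable_fun setT g ->
  (forall x, `|g x| <= M) -> intg (fun x => f x * g x).
Proof.
move=> fi mg gM; apply: (@intg_dom _ (fun x => M * `|f x|)).
- by apply: measurable_funM => //; exact: intg_measurable.
- by apply: intgZ; exact: intg_norm.
- by move=> x; rewrite normrM mulrC ler_wpM2r.
Qed.

Lemma rintD f g : intg f -> intg g ->
  rint (fun x => f x + g x) = rint f + rint g.
Proof. by move=> i1 i2; exact: RintegralD. Qed.

Lemma rintB f g : intg f -> intg g ->
  rint (fun x => f x - g x) = rint f - rint g.
Proof. by move=> i1 i2; exact: RintegralB. Qed.

Lemma rintZ a f : intg f -> rint (fun x => a * f x) = a * rint f.
Proof. by move=> i1; exact: RintegralZl. Qed.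

Lemma rint0 : rint (fun=> 0) = 0.
Proof. by rewrite /rint /Rintegral integral0. Qed.

Lemma rintN f : intg f -> rint (fun x => - f x) = - rint f.
Proof.
move=> i1; rewrite -mulN1r -rintZ//; congr rint.
by apply/funext => x; rewrite mulN1r.
Qed.

Lemma rint_sum (I : Type) (s : seq I) (P : pred I) (F : I -> X -> R) :
  (forall i, intg (F i)) ->
  rint (fun x => \sum_(i <- s | P i) F i x) = \sum_(i <- s | P i) rint (F i).
Proof.
move=> iF; elim: s => [|i s IHs].
  by under eq_fun do rewrite big_nil; rewrite rint0 big_nil.
under eq_fun do rewrite big_cons; rewrite big_cons.
by case: (P i) => //; rewrite rintD ?IHs//; exact: intg_sum.
Qed.

Lemma rint_ae f g : measurable_fun setT f -> measurable_fun setT g ->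
  (\forall x \ae mu, f x = g x) -> rint f = rint g.
Proof.
move=> mf mg fg; congr fine; apply: ae_eq_integral => //.
- exact/measurable_EFinP.
- exact/measurable_EFinP.
- by apply: filterS fg => x /= -> _.
Qed.

Lemma rint_ge0 f : (forall x, 0 <= f x) -> 0 <= rint f.
Proof. by move=> f0; exact: Rintegral_ge0. Qed.

Lemma rint_le f g : intg f -> intg g -> (forall x, f x <= g x) ->
  rint f <= rint g.
Proof. by move=> i1 i2 fg; exact: le_Rintegral. Qed.

Lemma rint_le_ae f g : intg f -> intg g -> (\forall x \ae mu, f x <= g x) ->
  rint f <= rint g.
Proof.
move=> i1 i2 fg.
have mf := intg_measurable i1; have mg := intg_measurable i2.
have mh : measurable_fun setT (fun x => Num.max (f x) (g x)).
  exact: measurable_maxr.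
have e : \forall x \ae mu, g x = Num.max (f x) (g x).
  by apply: filterS fg => x /max_idPr ->.
rewrite (rint_ae mg mh e); apply: rint_le => //.
- exact: intg_ae e _.
- by move=> x; rewrite le_max lexx.
Qed.

Lemma rint_abs f : intg f -> `|rint f| <= rint (fun x => `|f x|).
Proof. by move=> i1; exact: le_normr_Rintegral. Qed.

Lemma rintE f : intg f -> (rint f)%:E = (\int[mu]_x (f x)%:E)%E.
Proof. by move=> fi; rewrite fineK//; exact: integrable_fin_num. Qed.

Lemma intg_ge0_fin f : measurable_fun setT f -> (forall x, 0 <= f x) ->
  (\int[mu]_x (f x)%:E < +oo)%E -> intg f.
Proof.
move=> mf f0 fi; apply/integrableP; split; first exact/measurable_EFinP.
by under eq_integral do rewrite /= ger0_norm//.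
Qed.

Lemma rint_eq0 f : intg f -> (forall x, 0 <= f x) -> rint f = 0 ->
  \forall x \ae mu, f x = 0.
Proof.
move=> fi f0 rf; have mf := intg_measurable fi.
have : (\int[mu]_x `|(EFin \o f) x| = 0)%E.
  under eq_integral do rewrite /= ger0_norm//.
  by rewrite -rintE// rf.
move=> /ae_eq_integral_abs; move=> /(_ measurableT).
have /[swap] /[apply] : measurable_fun setT (EFin \o f).
  exact/measurable_EFinP.
by apply: filterS => x /(_ I) [].
Qed.

Lemma rdct (fn : nat -> X -> R) f g :
  (forall n, measurable_fun setT (fn n)) -> measurable_fun setT f ->
  (\forall x \ae mu, fn n x @[n --> \oo] --> f x) -> intg g ->
  (forall n, \forall x \ae mu, `|fn n x| <= g x) ->
  intg f /\ rint (fn n) @[n --> \oo] --> rint f.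
Proof.
move=> mfn mf fnf gi fng.
have [|||||fi _ c] := @dominated_convergence _ _ _ mu setT measurableT
  (fun n => EFin \o fn n) (EFin \o f) (EFin \o g).
- by move=> n; exact/measurable_EFinP.
- exact/measurable_EFinP.
- apply: filterS fnf => x fx _; apply: cvg_EFin => //.
  by near=> n.
- exact: gi.
- have := ae_foralln fng; apply: filterS => x h n _.
  by rewrite /= lee_fin.
split=> //.
have e : (\int[mu]_x (EFin \o f) x)%E = (rint f)%:E by rewrite rintE.
by move: c; rewrite e => /fine_cvg.
Unshelve. all: by end_near. Qed.

End real_integral.

Section square_integrable.
Context d (X : measurableType d) (R : realType).
Variable mu : {finite_measure set X -> \bar R}.
Implicit Types (f g h : X -> R).
Local Notation intg := (intg mu).
Local Notation rint := (rint mu).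

(** A predicate on functions rather than on classes: sections at a fixed time, pointwise signs and
    truncations are used throughout. *)
Definition sqi f := measurable_fun setT f /\ intg (fun x => f x ^+ 2).

Definition ip f g : R := rint (fun x => f x * g x).

Lemma intg_bnd f M : measurable_fun setT f -> (forall x, `|f x| <= M) -> intg f.
Proof.
move=> mf fM; apply: measurable_bounded_integrable => //.
  by rewrite ltey_eq fin_num_measure.
exists M; split; first by rewrite num_real.
by move=> N MN x _; apply: le_trans (fM x) _; exact: ltW.
Qed.

Lemma sqi_bnd f M : measurable_fun setT f -> (forall x, `|f x| <= M) -> sqi f.
Proof.
move=> mf fM; split=> //; apply: (@intg_bnd _ (M ^+ 2)).
  exact: measurable_funX.
by move=> x; rewrite normrX lerXn2r// nnegrE (le_trans _ (fM x)).
Qed.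

Lemma sqi_intgM f g : sqi f -> sqi g -> intg (fun x => f x * g x).
Proof.
move=> [mf f2] [mg g2]; apply: (@intg_dom _ _ _ _ _
  (fun x => f x ^+ 2 + g x ^+ 2)).
- exact: measurable_funM.
- exact: intgD.
- move=> x; rewrite normrM -(real_normK (num_real (f x))).
  rewrite -(real_normK (num_real (g x))).
  by have := normr_ge0 (f x); have := normr_ge0 (g x); nra.
Qed.

Lemma sqi_intg f : sqi f -> intg f.
Proof.
move=> sf; have /(sqi_intgM sf) : sqi (fun=> 1).
  by apply: (@sqi_bnd _ 1) => // x; rewrite normr1.
by congr (intg _); apply/funext => x; rewrite mulr1.
Qed.

Lemma sqi_measurable f : sqi f -> measurable_fun setT f. Proof. by case. Qed.

Lemma sqiZ a f : sqi f -> sqi (fun x => a * f x).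
Proof.
move=> [mf f2]; split; first exact: measurable_funM.
by under eq_fun do rewrite exprMn; exact: intgZ.
Qed.

Lemma sqiD f g : sqi f -> sqi g -> sqi (fun x => f x + g x).
Proof.
move=> sf sg; have [mf f2] := sf; have [mg g2] := sg.
split; first exact: measurable_funD.
under eq_fun do rewrite sqrrD.
apply: intgD => //; apply: intgD => //.
under eq_fun do rewrite -mulr_natl.
by apply: intgZ; exact: sqi_intgM.
Qed.

Lemma sqiN f : sqi f -> sqi (fun x => - f x).
Proof.
by move=> [mf f2]; split; [exact: measurableT_comp|under eq_fun do rewrite sqrrN].
Qed.

Lemma sqiB f g : sqi f -> sqi g -> sqi (fun x => f x - g x).
Proof. by move=> sf /sqiN; exact: sqiD. Qed.

Lemma sqi_sum (I : Type) (s : seq I) (P : pred I) (F : I -> X -> R) :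
  (forall i, sqi (F i)) -> sqi (fun x => \sum_(i <- s | P i) F i x).
Proof.
move=> iF; elim: s => [|i s IHs].
  under eq_fun do rewrite big_nil.
  by apply: (@sqi_bnd _ 0) => // x; rewrite normr0.
under eq_fun do rewrite big_cons.
by case: (P i) => //; exact: sqiD.
Qed.

Lemma sqiM f g M : sqi f -> measurable_fun setT g ->
  (forall x, `|g x| <= M) -> sqi (fun x => f x * g x).
Proof.
move=> [mf f2] mg gM; split; first exact: measurable_funM.
under eq_fun do rewrite exprMn.
apply: (@intgM _ _ _ _ _ _ (M ^+ 2)) => //; first exact: measurable_funX.
by move=> x; rewrite normrX lerXn2r// nnegrE (le_trans _ (gM x)).
Qed.

Lemma ipC f g : ip f g = ip g f.
Proof. by congr rint; apply/funext => x; rewrite mulrC. Qed.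

Lemma ipZl a f h : sqi f -> sqi h -> ip (fun x => a * f x) h = a * ip f h.
Proof.
move=> sf sh; rewrite /ip -rintZ; last exact: sqi_intgM.
by congr rint; apply/funext => x; rewrite mulrA.
Qed.

Lemma ipBl f g h : sqi f -> sqi g -> sqi h ->
  ip (fun x => f x - g x) h = ip f h - ip g h.
Proof.
move=> sf sg sh; rewrite /ip -rintB; [|exact: sqi_intgM..].
by congr rint; apply/funext => x; rewrite mulrBl.
Qed.

Lemma ip_suml (I : Type) (s : seq I) (P : pred I) (F : I -> X -> R) h :
  (forall i, sqi (F i)) -> sqi h ->
  ip (fun x => \sum_(i <- s | P i) F i x) h = \sum_(i <- s | P i) ip (F i) h.
Proof.
move=> sF sh; rewrite /ip -rint_sum; last by move=> i; exact: sqi_intgM.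
by congr rint; apply/funext => x; rewrite mulr_suml.
Qed.

Lemma ip_sqr f : ip f f = rint (fun x => f x ^+ 2).
Proof. by congr rint; apply/funext => x; rewrite expr2. Qed.

Lemma ip_ge0 f : 0 <= ip f f.
Proof. by apply: rint_ge0 => x; rewrite -expr2 sqr_ge0. Qed.

(** Discriminant of the nonnegative polynomial t -> |t f - g|^2; the squared form avoids square
    roots. *)
Lemma cauchy_schwarz f g : sqi f -> sqi g -> ip f g ^+ 2 <= ip f f * ip g g.
Proof.
move=> sf sg.
have H t : 0 <= t ^+ 2 * ip f f - 2 * t * ip f g + ip g g.
  have := ip_ge0 (fun x => t * f x - g x).
  have stf := sqiZ t sf.
  rewrite ipBl//; last exact: sqiB.
  rewrite ipZl//; last exact: sqiB.
  rewrite ![ip _ (fun _ => _ - _)]ipC !ipBl// !ipZl// [ip g f]ipC.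
  by rewrite (_ : _ - _ = t ^+ 2 * ip f f - 2 * t * ip f g + ip g g)//; ring.
have [f0|f0] := eqVneq (ip f f) 0.
  rewrite f0 mul0r.
  have [->|fg0] := eqVneq (ip f g) 0; first by rewrite expr0n.
  (* With leading coefficient 0 the polynomial is affine and takes the value -1 here. *)
  have := H ((ip g g + 1) / (2 * ip f g)); rewrite f0 mulr0 add0r.
  rewrite (_ : - _ + _ = -1) ?ler0N1//.
  by field.
have fp : 0 < ip f f by rewrite lt_neqAle eq_sym f0 ip_ge0.
have := H (ip f g / ip f f).
rewrite (_ : _ + _ = ip g g - ip f g ^+ 2 / ip f f); last by field.
by rewrite subr_ge0 ler_pdivrMr// mulrC.
Qed.

Lemma ip_young f g a : 0 < a -> sqi f -> sqi g ->
  `|ip f g| <= a * ip f f + ip g g / a.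
Proof.
move=> a0 sf sg; have [_ f2] := sf; have [_ g2] := sg.
apply: (le_trans (rint_abs (sqi_intgM sf sg))).
have -> : a * ip f f + ip g g / a =
    rint (fun x => a * (f x ^+ 2) + a^-1 * (g x ^+ 2)).
  rewrite rintD; [|exact: intgZ..].
  by rewrite !rintZ// -!ip_sqr [a^-1 * _]mulrC.
apply: rint_le.
- by apply: intg_norm; exact: sqi_intgM.
- by apply: intgD; exact: intgZ.
move=> x; rewrite normrM -(real_normK (num_real (f x))).
rewrite -(real_normK (num_real (g x))).
move: (normr_ge0 (f x)) (normr_ge0 (g x)); move: `|f x| `|g x| => u v u0 v0.
rewrite -(ler_pM2l a0) mulrDr mulrA mulVKf ?gt_eqF//.
by have := sqr_ge0 (a * u - v); nra.
Qed.

(** Fatou's lemma in a form that also yields integrability of the limit, which the completeness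
    proof does not know beforehand. *)
Lemma rfatou (hn : nat -> X -> R) h M : (forall n, intg (hn n)) ->
  (forall n x, 0 <= hn n x) -> measurable_fun setT h -> (forall x, 0 <= h x) ->
  (\forall x \ae mu, hn n x @[n --> \oo] --> h x) ->
  (forall n, rint (hn n) <= M) -> intg h /\ rint h <= M.
Proof.
move=> hni hn0 mh h0 hnh hM.
have mhn n : measurable_fun setT (EFin \o hn n).
  by apply/measurable_EFinP; exact: intg_measurable (hni n).
have le : (\int[mu]_x (h x)%:E <= M%:E)%E.
  have -> : (\int[mu]_x (h x)%:E =
      \int[mu]_x (limn_einf (fun n => (EFin \o hn n) x)))%E.
    apply: ae_eq_integral => //.
    - exact/measurable_EFinP.
    - rewrite (_ : (fun _ => _) = -%E \o
          (fun x => limn_esup (fun n => (- (EFin \o hn n) x)%E))); last first.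
        apply/funext => x /=; rewrite -limn_einfN; congr limn_einf.
        by apply/funext => n /=; rewrite opprK.
      apply: measurableT_comp => //; apply: measurable_fun_limn_esup => n.
      exact: measurableT_comp.
    - apply: filterS hnh => x hx _.
      have c : ((EFin \o hn n) x) @[n --> \oo] --> (h x)%:E.
        by apply: cvg_EFin => //; near=> n.
      by rewrite (cvg_limn_einf_sup c).1.
  apply: (le_trans (fatou mu measurableT mhn _)).
    by move=> n x _; rewrite /= lee_fin.
  apply: (le_trans (limn_einf_sup _)).
  rewrite limn_esup_lim; apply: lime_le; first exact: is_cvg_esups.
  near=> n; apply: ge_ereal_sup => _ [k /= nk <-].
  by rewrite -[leLHS]rintE// lee_fin.
have hi : intg h.
  by apply: intg_ge0_fin => //; rewrite (le_lt_trans le)// ltry.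
by split=> //; rewrite -lee_fin rintE.
Unshelve. all: by end_near. Qed.

End square_integrable.

(** * Completeness of L^2 *)

Section riesz_fischer.
Context d (X : measurableType d) (R : realType).
Variable mu : {finite_measure set X -> \bar R}.
Implicit Types (f g h : X -> R).
Local Notation intg := (intg mu).
Local Notation rint := (rint mu).
Local Notation sqi := (sqi mu).
Local Notation ip := (ip mu).

Definition nrm2 f : R := ip f f.

Lemma nrm2B f g : nrm2 (fun x => f x - g x) = nrm2 (fun x => g x - f x).
Proof. by congr rint; apply/funext => x; ring. Qed.

(** From |d| <= 2^k d^2 + 2^-k, the integral of |d_k| is at most 2^-k (1 + mu(X)); hence the sum of
    the |d_k| is integrable, and finite almost everywhere. *)
Lemma sqi_series_cvg (dk : nat -> X -> R) : (forall k, sqi (dk k)) ->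
  (forall k, nrm2 (dk k) <= (4^-1) ^+ k) ->
  \forall x \ae mu, cvgn (series (dk^~ x)).
Proof.
move=> sd dle; pose C := 1 + rint (fun=> 1).
have sn k : intg (fun x => `|dk k x|) by apply: intg_norm; exact: sqi_intg.
have i1 : intg (fun=> 1) by apply: (@intg_bnd _ _ _ _ _ 1) => // x; rewrite normr1.
have bnd k : rint (fun x => `|dk k x|) <= (2^-1) ^+ k * C.
  apply: (@le_trans _ _ (rint (fun x => 2 ^+ k * (dk k x ^+ 2) + 2^-1 ^+ k * 1))).
    apply: rint_le => //.
      by apply: intgD; apply: intgZ => //; case: (sd k).
    move=> x; rewrite mulr1 exprVn -(real_normK (num_real (dk k x))).
    have : 0 < 2 ^+ k :> R by rewrite exprn_gt0.
    move: (2 ^+ k) (`|_|) (normr_ge0 (dk k x)) => a u u0 a0.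
    rewrite -(ler_pM2l a0) mulrDr mulfV ?gt_eqF//.
    by have := sqr_ge0 (a * u - 2^-1); nra.
  rewrite rintD; [|by apply: intgZ; case: (sd k)|exact: intgZ].
  rewrite !rintZ//; last by case: (sd k).
  rewrite -ip_sqr mulrDr mulr1 lerD2r.
  apply: le_trans (_ : 2 ^+ k * 4^-1 ^+ k <= _).
    by rewrite ler_wpM2l// ?exprn_ge0//; exact: dle.
  by rewrite -exprMn (_ : 2 * 4^-1 = 2^-1)//; field.
have C0 : 0 <= C by rewrite addr_ge0// rint_ge0.
pose S x := (\sum_(0 <= k <oo) (`|dk k x|)%:E)%E.
have mnk k : measurable_fun setT (fun x => (`|dk k x|)%:E).
  by apply/measurable_EFinP; exact: intg_measurable (sn k).
have mS : measurable_fun setT S.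
  by apply: (@ge0_emeasurable_sum _ _ _ _ (fun k x => (`|dk k x|)%:E) xpredT).
have S0 x : (0 <= S x)%E by apply: nneseries_ge0.
have Sle : (\int[mu]_x S x <= (2 * C)%:E)%E.
  rewrite integral_nneseries//.
  apply: lime_le; first by apply: is_cvg_nneseries => k _ _; exact: integral_ge0.
  near=> n.
  under eq_bigr do rewrite -rintE//.
  rewrite sumEFin lee_fin.
  apply: (@le_trans _ _ (\sum_(0 <= k < n) 2^-1 ^+ k * C)); first exact: ler_sum.
  rewrite -mulr_suml ler_wpM2r//.
  have -> : \sum_(0 <= i < n) 2^-1 ^+ i = 2 - 2 * 2^-1 ^+ n :> R.
    elim: (n) => [|m IHm]; first by rewrite big_nil expr0 mulr1 subrr.
    by rewrite big_nat_recr//= IHm exprS; field.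
  by rewrite gerBl mulr_ge0// exprn_ge0// invr_ge0.
have iS : mu.-integrable setT S.
  apply/integrableP; split => //.
  under eq_integral do rewrite gee0_abs//.
  by rewrite (le_lt_trans Sle)// ltry.
have := integrable_ae measurableT iS; apply: filterS => x /(_ I).
rewrite ge0_fin_numE// => Sx.
have c : cvgn (series (fun k => `|dk k x|)) by exact: nnseries_is_cvg.
exact: (@normed_cvg R R^o (dk^~ x) c).
Unshelve. all: by end_near. Qed.

(** A fast subsequence converges almost everywhere; Fatou's lemma along it bounds the distance from
    its limit to every late term of the whole sequence. *)
Lemma riesz_fischer (fn : nat -> X -> R) : (forall n, sqi (fn n)) ->
  (forall e, 0 < e -> exists N, forall m n, (N <= m)%N -> (N <= n)%N ->
     nrm2 (fun x => fn m x - fn n x) <= e) ->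
  exists2 f, sqi f & nrm2 (fun x => fn n x - f x) @[n --> \oo] --> 0.
Proof.
move=> sfn cau.
have /choice [K KP] k : exists N, forall m n, (N <= m)%N -> (N <= n)%N ->
    nrm2 (fun x => fn m x - fn n x) <= (4^-1) ^+ k.
  by apply: cau; rewrite exprn_gt0.
(* Dominates [k] and every [K i] with i <= k, so that [s k] and [s k.+1] both lie beyond [K k]. *)
pose s k := (k + \sum_(i < k.+1) K i)%N.
have sK k i : (i <= k)%N -> (K i <= s k)%N.
  by move=> ik; rewrite /s (bigD1 (Ordinal (ik : (i < k.+1)%N)))//= addnCA leq_addr.
pose dk k x := fn (s k.+1) x - fn (s k) x.
have sdk k : sqi (dk k) by exact: sqiB.
have dle k : nrm2 (dk k) <= (4^-1) ^+ k.
  by apply: KP; apply: sK.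
have c := sqi_series_cvg sdk dle.
(* The upper limit in the extended reals exists everywhere and is measurable; off the set of
   convergence its value is irrelevant. *)
pose f x := fine (limn_esup (fun k => (EFin \o fn (s k)) x)).
have mf : measurable_fun setT f.
  apply: measurableT_comp; first exact: fine_measurable.
  apply: measurable_fun_limn_esup => k; apply/measurable_EFinP.
  exact: sqi_measurable.
have fsf : \forall x \ae mu, fn (s k) x @[k --> \oo] --> f x.
  apply: filterS c => x cx.
  have cx' : cvgn (fun k => fn (s k) x).
    rewrite (_ : (fun k => _) = (fun k => fn (s 0%N) x + series (dk^~ x) k)).
      by apply: is_cvgD => //; exact: is_cvg_cst.
    apply/funext => k; have := eq_sum_telescope (fun k => fn (s k) x) k.
    by move=> ->.
  have e : (EFin \o fn (s k)) x @[k --> \oo] --> (limn (fun k => fn (s k) x))%:E.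
    by apply: cvg_EFin => //; near=> n.
  by rewrite /f (cvg_limn_einf_sup e).2 /=.
have key e : 0 < e -> exists N, forall n, (N <= n)%N ->
    intg (fun x => (fn n x - f x) ^+ 2) /\ nrm2 (fun x => fn n x - f x) <= e.
  move=> e0; have [N NP] := cau e e0; exists N => n Nn.
  have -> : nrm2 (fun x => fn n x - f x) = rint (fun x => (fn n x - f x) ^+ 2).
    by rewrite /nrm2 ip_sqr.
  apply: (@rfatou _ _ _ mu (fun k x => (fn n x - fn (s (k + N)%N) x) ^+ 2)).
  - by move=> k; case: (sqiB (sfn n) (sfn (s (k + N)%N))).
  - by move=> k x; exact: sqr_ge0.
  - apply: measurable_funX; apply: measurable_funB => //.
    exact: sqi_measurable.
  - by move=> x; exact: sqr_ge0.
  - apply: filterS fsf => x fx; rewrite expr2.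
    under eq_cvg do rewrite expr2.
    suff h : fn n x - fn (s (k + N)%N) x @[k --> \oo] --> fn n x - f x.
      exact: cvgM.
    apply: cvgB; first exact: cvg_cst.
    by have := fx; rewrite -(cvg_shiftn N).
  - move=> k; rewrite -ip_sqr; apply: NP => //.
    by rewrite (leq_trans (leq_addl k N))// leq_addr.
have [N0 /(_ _ (leqnn _)) [f0 _]] := key 1 ltr01.
exists f.
  (* [f] is recovered as fn N0 - (fn N0 - f), a difference of square-integrable functions. *)
  have /(sqiB (sfn N0)) : sqi (fun x => fn N0 x - f x).
    split=> //; apply: measurable_funB => //; exact: sqi_measurable.
  by congr (sqi _); apply/funext => x; rewrite subKr.
apply/cvgrPdist_le => e e0; have [N NP] := key e e0.
near=> n; rewrite sub0r normrN ger0_norm ?ip_ge0//.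
by have [] // := NP n; near: n; exact: nbhs_infty_ge.
Unshelve. all: by end_near. Qed.

End riesz_fischer.

(** * Fubini's theorem for real-valued integrals *)

Section fubini.
Context d1 d2 (X : measurableType d1) (Y : measurableType d2) (R : realType).
Variables (m1 : {finite_measure set X -> \bar R})
          (m2 : {finite_measure set Y -> \bar R}).
Implicit Type F : X * Y -> R.
Local Notation Q := (finite_prod m1 m2).

(** The inner integral of Fubini's theorem may be infinite on a null set; [fine] gives it a real
    default there without changing the outer integral. *)
Lemma fine_intg d (Z : measurableType d) (mu : {measure set Z -> \bar R}) G :
  mu.-integrable setT G ->
  intg mu (fine \o G) /\ rint mu (fine \o G) = fine (\int[mu]_x G x).
Proof.
move=> iG; have [mG _] := integrableP _ _ _ iG.
have m : measurable_fun setT (fine \o G).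
  by apply: measurableT_comp mG; exact: fine_measurable.
split.
  apply: (le_integrable measurableT _ _ iG); first exact/measurable_EFinP.
  by move=> x _ /=; case: (G x) => //= *; rewrite ?normr0 ?leey.
congr fine; apply: ae_eq_integral => //; first exact/measurable_EFinP.
have := integrable_ae measurableT iG.
by apply: filterS => x /(_ I) xf _ /=; rewrite fineK.
Qed.

Lemma fubini1 F : intg Q F ->
  intg m1 (fun x => rint m2 (fun y => F (x, y))) /\
  rint Q F = rint m1 (fun x => rint m2 (fun y => F (x, y))).
Proof.
move=> iF; have iF' : (m1 \x m2)%E.-integrable setT (EFin \o F) by [].
have [i e] := fine_intg (integrable_fubini_F iF').
by split=> //; rewrite [RHS]e integral12_prod_meas1.
Qed.

Lemma fubini2 F : intg Q F ->
  intg m2 (fun y => rint m1 (fun x => F (x, y))) /\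
  rint Q F = rint m2 (fun y => rint m1 (fun x => F (x, y))).
Proof.
move=> iF; have iF' : (m1 \x m2)%E.-integrable setT (EFin \o F) by [].
have iG : m2.-integrable setT (fubini_G m1 (EFin \o F)).
  apply/integrableP; split; first exact: measurable_fubini_G iF'.
  have mF : measurable_fun setT (EFin \o F) by case/integrableP : iF'.
  apply: le_lt_trans ((integrable21ltyP m1 m2 mF).1 iF').
  apply: ge0_le_integral => //.
  - by apply: measurableT_comp => //; exact: measurable_fubini_G iF'.
  - apply: (@measurable_fun_fubini_tonelli_G _ _ _ _ _ m1 (abse \o (EFin \o F))).
      exact: measurableT_comp.
    by move=> ?; exact: abse_ge0.
  - move=> y _; apply: le_abse_integral => //; exact: measurable_fun_pair1.
have [i e] := fine_intg iG.
by split=> //; rewrite [RHS]e integral21_prod_meas1.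
Qed.

Lemma ae_intg1 F : intg Q F -> \forall x \ae m1, intg m2 (fun y => F (x, y)).
Proof. by move=> iF; exact: (@ae_integrable1 _ _ _ _ _ m1 m2 (EFin \o F)). Qed.

Lemma ae_sqi1 F : sqi Q F -> \forall x \ae m1, sqi m2 (fun y => F (x, y)).
Proof.
move=> [mF /ae_intg1]; apply: filterS => x h; split => //.
exact: measurable_fun_pair2.
Qed.

Lemma ae_fst (P : X -> Prop) : (\forall x \ae m1, P x) ->
  \forall p \ae Q, P p.1.
Proof.
move=> [A [mA A0 sA]]; exists (A `*` setT); split.
- exact: measurableX.
- transitivity (m1 A * m2 setT)%E; first exact: product_measure1E.
  by rewrite A0 mul0e.
- by move=> [x y] /= h; split=> //; exact: sA.
Qed.

Lemma ae_snd (P : Y -> Prop) : (\forall y \ae m2, P y) ->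
  \forall p \ae Q, P p.2.
Proof.
move=> [A [mA A0 sA]]; exists (setT `*` A); split.
- exact: measurableX.
- transitivity (m1 setT * m2 A)%E; first exact: product_measure1E.
  by rewrite A0 mule0.
- by move=> [x y] /= h; split=> //; exact: sA.
Qed.

Lemma intg_fst (f : X -> R) : intg m1 f -> intg Q (fun p => f p.1).
Proof.
move=> fi; have mf := intg_measurable fi.
have mf1 : measurable_fun setT (EFin \o (fun p : X * Y => f p.1)).
  by apply/measurable_EFinP; apply: measurableT_comp => //; exact: measurable_fst.
apply/(integrable12ltyP m1 m2 mf1) => /=.
under eq_integral do rewrite integral_cst//.
have [_ fin] := integrableP _ _ _ fi.
rewrite ge0_integralZr//.
- by rewrite lte_mul_pinfty// ?integral_ge0// ?ltey_eq ?fin_num_measure//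
     ge0_fin_numE// integral_ge0.
- by apply/measurable_EFinP; apply: measurableT_comp.
Qed.

Lemma intg_snd (f : Y -> R) : intg m2 f -> intg Q (fun p => f p.2).
Proof.
move=> fi; have mf := intg_measurable fi.
have mf1 : measurable_fun setT (EFin \o (fun p : X * Y => f p.2)).
  by apply/measurable_EFinP; apply: measurableT_comp => //; exact: measurable_snd.
apply/(integrable21ltyP m1 m2 mf1) => /=.
under eq_integral do rewrite integral_cst//.
have [_ fin] := integrableP _ _ _ fi.
rewrite ge0_integralZr//.
- by rewrite lte_mul_pinfty// ?integral_ge0// ?ltey_eq ?fin_num_measure//
     ge0_fin_numE// integral_ge0.
- by apply/measurable_EFinP; apply: measurableT_comp.
Qed.

End fubini.

(** * Hilbert bases and weak compactness *)

(** Along an ultrafilter finer than the filter of cofinite sets all coordinates converge at once, by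
    compactness of segments. The subsequence is then chosen greedily, in place of nested
    extractions. *)
Lemma diagonal_extraction (R : realType) (c : nat -> nat -> R) :
  (forall j, exists B, forall n, `|c n j| <= B) ->
  exists2 s : nat -> nat, extraction s &
    exists l : nat -> R, forall j, c (s n) j @[n --> \oo] --> l j.
Proof.
move=> cB.
have [G [UG leG]] := ultraFilterLemma (eventually_filter).
have PG : ProperFilter G by exact: ultra_proper.
have /choice [l lP] j : exists l : R, c n j @[n --> G] --> l.
  have [B cBj] := cB j.
  have GB : (c^~ j @ G) `[- B, B]%classic.
    apply: leG; near=> n; rewrite /= in_itv/= -ler_norml; exact: cBj.
  have [p [_ clp]] := @segment_compact R (- B) B (c^~ j @ G) _ GB.
  exists p => U Up; have [//|GC] := in_ultra_setVsetC ((c^~ j) @^-1` U) UG.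
  by have [x [Cx Ux]] := clp (~` U) U GC Up.
(* Beyond the index [p.1], the first [p.2] coordinates are within 1 / [p.2] of their limits; for
   [p.2] = 0 this last condition is empty. *)
have /choice [g gP] (p : nat * nat) : exists n, (p.1 < n)%N /\
    forall j, (j < p.2)%N -> `|l j - c n j| <= p.2%:R^-1.
  case: p => p m /=.
  case: m => [|m]; first by exists p.+1.
  suff : G [set n | (p < n)%N /\
      forall j, (j < m.+1)%N -> `|l j - c n j| <= m.+1%:R^-1].
    by move=> /filter_ex[n [? ?]]; exists n.
  apply: filterI; first by apply: leG; exact: nbhs_infty_gt.
  have h (j : 'I_m.+1) : G [set n | `|l j - c n j| <= m.+1%:R^-1].
    have /cvgrPdist_le := lP j; apply; by rewrite invr_gt0.
  have {}h : G [set n | forall j : 'I_m.+1, `|l j - c n j| <= m.+1%:R^-1].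
    exact: filter_forall.
  apply: (filterS _ h) => n hn j jm.
  exact: (hn (Ordinal jm)).
pose s := fix s n := if n is n'.+1 then g (s n', n'.+1) else 0%N.
exists s.
  have s1 n : (s n < s n.+1)%N by have [] := gP (s n, n.+1).
  by apply: homo_ltn => //; exact: ltn_trans.
exists l => j; apply/cvgrPdist_le => e e0.
near=> n; have n0 : (0 < n)%N by near: n; exact: nbhs_infty_gt.
rewrite -(prednK n0) /=; have [_ /(_ j)] := gP (s n.-1, n.-1.+1); rewrite /= prednK//.
move=> h; apply: (le_trans (h _)); first by near: n; exact: nbhs_infty_gt.
rewrite -[leRHS]invrK lef_pV2 ?posrE ?invr_gt0 ?ltr0n//.
by near: n; exact: nbhs_infty_ger.
Unshelve. all: by end_near. Qed.

Lemma sqr_le_norm (R : realDomainType) (a b : R) : 0 <= b ->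
  a ^+ 2 <= b ^+ 2 -> `|a| <= b.
Proof.
move=> b0 h; rewrite -(@ler_pXn2r _ 2)// ?nnegrE//.
by rewrite real_normK// num_real.
Qed.

Lemma cvg_sqr0 (R : realType) (u : nat -> R) :
  u n ^+ 2 @[n --> \oo] --> 0 -> u n @[n --> \oo] --> 0.
Proof.
move=> h; apply/cvgrPdist_le => e e0.
have /cvgrPdist_le/(_ _ (exprn_gt0 2 e0)) := h.
apply: filterS => n; rewrite !sub0r !normrN normrX => le.
by rewrite -(@ler_pXn2r _ 2)// nnegrE ltW.
Qed.

Lemma cvg_bigsum (R : realType) (T : Type) (F : set_system T) (FF : Filter F)
    (I : Type) (r : seq I) (u : I -> T -> R) (l : I -> R) :
  (forall i, u i t @[t --> F] --> l i) ->
  \sum_(i <- r) u i t @[t --> F] --> \sum_(i <- r) l i.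
Proof.
move=> ul; elim: r => [|i r IHr].
  by rewrite big_nil; under eq_cvg do rewrite big_nil; exact: cvg_cst.
by rewrite big_cons; under eq_cvg do rewrite big_cons; exact: cvgD.
Qed.

Section orthonormal.
Context d (X : measurableType d) (R : realType).
Variable mu : {finite_measure set X -> \bar R}.
Implicit Types (f g h u v : X -> R).
Local Notation sqi := (sqi mu).
Local Notation ip := (ip mu).
Local Notation nrm2 := (nrm2 mu).

Lemma cvg_ip (fn : nat -> X -> R) f g : (forall n, sqi (fn n)) -> sqi f ->
  sqi g -> nrm2 (fun x => fn n x - f x) @[n --> \oo] --> 0 ->
  ip (fn n) g @[n --> \oo] --> ip f g.
Proof.
move=> sfn sf sg c; apply: (@cvg_sub0 _ _ _ _ _ _ (fun=> ip f g)); last exact: cvg_cst.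
apply: cvg_sqr0.
apply: (@squeeze_cvgr _ _ _ _ (fun=> 0) (fun n =>
     nrm2 (fun x => fn n x - f x) * nrm2 g)).
- near=> n; rewrite sqr_ge0/= -ipBl//; apply: cauchy_schwarz => //.
  exact: sqiB.
- exact: cvg_cst.
- rewrite -[X in _ --> X](mul0r (nrm2 g)); apply: cvgM => //; exact: cvg_cst.
Unshelve. all: by end_near. Qed.

(* Zero vectors are allowed so that a family over any countable type can be
   enumerated by nat through [pickle_inv]. *)
Definition hilbert_basis (e : nat -> X -> R) := [/\
  forall k, measurable_fun setT (e k) /\ exists M, forall x, `|e k x| <= M,
  forall i j, i != j -> ip (e i) (e j) = 0,
  forall k, ip (e k) (e k) = 1 \/ e k = (fun=> 0) &
  forall u, sqi u -> (forall k, ip u (e k) = 0) -> \forall x \ae mu, u x = 0].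

Section basis.
Variable e : nat -> X -> R.
Hypothesis he : hilbert_basis e.

Lemma basis_sqi k : sqi (e k).
Proof. by case: he => /(_ k)[mk [M kM]] _ _ _; exact: sqi_bnd mk kM. Qed.

Definition psum (a : nat -> R) n x := \sum_(k < n) a k * e k x.

Lemma psum_sqi a n : sqi (psum a n).
Proof. by apply: sqi_sum => i; apply: sqiZ; exact: basis_sqi. Qed.

Lemma ip_cst0 f : ip f (fun=> 0) = 0.
Proof. by rewrite /ip; under eq_fun do rewrite mulr0; exact: rint0. Qed.

(** A coefficient carried by a zero vector would count in the sum of the [a k ^+ 2] but not in the
    norm of [psum]. *)
Definition null_off (a : nat -> R) := forall k, e k = (fun=> 0) -> a k = 0.

Lemma null_off_coef f : null_off (fun k => ip f (e k)).
Proof. by move=> k ->; exact: ip_cst0. Qed.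

Lemma ip_psum_e a n k : null_off a ->
  ip (psum a n) (e k) = if (k < n)%N then a k else 0.
Proof.
move=> na; have [_ o nn _] := he.
rewrite ip_suml; last 2 first.
- by move=> i; apply: sqiZ; exact: basis_sqi.
- exact: basis_sqi.
transitivity (\sum_(i < n) a i * ip (e i) (e k)).
  by apply: eq_bigr => i _; rewrite ipZl//; exact: basis_sqi.
case: ifPn => kn.
  rewrite (bigD1 (Ordinal kn))//= big1 ?addr0; last first.
    by move=> i; rewrite -val_eqE /= => ik; rewrite o// mulr0.
  have [->|e0] := nn k; first by rewrite mulr1.
  by rewrite na// mul0r.
apply: big1 => i _; rewrite o ?mulr0//.
by apply: contraNneq kn => <-.
Qed.

Lemma ip_psum a f n : sqi f ->
  ip (psum a n) f = \sum_(k < n) a k * ip f (e k).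
Proof.
move=> sf; rewrite ip_suml//; last first.
  by move=> i; apply: sqiZ; exact: basis_sqi.
by apply: eq_bigr => i _; rewrite ipZl//; [rewrite ipC|exact: basis_sqi].
Qed.

Lemma nrm2_subr f g : sqi f -> sqi g ->
  nrm2 (fun x => f x - g x) = nrm2 f - 2 * ip f g + nrm2 g.
Proof.
move=> sf sg; have sfg := sqiB sf sg.
rewrite /nrm2 ipBl// ![ip _ (fun _ => _ - _)]ipC !ipBl// [ip g f]ipC.
by ring.
Qed.

Lemma nrm2_psum a n : null_off a -> nrm2 (psum a n) = \sum_(k < n) a k ^+ 2.
Proof.
move=> na; rewrite /nrm2 ip_psum; last exact: psum_sqi.
by apply: eq_bigr => i _; rewrite ip_psum_e// ltn_ord expr2.
Qed.

Lemma nrm2_psumB a m n : null_off a -> (m <= n)%N ->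
  nrm2 (fun x => psum a n x - psum a m x) =
  \sum_(k < n) a k ^+ 2 - \sum_(k < m) a k ^+ 2.
Proof.
move=> na mn; rewrite nrm2_subr; [|exact: psum_sqi..].
rewrite !nrm2_psum// ip_psum; last exact: psum_sqi.
have -> : \sum_(k < n) a k * ip (psum a m) (e k) = \sum_(k < m) a k ^+ 2.
  rewrite (big_ord_widen _ (fun k => a k ^+ 2) mn) [RHS]big_mkcond.
  apply: eq_bigr => i _; rewrite ip_psum_e//.
  by case: ifP => _; rewrite ?mulr0// expr2.
by ring.
Qed.

Lemma nrm2_remainder f n :
  sqi f -> nrm2 (fun x => f x - psum (fun k => ip f (e k)) n x) =
  nrm2 f - \sum_(k < n) ip f (e k) ^+ 2.
Proof.
move=> sf; rewrite nrm2_subr//; last exact: psum_sqi.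
rewrite nrm2_psum; last exact: null_off_coef.
rewrite [ip f _]ipC ip_psum//.
under eq_bigr do rewrite -expr2.
by ring.
Qed.

Lemma bessel f n : sqi f -> \sum_(k < n) ip f (e k) ^+ 2 <= nrm2 f.
Proof. by move=> sf; rewrite -subr_ge0 -nrm2_remainder// ip_ge0. Qed.

(** Partial sums form a Cauchy sequence, since the squared norm of a difference of two of them is a
    difference of partial sums of a convergent series; continuity of [ip] identifies the
    coefficients of the limit. *)
Lemma synthesis a C : null_off a -> (forall n, \sum_(k < n) a k ^+ 2 <= C) ->
  exists v, [/\ sqi v, forall k, ip v (e k) = a k &
    nrm2 (fun x => psum a n x - v x) @[n --> \oo] --> 0].
Proof.
move=> na aC.
pose S n := \sum_(k < n) a k ^+ 2.
have homS : {homo S : m n / (m <= n)%N >-> m <= n}.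
  apply: homo_leq => //; first by move=> x y z; exact: le_trans.
  by move=> n; rewrite /S big_ord_recr /= lerDl sqr_ge0.
have cS : cvgn S.
  apply: nondecreasing_is_cvgn => //; exists C => _ [n _ <-]; exact: aC.
have [v sv vc] : exists2 v, sqi v &
    nrm2 (fun x => psum a n x - v x) @[n --> \oo] --> 0.
  apply: riesz_fischer => [n|eps eps0]; first exact: psum_sqi.
  have /cvgrPdist_le/(_ (eps / 2)) := cS.
  rewrite divr_gt0// => /(_ isT)[N _ NP]; exists N => m n Nm Nn.
  have key i j : (N <= i)%N -> (i <= j)%N -> S j - S i <= eps.
    move=> Ni ij; have := NP i Ni; have := NP j (leq_trans Ni ij).
    rewrite /= !ler_distl => /andP[a1 a2] /andP[a3 a4].
    by move: a1 a2 a3 a4; move: (limn S) => l *; lra.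
  have [mn|/ltnW nm] := leqP m n.
    by rewrite nrm2B nrm2_psumB//; exact: key.
  by rewrite nrm2_psumB//; exact: key.
exists v; split => // k.
have := cvg_ip (psum_sqi a) sv (basis_sqi k) vc.
move=> /(cvg_lim (@Rhausdorff R)) <-; apply: (cvg_lim (@Rhausdorff R)).
apply: cvg_near_cst; near=> n; rewrite ip_psum_e// ifT//.
by near: n; exact: nbhs_infty_gt.
Unshelve. all: by end_near. Qed.

(** The function synthesised from the coefficients of [f] differs from [f] by a function orthogonal
    to the whole basis, null by completeness. *)
Lemma parseval_remainder f : sqi f ->
  nrm2 (fun x => f x - psum (fun k => ip f (e k)) n x) @[n --> \oo] --> 0.
Proof.
move=> sf; have [v [sv vk vc]] := synthesis (null_off_coef f) (fun n => bessel n sf).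
have [_ _ _ complete] := he.
have : \forall x \ae mu, f x - v x = 0.
  apply: complete; first exact: sqiB.
  by move=> k; rewrite ipBl ?vk ?subrr//; exact: basis_sqi.
move=> fv; apply: cvg_trans vc; apply: near_eq_cvg; near=> n.
rewrite nrm2B; set p := psum _ n; have sp : sqi p by exact: psum_sqi.
have m1 := sqi_measurable (sqiB sp sf); have m2 := sqi_measurable (sqiB sp sv).
apply: rint_ae; [exact: measurable_funM..|].
by apply: filterS fv => x /eqP; rewrite subr_eq0 => /eqP ->.
Unshelve. all: by end_near. Qed.

Lemma parseval f g : sqi f -> sqi g ->
  \sum_(k < n) ip f (e k) * ip g (e k) @[n --> \oo] --> ip f g.
Proof.
move=> sf sg; have c := parseval_remainder sf.
have E n : \sum_(k < n) ip f (e k) * ip g (e k) =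
  ip (psum (fun k => ip f (e k)) n) g by rewrite ip_psum.
under eq_cvg do rewrite E.
apply: cvg_ip => //; first by move=> n; exact: psum_sqi.
by under eq_cvg do rewrite nrm2B.
Qed.

(** Independent of [n]: it provides the dominating function when Parseval's identity is integrated
    in time. *)
Lemma parseval_bound f g n : sqi f -> sqi g ->
  `|\sum_(k < n) ip f (e k) * ip g (e k)| <= nrm2 f + nrm2 g.
Proof.
move=> sf sg; apply: (le_trans (ler_norm_sum _ _ _)).
apply: (@le_trans _ _ (\sum_(k < n) (ip f (e k) ^+ 2 + ip g (e k) ^+ 2))).
  apply: ler_sum => i _; rewrite normrM.
  rewrite -(real_normK (num_real (ip f _))) -(real_normK (num_real (ip g _))).
  move: (normr_ge0 (ip f (e i))) (normr_ge0 (ip g (e i))).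
  by move: (`|_|) (`|_|) => a b; nra.
by rewrite big_split /= lerD// bessel.
Qed.

Lemma psum_bnd a n : exists2 M, 0 <= M & forall x, `|psum a n x| <= M.
Proof.
have /choice [E hE] k : exists M, forall x, `|e k x| <= M.
  by case: he => /(_ k)[_].
exists (\sum_(k < n) `|a k| * `|E k|).
  by apply: sumr_ge0 => k _; rewrite mulr_ge0.
move=> x; apply: le_trans (ler_norm_sum _ _ _) _.
apply: ler_sum => k _; rewrite normrM ler_wpM2l//.
by rewrite (le_trans (hE k x))// ler_norm.
Qed.

(** Replacing [g] by a partial sum of its expansion costs an error uniform in [n], because the norms
    are bounded. *)
Lemma weak_cvg_basis (yn : nat -> X -> R) y C : (forall n, sqi (yn n)) -> sqi y ->
  (forall n, nrm2 (yn n) <= C) ->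
  (forall k, ip (yn n) (e k) @[n --> \oo] --> ip y (e k)) ->
  forall g, sqi g -> ip (yn n) g @[n --> \oo] --> ip y g.
Proof.
move=> syn sy yC ye g sg; apply/cvgrPdist_le => eps eps0.
have C0 : 0 <= C by apply: le_trans (yC 0%N); exact: ip_ge0.
pose D := C + nrm2 y + 1.
have y0 : 0 <= nrm2 y by exact: ip_ge0.
have D0 : 0 < D by rewrite /D; lra.
(* By Cauchy-Schwarz against a vector of squared norm at most [D], a remainder of this size
   contributes at most eps / 4. *)
have pos : 0 < eps ^+ 2 / (16 * D) by rewrite divr_gt0 ?exprn_gt0 ?mulr_gt0.
have /cvgrPdist_le/(_ _ pos)[K _ /(_ K (leqnn K)) /=] := parseval_remainder sg.
rewrite sub0r normrN ger0_norm ?ip_ge0//.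
set gK := psum _ K => rK.
have sgK : sqi gK by exact: psum_sqi.
have tail u : sqi u -> nrm2 u <= D -> `|ip u g - ip u gK| <= eps / 4.
  move=> su uD; rewrite ![ip u _]ipC -ipBl//.
  have h := cauchy_schwarz (sqiB sg sgK) su.
  apply: sqr_le_norm; first by rewrite divr_ge0// ltW.
  apply: (le_trans h).
  apply: le_trans (ler_pM (ip_ge0 _ _) (ip_ge0 _ _) rK uD) _.
  by rewrite le_eqVlt; apply/orP; left; apply/eqP; field; rewrite gt_eqF.
have cK : ip (yn n) gK @[n --> \oo] --> ip y gK.
  rewrite ipC ip_psum//; under eq_cvg do rewrite ipC ip_psum//.
  by apply: cvg_bigsum => k; apply: cvgM; [exact: cvg_cst|exact: ye].
have /cvgrPdist_le/(_ (eps / 2)) := cK.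
rewrite divr_gt0// => /(_ isT); apply: filterS => n hn.
have t1 : `|ip (yn n) g - ip (yn n) gK| <= eps / 4.
  by apply: tail => //; rewrite /D; have := yC n; lra.
have t2 : `|ip y g - ip y gK| <= eps / 4 by apply: tail => //; rewrite /D; lra.
by move: hn t1 t2; rewrite !ler_distl => /andP[? ?] /andP[? ?] /andP[? ?];
  apply/andP; split; lra.
Qed.

(** Extract so that every coefficient converges; Bessel's inequality passes to the limit, and
    [synthesis] realises the limit coefficients. *)
Lemma weak_compactness (wn : nat -> X -> R) C : (forall n, sqi (wn n)) ->
  (forall n, nrm2 (wn n) <= C) ->
  exists2 s : nat -> nat, extraction s & exists2 w, sqi w &
    forall g, sqi g -> ip (wn (s n)) g @[n --> \oo] --> ip w g.
Proof.
move=> swn wC.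
have C0 : 0 <= C by apply: le_trans (wC 0%N); exact: ip_ge0.
have [|s es [l ls]] := @diagonal_extraction R (fun n j => ip (wn n) (e j)).
  move=> j; exists (C + nrm2 (e j)) => n.
  apply: le_trans (ip_young ltr01 (swn n) (basis_sqi j)) _.
  by rewrite mul1r divr1 lerD2r; exact: wC.
exists s => //.
have nl : null_off l.
  move=> k ek0; have := ls k; under eq_cvg do rewrite ek0 ip_cst0.
  by move/(cvg_lim (@Rhausdorff R)) => <-; rewrite lim_cst.
have [|w [sw wk wc]] := @synthesis l C nl.
  move=> n; have h : \sum_(k < n) ip (wn (s m)) (e k) ^+ 2 @[m --> \oo] -->
      \sum_(k < n) l k ^+ 2.
    apply: cvg_bigsum => k; rewrite expr2; under eq_cvg do rewrite expr2.
    by apply: cvgM; exact: ls.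
  rewrite -(cvg_lim (@Rhausdorff R) h); apply: limr_le; first by apply/cvg_ex; eexists; exact: h.
  by near=> m; apply: (le_trans (bessel n (swn _))); exact: wC.
exists w => //.
apply: (weak_cvg_basis (yn := fun n => wn (s n)) (C := C)) => // k.
by rewrite wk; exact: ls.
Unshelve. all: by end_near. Qed.

End basis.
End orthonormal.

(** * The time interval and Lebesgue differentiation *)

Section interval.
Context (R : realType) (T : R).
Hypothesis T0 : 0 < T.
Local Notation I := (interval_measure T).
Local Notation leb := (@lebesgue_measure R).
Implicit Types (f u : measurableTypeR R -> R).

Lemma interval_aeT (P : measurableTypeR R -> Prop) :
  (forall t, 0 <= t -> t < T -> P t) -> \forall t \ae I, P t.
Proof.
move=> h; exists (~` `[0%R, T[%classic); split.
- by apply: measurableC; exact: measurable_itv.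
- transitivity (leb (~` `[0%R, T[%classic `&` `[0%R, T[%classic)) => //.
  by rewrite setICl measure0.
- by move=> t /= nPt; rewrite in_itv/= => /andP[t0 tT]; exact: nPt (h _ t0 tT).
Qed.

Lemma interval_ae_lebesgue (P : measurableTypeR R -> Prop) :
  (\forall t \ae leb, P t) -> \forall t \ae I, P t.
Proof.
move=> [A [mA A0 sA]]; exists A; split => //.
transitivity (leb (A `&` `[0%R, T[%classic)) => //.
apply/eqP; rewrite -measure_le0 -A0; apply: le_measure; rewrite ?inE//.
by apply: measurableI => //; exact: measurable_itv.
Qed.

Lemma interval_ae_neq c : \forall t \ae I, t <> c.
Proof.
apply: interval_ae_lebesgue; exists [set c]; split => //.
- exact: lebesgue_measure_set1.
- by move=> t /= /contrapT ->.
Qed.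

Lemma integral_interval (f : measurableTypeR R -> \bar R) : measurable_fun setT f ->
  (\int[I]_t f t = \int[leb]_(t in `[0%R, T[) f t)%E.
Proof.
move=> mf; transitivity (\int[I]_(t in `[0%R, T[) f t)%E.
  rewrite [RHS]integral_mkcond; apply: ae_eq_integral => //.
    by apply/(measurable_restrictT _ _).1 => //; exact: measurable_funTS.
  apply: interval_aeT => t t0 tT _.
  by rewrite patchE mem_set//= in_itv/= t0.
apply: eq_measure_integral => A mA /= sA.
by transitivity (leb (A `&` `[0%R, T[%classic)) => //; rewrite setIidl.
Qed.

Lemma intg_interval f : intg I f -> leb.-integrable `[0%R, T[ (EFin \o f).
Proof.
move=> fi; have mf := intg_measurable fi.
have [_ h] := integrableP _ _ _ fi; apply/integrableP; split.
  by apply: measurable_funTS; exact/measurable_EFinP.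
rewrite -integral_interval//; apply: measurableT_comp => //.
exact/measurable_EFinP.
Qed.

Lemma rint_interval f : measurable_fun setT f ->
  rint I f = \int[leb]_(t in `[0%R, T[) f t.
Proof. by move=> mf; congr fine; apply: integral_interval; exact/measurable_EFinP. Qed.

(** Extended by 0 outside [0, T[, [u] has a vanishing primitive, whose derivative is [u] almost
    everywhere by Lebesgue's theorem. *)
Lemma intervals_ae0 u : intg I u ->
  (forall a b, 0 <= a -> a < b -> b <= T ->
     rint I (fun t => u t * (a < t < b)%R%:R) = 0) ->
  \forall t \ae I, u t = 0.
Proof.
move=> ui h; have mu := intg_measurable ui.
pose g := u \_ `[0%R, T[%classic.
have ig : leb.-integrable setT (EFin \o g).
  rewrite /g -restrict_EFin; apply/integrable_restrict => //=.
  by rewrite setTI; exact: intg_interval.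
have gl : locally_integrable setT g.
  by apply: integrable_locally => //; exact: intg_interval.
have ig' y : leb.-integrable `]-oo, y] (EFin \o g) by exact: integrableS ig.
have mind x : measurable_fun setT (fun t : measurableTypeR R => (t <= x)%R%:R : R).
  rewrite (_ : (fun t => _) = \1_`]-oo, x]%classic); first exact: measurable_indic.
  by apply/funext => t; rewrite indicE mem_setE in_itv.
(* Within [0, T[ a half-line differs from an interval of the hypothesis by the points 0 and x only,
   which are null. *)
have F0 x : \int[leb]_(t in `]-oo, x]) g t = 0.
  transitivity (rint I (fun t => u t * (t <= x)%R%:R)).
    rewrite rint_interval; last exact: measurable_funM.
    rewrite [LHS]Rintegral_mkcond [RHS]Rintegral_mkcond.
    apply: eq_Rintegral => t _; rewrite /g !patchE.
    rewrite !mem_setE !in_itv/=.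
    by case: (t <= x); case: ifP => //; rewrite ?mulr1 ?mulr0.
  have [x0|x0] := leP x 0.
    rewrite -[RHS](rint0 I); apply: rint_ae => //; first exact: measurable_funM.
    have h0 := @interval_aeT (fun t => 0 <= t) (fun t t0 _ => t0).
    apply: filterS2 h0 (interval_ae_neq 0) => t t0 /eqP tn0.
    by rewrite leNgt (le_lt_trans x0) ?mulr0// lt_neqAle eq_sym tn0.
  have m0 : 0 < Num.min x T by rewrite lt_min x0.
  have mT : Num.min x T <= T by rewrite ge_min lexx orbT.
  rewrite -[RHS](h 0 _ (lexx _) m0 mT).
  apply: rint_ae; first exact: measurable_funM.
    apply: measurable_funM => //.
    rewrite (_ : (fun t => _) = \1_`]0, Num.min x T[%classic); first exact: measurable_indic.
    by apply/funext => t; rewrite indicE mem_setE in_itv.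
  have hT := @interval_aeT (fun t => 0 <= t /\ t < T) (fun t t0 tT => conj t0 tT).
  apply: filterS3 hT (interval_ae_neq 0) (interval_ae_neq x) => t [t0 tT] /eqP tn0 /eqP tnx.
  congr (_ * _%:R); congr nat_of_bool; rewrite lt_min tT andbT le_eqVlt (negbTE tnx) /=.
  by rewrite [0 < t]lt_neqAle eq_sym tn0 t0.
have ae0 : \forall t \ae leb, g t = 0.
  have FF : Filter (almost_everywhere leb) by exact: ae_filter_ringOfSetsType.
  have := FTC1Ny ig' gl; apply: filterS => t [_ dF]; rewrite -dF.
  rewrite (_ : (fun x => _) = cst 0); first by rewrite derive1_cst.
  by apply/funext => x; rewrite F0.
have {}ae0 := interval_ae_lebesgue ae0.
have aeT : \forall t \ae I, g t = u t.
  by apply: interval_aeT => t t0 tT; rewrite /g patchE mem_set//= in_itv/= t0.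
have FF : Filter (almost_everywhere I) by exact: ae_filter_ringOfSetsType.
by move: ae0 aeT; apply: filterS2 => t + <-.
Qed.

End interval.

Section countable_basis.
Context d (X : measurableType d) (R : realType) (K : countType).
Variable mu : {finite_measure set X -> \bar R}.
Implicit Types u : X -> R.

Definition orthonormal_basis (e : K -> X -> R) := [/\
  forall k, measurable_fun setT (e k) /\ exists M, forall x, `|e k x| <= M,
  forall i j, ip mu (e i) (e j) = (i == j)%:R &
  forall u, sqi mu u -> (forall k, ip mu u (e k) = 0) ->
    \forall x \ae mu, u x = 0].

Definition enum_basis (e : K -> X -> R) (n : nat) : X -> R :=
  oapp e (fun=> 0) (pickle_inv n).

Lemma enum_basisP e : orthonormal_basis e -> hilbert_basis mu (enum_basis e).
Proof.
move=> [me oe ce]; split.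
- move=> k; rewrite /enum_basis; case: pickle_inv => //=.
  by split=> //; exists 0 => x; rewrite normr0.
- move=> i j ij; rewrite /enum_basis.
  have := @pickle_invK K i; have := @pickle_invK K j.
  case: pickle_inv => [kj|] /= hj; last by rewrite ip_cst0.
  case: pickle_inv => [ki|] /= hi; last by rewrite ipC ip_cst0.
  rewrite oe; case: eqP => // kij.
  by move: ij; rewrite -hi -hj kij eqxx.
- move=> k; rewrite /enum_basis; case: pickle_inv => [i|]; last by right.
  by left; rewrite oe eqxx.
- move=> u su h; apply: ce => // k.
  by have := h (pickle k); rewrite /enum_basis pickleK_inv.
Qed.

End countable_basis.

Lemma ae_forall_countable d (X : measurableType d) (R : realType) (K : countType)
    (mu : {measure set X -> \bar R}) (P : K -> X -> Prop) :
  (forall k, \forall x \ae mu, P k x) -> \forall x \ae mu, forall k, P k x.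
Proof.
move=> h; have : \forall x \ae mu, forall n : nat,
    oapp (P^~ x) True (@pickle_inv K n).
  apply: ae_foralln => n; case: pickle_inv => [k|] /=; first exact: h.
  exact: aeW.
by apply: filterS => x hx k; have := hx (pickle k); rewrite pickleK_inv.
Qed.

Lemma intg_dom_ae d (X : measurableType d) (R : realType)
    (mu : {measure set X -> \bar R}) (f g : X -> R) :
  measurable_fun setT f -> intg mu g ->
  (\forall x \ae mu, `|f x| <= g x) -> intg mu f.
Proof.
move=> mf ig fg.
apply: (@rdct _ _ _ mu (fun=> f) f g _ _ _ _ _).1 => //.
by apply: aeW => x; exact: cvg_cst.
Qed.

(** * Tensor products of orthonormal bases *)

Section tensor.
Context d1 d2 (X : measurableType d1) (Y : measurableType d2) (R : realType).
Variables (m1 : {finite_measure set X -> \bar R})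
          (m2 : {finite_measure set Y -> \bar R}).
Local Notation Q := (finite_prod m1 m2).
Implicit Types u : X * Y -> R.

Lemma sqi_fst (f : X -> R) : sqi m1 f -> sqi Q (fun p => f p.1).
Proof.
move=> [mf f2]; split; first exact: measurableT_comp.
exact: (intg_fst _ f2).
Qed.

Lemma sqi_snd (f : Y -> R) : sqi m2 f -> sqi Q (fun p => f p.2).
Proof.
move=> [mf f2]; split; first exact: measurableT_comp.
exact: (intg_snd _ f2).
Qed.

(** Cauchy-Schwarz against the constant 1 bounds the squared inner integral by m2(Y) times the
    integral of u^2, wherever the section is square-integrable. *)
Lemma sqi_rint2 u : sqi Q u -> sqi m1 (fun x => rint m2 (fun y => u (x, y))).
Proof.
move=> su; have [mu u2] := su.
have ui := sqi_intg su; have [ui1 _] := fubini1 ui.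
have [u21 _] := fubini1 u2.
have s1 : sqi m2 (fun=> 1) by apply: (@sqi_bnd _ _ _ _ _ 1) => // x; rewrite normr1.
split; first exact: intg_measurable ui1.
apply: (@intg_dom_ae _ _ _ _ _ (fun x => rint m2 (fun=> 1) *
    rint m2 (fun y => u (x, y) ^+ 2))).
- by apply: measurable_funX; exact: intg_measurable ui1.
- exact: intgZ.
- apply: filterS (ae_sqi1 su) => x sx; rewrite ger0_norm ?sqr_ge0//.
  have := cauchy_schwarz sx s1.
  have -> : ip m2 (fun y => u (x, y)) (fun=> 1) = rint m2 (fun y => u (x, y)).
    by congr rint; apply/funext => y; rewrite mulr1.
  have -> : ip m2 (fun=> 1) (fun=> 1) = rint m2 (fun=> 1).
    by congr rint; apply/funext => y; rewrite mulr1.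
  by rewrite ip_sqr mulrC.
Qed.

(** For completeness: the coefficient of u(x, .) on [b j] is, as a function of x, orthogonal to
    every [a i], hence null. Countability of [K2] gives one null set for all j, off which the
    section vanishes. *)
Lemma orthonormal_basis_prod (K1 K2 : countType) (a : K1 -> X -> R) (b : K2 -> Y -> R) :
  orthonormal_basis m1 a -> orthonormal_basis m2 b ->
  orthonormal_basis Q (fun (k : K1 * K2) p => a k.1 p.1 * b k.2 p.2).
Proof.
move=> [ma oa ca] [mb ob cb].
have sa i : sqi m1 (a i) by case: (ma i) => ? [M]; exact: sqi_bnd.
have sb i : sqi m2 (b i) by case: (mb i) => ? [M]; exact: sqi_bnd.
have ms (k : K1 * K2) : measurable_fun setT (fun p : X * Y => a k.1 p.1 * b k.2 p.2) /\
    exists M, forall p : X * Y, `|a k.1 p.1 * b k.2 p.2| <= M.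
  have [m [M hM]] := ma k.1; have [m' [M' hM']] := mb k.2; split.
    by apply: measurable_funM; apply: measurableT_comp.
  by exists (M * M') => p; rewrite normrM ler_pM.
have ss k : sqi Q (fun p : X * Y => a k.1 p.1 * b k.2 p.2).
  by case: (ms k) => m [M]; exact: sqi_bnd m.
split => //.
- move=> [i j] [i' j'] /=; rewrite /ip.
  have [_ ->] := fubini1 (sqi_intgM (ss (i, j)) (ss (i', j'))); rewrite /=.
  transitivity (rint m1 (fun x => (j == j')%:R * (a i x * a i' x))).
    congr rint; apply/funext => x.
    transitivity (rint m2 (fun y => (a i x * a i' x) * (b j y * b j' y))).
      by congr rint; apply/funext => y; ring.
    by rewrite rintZ; [rewrite mulrC; congr (_ * _); exact: ob|exact: sqi_intgM].
  rewrite rintZ; last exact: sqi_intgM.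
  have /= := oa i i'; rewrite /ip => ->.
  by rewrite -pair_eqE /= -natrM mulnb andbC.
- move=> u su h.
  have uj0 j : \forall x \ae m1, rint m2 (fun y => u (x, y) * b j y) = 0.
    have [mbj [M bM]] := mb j.
    have sub : sqi Q (fun p => u p * b j p.2).
      by apply: (sqiM su) (fun p => bM p.2); apply: measurableT_comp.
    apply: ca; first exact: sqi_rint2 sub.
    move=> i; have := h (i, j); rewrite /ip /= => hij.
    have iu : intg Q (fun p => u p * (a i p.1 * b j p.2)) := sqi_intgM su (ss (i, j)).
    have [_] := fubini1 iu; rewrite hij => e; rewrite [RHS]e /=.
    apply: rint_ae.
    + have [i1 _] := fubini1 (sqi_intg sub).
      by apply: measurable_funM; [exact: intg_measurable i1|case: (ma i)].
    + by have [i1 _] := fubini1 iu; exact: intg_measurable i1.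
    apply: filterS (ae_sqi1 su) => x sx /=; rewrite mulrC -rintZ; last exact: sqi_intgM.
    by congr rint; apply/funext => y; ring.
  have h2 : \forall x \ae m1, \forall y \ae m2, u (x, y) = 0.
    apply: filterS2 (ae_forall_countable uj0) (ae_sqi1 su) => x hx sx.
    exact: cb sx hx.
  have [mu u2] := su.
  have [i2 e2] := fubini1 u2.
  have r0 : rint Q (fun p => u p ^+ 2) = 0.
    rewrite e2 -[RHS](rint0 m1); apply: rint_ae => //; first exact: intg_measurable i2.
    apply: filterS2 h2 (ae_sqi1 su) => x hx [mx _].
    rewrite -[RHS](rint0 m2); apply: rint_ae => //; first exact: measurable_funX.
    by apply: filterS hx => y ->; rewrite expr0n.
  have := rint_eq0 u2 (fun p => sqr_ge0 (u p)) r0.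
  by apply: filterS => p /eqP; rewrite sqrf_eq0 => /eqP.
Qed.

End tensor.

(** * The trigonometric basis of the torus *)

Lemma is_derive_affine (R : realType) (f : R -> R) (df a b x : R) :
  is_derive (a * x + b) 1 f df -> is_derive x 1 (fun x => f (a * x + b)) (a * df).
Proof.
move=> fd; rewrite mulrC.
have h : is_derive x 1 (fun x => a * x + b) a.
  have -> : (fun x => a * x + b) = a *: id + cst b by apply/funext.
  by apply: is_derive_eq; rewrite addr0 scaler1.
exact: (@is_derive1_comp _ f _ x).
Qed.

Lemma continuous_cos_affine (R : realType) (a b : R) :
  continuous (fun x : R => cos (a * x + b)).
Proof.
move=> x; apply: continuous_comp; last exact: continuous_cos.
by apply: cvgD; [apply: cvgM; [exact: cvg_cst|exact: cvg_id]|exact: cvg_cst].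
Qed.

Lemma cosM (R : realType) (x y : R) :
  cos x * cos y = 2^-1 * (cos (x + y) + cos (x - y)).
Proof. by rewrite cosD cosB; field. Qed.

Lemma sin_int_period (R : realType) (n : int) (x : R) :
  sin (x + n%:~R * (2 * pi)) = sin x.
Proof.
have e k : sin (x + k%:R * (2 * pi)) = sin x /\ sin (x - k%:R * (2 * pi)) = sin x.
  have e2 : k%:R * (2 * pi) = pi *+ 2 *+ k :> R by rewrite !mulr_natl.
  rewrite e2; split; first by rewrite (periodicn (@sinD2pi R)).
  by rewrite -[LHS](periodicn (@sinD2pi R) k) subrK.
case: n => k; first by have [] := e k.
by have [_] := e k.+1; rewrite NegzE mulrNz mulNr.
Qed.

Lemma bernoulli_inequality (R : realFieldType) (y : R) n : -1 <= y ->
  1 + n%:R * y <= (1 + y) ^+ n.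
Proof.
move=> y1; elim: n => [|n IHn]; first by rewrite mul0r addr0 expr0.
rewrite exprS; apply: le_trans (_ : (1 + y) * (1 + n%:R * y) <= _).
  have -> : (1 + y) * (1 + n%:R * y) = 1 + n.+1%:R * y + n%:R * y ^+ 2.
    by rewrite -natr1; ring.
  by rewrite lerDl mulr_ge0 ?sqr_ge0.
by rewrite ler_wpM2l//; lra.
Qed.

(** The peaking polynomials (1 - x^n)^(2^n) of elementary proofs of the Stone-Weierstrass theorem,
    with exponent 2^n n so that the limit at x = 1/2 is also 0. Below 1/2, Bernoulli's inequality
    gives the lower bound 1 - n (2x)^n; from 1/2 on, (1 - y) (1 + y) <= 1 and Bernoulli give the
    upper bound 1 / (n + 1). *)
Lemma cvg_bernstein_step (R : realType) (x : R) : 0 <= x <= 1 ->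
  (1 - x ^+ n) ^+ (2 ^ n * n) @[n --> \oo] --> ((x < 2^-1)%R%:R : R).
Proof.
move=> /andP[x0 x1].
have xn n : 0 <= x ^+ n <= 1 by rewrite exprn_ge0// exprn_ile1.
have f0 n : 0 <= 1 - x ^+ n by have := xn n; lra.
case: ltP => x2.
  rewrite (_ : true%:R = 1 :> R)//.
  apply/cvgrPdist_le => e e0.
  (* n (2x)^n = (n s^n) s^n is a bounded factor times one that tends to 0. *)
  pose s := Num.sqrt (2 * x).
  have s0 : 0 <= s by exact: sqrtr_ge0.
  have s2 : s ^+ 2 = 2 * x by rewrite sqr_sqrtr// mulr_ge0.
  have s1 : s < 1.
    rewrite -(@ltr_pXn2r _ 2)// ?nnegrE// s2 expr1n.
    lra.
  have [sz|sz] := eqVneq s 0.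
    have xz : x = 0 by move: s2; rewrite sz expr0n /= => h; lra.
    near=> n; rewrite xz expr0n [(n == 0)%N]eqn0Ngt.
    have -> : (0 < n)%N by near: n; exact: nbhs_infty_gt.
    by rewrite subr0 expr1n subrr normr0 ltW.
  have sp : 0 < s by rewrite lt_neqAle eq_sym sz.
  (* Bernoulli's inequality for s^-1 = 1 + (s^-1 - 1) gives n (s^-1 - 1) <= s^-n, that is n s^n <=
     C. *)
  pose C := (s^-1 - 1)^-1.
  have C0 : 0 < C by rewrite invr_gt0 subr_gt0 invf_gt1.
  have bnd n : n%:R * s ^+ n <= C.
    have h : n%:R * (s^-1 - 1) <= s^-1 ^+ n.
      have s11 : 1 < s^-1 by rewrite invf_gt1.
      have : 1 + n%:R * (s^-1 - 1) <= (1 + (s^-1 - 1)) ^+ n.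
        by apply: bernoulli_inequality; lra.
      by rewrite [1 + (_ - 1)]addrC subrK; lra.
    rewrite /C -[leRHS]mul1r ler_pdivlMr ?subr_gt0 ?invf_gt1//.
    rewrite mulrAC -ler_pdivlMr ?exprn_gt0// mul1r -exprVn.
    exact: h.
  have sn : s ^+ n @[n --> \oo] --> 0.
    by apply: cvg_expr; rewrite ger0_norm.
  have /cvgrPdist_le/(_ (e / C)) := sn.
  rewrite divr_gt0// => /(_ isT); apply: filterS => n.
  rewrite sub0r normrN ger0_norm ?exprn_ge0// => sne.
  rewrite ger0_norm ?subr_ge0 ?exprn_ile1//; last by have := xn n; lra.
  have xnn := xn n.
  have h : 1 + (2 ^ n * n)%:R * (- x ^+ n) <= (1 + - x ^+ n) ^+ (2 ^ n * n).
    by apply: bernoulli_inequality; lra.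
  suff : (2 ^ n * n)%:R * x ^+ n <= e.
    move: h; rewrite mulrN; move: ((1 - x ^+ n) ^+ (2 ^ n * n)) => A.
    by move: (_%:R * _) => B; lra.
  have -> : (2 ^ n * n)%:R * x ^+ n = n%:R * s ^+ n * s ^+ n.
    by rewrite natrM natrX mulrAC -exprMn -s2 exprAC; ring.
  move: sne; rewrite ler_pdivlMr// mulrC; apply: le_trans.
  by rewrite ler_wpM2r ?exprn_ge0.
apply: (@squeeze_cvgr _ _ _ _ (fun=> 0) (fun n => n.+1%:R^-1)).
- near=> n; rewrite exprn_ge0//=.
  have h : (1 - x ^+ n) * (1 + x ^+ n) <= 1.
    by have := xn n; move: (x ^+ n) => y; nra.
  have {}h : (1 - x ^+ n) ^+ (2 ^ n * n) * (1 + x ^+ n) ^+ (2 ^ n * n) <= 1.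
    rewrite -exprMn exprn_ile1//; apply: mulr_ge0 => //.
    by have := xn n; lra.
  have b : n.+1%:R <= (1 + x ^+ n) ^+ (2 ^ n * n).
    apply: le_trans (bernoulli_inequality _ _); last by have := xn n; lra.
    rewrite -natr1 addrC lerD2l natrM natrX mulrAC -exprMn.
    rewrite ler_peMl// exprn_ege1//; lra.
  rewrite -[leRHS]mul1r ler_pdivlMr ?ltr0n//.
  by apply: le_trans h; rewrite ler_wpM2l ?exprn_ge0.
- exact: cvg_cst.
- exact: cvg_harmonic.
Unshelve. all: by end_near. Qed.

(** * The trigonometric basis in one variable *)

Section cas.
Context (R : realType) (T : R).
Hypothesis T0 : 0 < T.
Local Notation I := (interval_measure T).
Local Notation leb := (@lebesgue_measure R).
Local Notation om := (2 * pi / T).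

Let omT : om * T = 2 * pi. Proof. by rewrite divfK// gt_eqF. Qed.

(* sqrt (2/T) cos (2 pi j x / T - pi/4) is the normalised cos + sin: letting j
   range over int gives a real orthonormal basis in which the sine and the cosine
   of frequency |j| need not be told apart. *)
Definition cas (j : int) (x : measurableTypeR R) : R :=
  Num.sqrt (2 / T) * cos (j%:~R * om * x + - (pi / 4)).

Lemma measurable_cos_affine (a b : R) :
  measurable_fun setT (fun x : measurableTypeR R => cos (a * x + b)).
Proof. by apply: continuous_measurable_fun; exact: continuous_cos_affine. Qed.

Lemma cos_bnd (x : R) : `|cos x| <= 1.
Proof. by rewrite ler_norml cos_geN1 cos_le1. Qed.

Lemma intg_cos_affine (a b : R) : intg I (fun x => cos (a * x + b)).
Proof.
apply: (@intg_bnd _ _ _ _ _ 1); first exact: measurable_cos_affine.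
by move=> x; exact: cos_bnd.
Qed.

Lemma rint_interval_cst (c : R) : rint I (fun=> c) = c * T.
Proof.
rewrite rint_interval// Rintegral_cst//.
have e : leb `[0%R, T[%classic = T%:E.
  by rewrite lebesgue_measure_itv /= lte_fin T0 -EFinB subr0.
by congr (_ * _); rewrite -[RHS]/(fine T%:E) -e.
Qed.

Lemma rint_cos (n : int) (b : R) :
  rint I (fun x => cos (n%:~R * om * x + b)) = if n == 0 then cos b * T else 0.
Proof.
case: eqP => [->|/eqP n0].
  rewrite -rint_interval_cst; congr rint; apply/funext => x.
  by rewrite !mul0r add0r.
set a := n%:~R * om.
have a0 : a != 0.
  by rewrite mulf_neq0 ?intr_eq0// gt_eqF// divr_gt0// mulr_gt0// pi_gt0.
rewrite rint_interval; last exact: measurable_cos_affine.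
rewrite Rintegral_itv_bndo_bndc; last first.
  by apply: intg_interval; exact: intg_cos_affine.
pose F (x : R) := a^-1 * sin (a * x + b).
have dF (x : R) : is_derive x 1 F (cos (a * x + b)).
  have h := is_derive_affine (is_derive_sin (a * x + b)).
  have -> : F = a^-1 *: (fun x => sin (a * x + b)) by [].
  by apply: is_derive_eq; rewrite [LHS]mulrA mulVf ?mul1r.
have cF (x : R) : {for x, continuous F}.
  by apply: differentiable_continuous; apply/derivable1_diffP; case: (dF x).
rewrite /Rintegral (continuous_FTC2 T0 _ _ _ (F := F)).
- rewrite /= /F mulr0 add0r -mulrBr.
  rewrite (_ : a * T = n%:~R * (2 * pi)) ?[_ + b]addrC ?sin_int_period ?subrr ?mulr0//.
  by rewrite /a -mulrA omT.
- by apply: continuous_subspaceT => x; exact: continuous_cos_affine.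
- split.
  + by move=> x _; case: (dF x).
  + by apply: cvg_at_right_filter; exact: cF.
  + by apply: cvg_at_left_filter; exact: cF.
- by move=> x _; rewrite derive1E derive_val.
Qed.

Lemma cos_piquarter_sqr : cos (pi / 4 : R) ^+ 2 = 2^-1.
Proof.
have h : cos (pi / 4 + pi / 4 : R) = 0.
  rewrite (_ : pi / 4 + pi / 4 = pi / 2); last by field.
  exact: cos_pihalf.
have := cos2Dsin2 (pi / 4 : R); move: h; rewrite cosD -!expr2 => h1 h2.
lra.
Qed.

(** In the product formula the term of frequency i + j carries the phase - pi / 2, whose cosine is
    0, so it integrates to 0 even when i + j = 0. This is what the shift by pi / 4 is for. *)
Lemma ip_cas i j : ip I (cas i) (cas j) = (i == j)%:R.
Proof.
have sT : Num.sqrt (2 / T) ^+ 2 = 2 / T by rewrite sqr_sqrtr// divr_ge0// ltW.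
transitivity (T^-1 * (rint I (fun x => cos ((i + j)%:~R * om * x + - (pi / 2))) +
              rint I (fun x => cos ((i - j)%:~R * om * x + 0)))).
  rewrite -rintD; [|exact: intg_cos_affine..].
  rewrite -rintZ; last by apply: intgD; exact: intg_cos_affine.
  congr rint; apply/funext => x.
  rewrite /cas; set w := om; rewrite mulrACA -expr2 sT cosM.
  rewrite (_ : i%:~R * w * x + - (pi / 4) + (j%:~R * w * x + - (pi / 4)) =
    (i + j)%:~R * w * x + - (pi / 2)); last by rewrite intrD; field.
  rewrite (_ : i%:~R * w * x + - (pi / 4) - (j%:~R * w * x + - (pi / 4)) =
    (i - j)%:~R * w * x + 0); last by rewrite intrB; ring.
  by field; rewrite gt_eqF.
rewrite !rint_cos subr_eq0 cos0 cosN cos_pihalf mul0r.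
rewrite if_same add0r.
by case: eqP => _; rewrite ?mulr0// mul1r mulVf// gt_eqF.
Qed.

Lemma measurable_cas j : measurable_fun setT (cas j).
Proof. by apply: measurable_funM => //; exact: measurable_cos_affine. Qed.

Lemma cas_bnd j x : `|cas j x| <= Num.sqrt (2 / T).
Proof.
rewrite /cas normrM ger0_norm ?sqrtr_ge0// -[leRHS]mulr1.
by rewrite ler_wpM2l ?sqrtr_ge0// cos_bnd.
Qed.

Section completeness.
Variable u : measurableTypeR R -> R.
Hypothesis su : sqi I u.
Hypothesis uc : forall j, ip I u (cas j) = 0.

Let ui : intg I u := sqi_intg su.

Let iuM (v : measurableTypeR R -> R) : measurable_fun setT v ->
  (forall x, `|v x| <= 1) -> intg I (fun x => u x * v x).
Proof. by move=> mv v1; exact: intgM ui mv v1. Qed.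

(** A cosine of frequency j and any phase is a combination of [cas j] and [cas (- j)]. *)
Lemma coef_cos (j : int) b : rint I (fun x => u x * cos (j%:~R * om * x + b)) = 0.
Proof.
pose k : R := cos (pi / 4).
have k2 : k ^+ 2 = 2^-1 by exact: cos_piquarter_sqr.
have k0 : k != 0 by rewrite -sqrf_eq0 k2 invr_neq0.
have s0 : Num.sqrt (2 / T) != 0 by rewrite gt_eqF// sqrtr_gt0 divr_gt0.
have sk : sin (pi / 4 : R) = k.
  have := sinDpihalf (- (pi / 4) : R).
  rewrite (_ : - (pi / 4) + pi / 2 = pi / 4); last by field.
  by rewrite cosN.
have h i : rint I (fun x => u x * cos (i%:~R * om * x + - (pi / 4))) = 0.
  have := uc i; rewrite /ip /cas.
  rewrite (_ : (fun x => _) = (fun x => Num.sqrt (2 / T) *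
     (u x * cos (i%:~R * om * x + - (pi / 4))))); last first.
    by apply/funext => x; ring.
  rewrite rintZ; last first.
    by apply: iuM; [exact: measurable_cos_affine|move=> x; exact: cos_bnd].
  by move/eqP; rewrite mulf_eq0 (negbTE s0) => /eqP.
(* The solution of k (A + B) = cos b and k (A - B) = - sin b. *)
pose A := (cos b - sin b) / (2 * k); pose B := (cos b + sin b) / (2 * k).
transitivity (A * rint I (fun x => u x * cos (j%:~R * om * x + - (pi / 4))) +
   B * rint I (fun x => u x * cos ((- j)%:~R * om * x + - (pi / 4)))); last first.
  by rewrite !h !mulr0 addr0.
have iu a c : intg I (fun x => u x * cos (a * x + c)).
  by apply: iuM; [exact: measurable_cos_affine|move=> x; exact: cos_bnd].
rewrite -!rintZ// -rintD; [|exact: intgZ..].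
congr rint; apply/funext => x.
rewrite mulrNz !mulNr; set y := j%:~R * om * x.
rewrite -opprD cosN !cosD cosN sinN sk -/k /A /B.
by field.
Qed.

(** Frequency and phase stay free in the induction: the product formula absorbs one cosine at a time
    and shifts both. *)
Lemma coef_cos_pow n a (j : int) b :
  rint I (fun x => u x * (cos (om * x + a) ^+ n * cos (j%:~R * om * x + b))) = 0.
Proof.
have im m i c : intg I (fun x => u x * (cos (om * x + a) ^+ m * cos (i%:~R * om * x + c))).
  apply: iuM.
    by apply: measurable_funM; [apply: measurable_funX|]; exact: measurable_cos_affine.
  move=> x; rewrite normrM normrX mulr_ile1// ?exprn_ile1// ?cos_bnd//.
elim: n j b => [|n IHn] j b.
  by rewrite -[RHS](coef_cos j b); congr rint; apply/funext => x; rewrite expr0 mul1r.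
transitivity (2^-1 * (
  rint I (fun x => u x * (cos (om * x + a) ^+ n * cos ((1 + j)%:~R * om * x + (a + b)))) +
  rint I (fun x => u x * (cos (om * x + a) ^+ n * cos ((1 - j)%:~R * om * x + (a - b)))))); last first.
  by rewrite !IHn addr0 mulr0.
rewrite -rintD// -rintZ; last exact: intgD.
congr rint; apply/funext => x.
rewrite exprSr -mulrA cosM.
rewrite (_ : om * x + a + (j%:~R * om * x + b) = (1 + j)%:~R * om * x + (a + b));
  last by rewrite intrD; ring.
rewrite (_ : om * x + a - (j%:~R * om * x + b) = (1 - j)%:~R * om * x + (a - b));
  last by rewrite intrB; ring.
by ring.
Qed.

Lemma coef_cos_poly (p : {poly R}) a : rint I (fun x => u x * p.[cos (om * x + a)]) = 0.
Proof.
transitivity (rint I (fun x => \sum_(i < size p) p`_i * (u x * (cos (om * x + a) ^+ i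
    * cos (0%:~R * om * x + 0))))).
  congr rint; apply/funext => x; rewrite horner_coef mulr_sumr.
  by apply: eq_bigr => i _; rewrite !mul0r addr0 cos0 mulr1; ring.
rewrite rint_sum.
  apply: big1 => i _; rewrite rintZ ?coef_cos_pow ?mulr0//.
  apply: iuM.
    by apply: measurable_funM; [apply: measurable_funX|]; exact: measurable_cos_affine.
  by move=> x; rewrite normrM normrX mulr_ile1// ?exprn_ile1// ?cos_bnd//.
move=> i; apply: intgZ; apply: iuM.
  by apply: measurable_funM; [apply: measurable_funX|]; exact: measurable_cos_affine.
by move=> x; rewrite normrM normrX mulr_ile1// ?exprn_ile1// ?cos_bnd//.
Qed.

(* The polynomials (1 - X^n)^(2^n n) in cos converge boundedly to the indicator
   of X < 1/2, so that u is orthogonal to the indicator of every interval. *)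
Lemma coef_cos_level a y0 : -1 <= y0 <= 1 ->
  rint I (fun x => u x * (y0 < cos (om * x + a))%R%:R) = 0.
Proof.
move=> /andP[y1 y2].
pose p n : {poly R} := (1 - ((2^-1 + y0 / 4)%:P - 4^-1 *: 'X) ^+ n) ^+ (2 ^ n * n).
(* Since |cos - y0| <= 2, this rescaling stays in [0, 1]; it is below 1/2 exactly where the cosine
   exceeds y0. *)
pose X (x : R) := 2^-1 - (cos (om * x + a) - y0) / 4.
have pE n x : (p n).[cos (om * x + a)] = (1 - X x ^+ n) ^+ (2 ^ n * n).
  have -> : X x = 2^-1 + y0 / 4 - 4^-1 * cos (om * x + a) by rewrite /X; ring.
  by rewrite /p !hornerE.
have X01 x : 0 <= X x <= 1.
  by have := cos_le1 (om * x + a); have := cos_geN1 (om * x + a); rewrite /X; lra.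
have mc := @measurable_cos_affine om a.
have mX : measurable_fun setT X.
  by apply: measurable_funB => //; apply: measurable_funM => //; exact: measurable_funB.
have pm n : measurable_fun setT (fun x : measurableTypeR R => (p n).[cos (om * x + a)]).
  rewrite (_ : (fun x => _) = (fun x => (1 - X x ^+ n) ^+ (2 ^ n * n))).
    apply: measurable_funX; apply: measurable_funB => //; exact: measurable_funX.
  by apply/funext => x; exact: pE.
have ml : measurable_fun setT (fun x : measurableTypeR R => (y0 < cos (om * x + a))%R%:R : R).
  have : measurable_fun setT (fun x : measurableTypeR R => y0 < cos (om * x + a)).
    exact: measurable_fun_ltr.
  by move=> mb; apply: (measurableT_comp (f := fun b : bool => b%:R : R)).
have mu := sqi_measurable su.
have [||||n|_] := @rdct _ _ _ I (fun n x => u x * (p n).[cos (om * x + a)])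
   (fun x => u x * (y0 < cos (om * x + a))%R%:R) (fun x => `|u x|).
- by move=> n; exact: measurable_funM.
- exact: measurable_funM.
- apply: aeW => x; apply: cvgM; first exact: cvg_cst.
  under eq_cvg do rewrite pE.
  have -> : (y0 < cos (om * x + a)) = (X x < 2^-1).
    by rewrite /X; apply/idP/idP; lra.
  exact: cvg_bernstein_step.
- exact: intg_norm.
- apply: aeW => x; rewrite normrM ler_piMr// pE normrX exprn_ile1//.
  have /andP[X0 X1] := X01 x.
  have h0 : 0 <= X x ^+ n by rewrite exprn_ge0.
  have h1 : X x ^+ n <= 1 by rewrite exprn_ile1.
  by rewrite ger0_norm; lra.
under eq_cvg do rewrite coef_cos_poly.
by move/(cvg_lim (@Rhausdorff R)) => <-; rewrite lim_cst.
Qed.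

(** As the period is T, the interval ]a, b[ is the part of [0, T[ where a cosine centred at the
    midpoint exceeds its value at the ends. *)
Lemma coef_itv (a b : R) : 0 <= a -> a < b -> b <= T ->
  rint I (fun t => u t * (a < t < b)%R%:R) = 0.
Proof.
move=> a0 ab bT; pose m := (a + b) / 2; pose dl := (b - a) / 2.
have o0 : 0 < om by rewrite divr_gt0// mulr_gt0// pi_gt0.
rewrite -(@coef_cos_level (- (om * m)) (cos (om * dl))); last first.
  by rewrite cos_geN1 cos_le1.
apply: rint_ae.
- apply: measurable_funM; first exact: sqi_measurable su.
  rewrite (_ : (fun t => _) = \1_`]a, b[%classic); first exact: measurable_indic.
  by apply/funext => t; rewrite indicE mem_setE in_itv.
- apply: measurable_funM; first exact: sqi_measurable su.
  apply: (measurableT_comp (f := fun b : bool => b%:R : R)) => //.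
  by apply: measurable_fun_ltr => //; exact: measurable_cos_affine.
apply: interval_aeT => t t0 tT; congr (_ * _%:R); congr nat_of_bool.
have -> : om * t + - (om * m) = om * (t - m) by ring.
have -> : cos (om * (t - m)) = cos (om * `|t - m|).
  by have [h|h] := ler0P (t - m); rewrite ?mulrN ?cosN.
have -> : (a < t < b) = (`|t - m| < dl).
  rewrite ltr_norml /m /dl; apply/idP/idP => /andP[h1 h2]; apply/andP; split; lra.
have dm : `|t - m| <= T - dl.
  by rewrite ler_norml /m /dl; apply/andP; split; lra.
have pT : om * T = 2 * pi := omT.
have p0 := pi_gt0 R.
have psi0 : 0 < om * dl by rewrite mulr_gt0// /dl; lra.
have psi1 : om * dl <= pi.
  suff : om * dl <= om * (T / 2) by rewrite mulrA pT; lra.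
  by rewrite ler_pM2l// /dl; lra.
have th0 : 0 <= om * `|t - m| by rewrite mulr_ge0// ltW.
have th1 : om * `|t - m| <= 2 * pi - om * dl.
  by rewrite (_ : 2 * pi - _ = om * (T - dl)) ?ler_pM2l// mulrBr pT.
rewrite -(ltr_pM2l o0); move: (om * `|t - m|) (om * dl) th0 th1 psi0 psi1.
move=> th ps th0 th1 ps0 ps1.
(* The cosine is decreasing on [0, pi] only; a larger angle is reflected to 2 pi - th, which is at
   least [ps] by [th1]. *)
have [thp|thp] := leP th pi.
  by rewrite ltr_cos ?in_itv/=; [|lra..].
have -> : cos th = cos (2 * pi - th).
  by rewrite -[RHS]cosN -[RHS]cosD2pi; congr cos; rewrite -mulr_natl; ring.
rewrite ltr_cos ?in_itv/=; [|lra..].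
by apply/idP/idP; lra.
Qed.

Lemma cas_complete : \forall x \ae I, u x = 0.
Proof. by apply: (intervals_ae0 T0 ui) => a b; exact: coef_itv. Qed.

End completeness.

Lemma cas_basis : orthonormal_basis I cas.
Proof.
split; [move=> j; split|exact: ip_cas|exact: cas_complete].
  exact: measurable_cas.
by exists (Num.sqrt (2 / T)) => x; exact: cas_bnd.
Qed.

End cas.

(** * The basis of the torus, by induction on the dimension *)

Section torus_cons.
Context (R : realType) (n : nat).
Local Notation m := (torus_measure R n).
Local Notation I := (interval_measure (1 : R)).
Local Notation Q := (finite_prod I m).
Local Notation tc := (@tuple_cons R n).
Implicit Types f : n.+1.-tuple (measurableTypeR R) -> R.

Lemma torus_intg_cons f : measurable_fun setT f ->
  intg (torus_measure R n.+1) f <-> intg Q (fun p => f (tc p)).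
Proof.
move=> mf.
have mt : measurable_fun setT tc := @measurable_tuple_cons R n.
have mc : measurable_fun setT (fun p => f (tc p)) by exact: measurableT_comp.
have e : (\int[torus_measure R n.+1]_x `|(EFin \o f) x| =
    \int[Q]_p `|(EFin \o (fun p => f (tc p))) p|)%E.
  apply: (@ge0_integral_pushforward _ _ _ _ _ tc mt Q setT (abse \o (EFin \o f))).
  - exact: measurableT.
  - by apply: measurableT_comp => //; exact/measurable_EFinP.
  - by move=> x _; exact: abse_ge0.
split=> /integrableP[_ h]; apply/integrableP; split; try exact/measurable_EFinP.
- by rewrite -e.
- by rewrite e.
Qed.

Lemma torus_rint_cons f : measurable_fun setT f -> intg Q (fun p => f (tc p)) ->
  rint (torus_measure R n.+1) f = rint Q (fun p => f (tc p)).
Proof.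
move=> mf fi; congr fine.
have mt : measurable_fun setT tc := @measurable_tuple_cons R n.
apply: (@integral_pushforward _ _ _ _ _ tc mt Q setT (EFin \o f)) => //.
exact/measurable_EFinP.
Qed.

End torus_cons.

Definition torus_cas (R : realType) (N : nat) (k : N.-tuple int)
  (x : N.-tuple (measurableTypeR R)) : R := \prod_(i < N) cas 1 (tnth k i) (tnth x i).

Lemma torus_cas_cons (R : realType) (n : nat) (k : n.+1.-tuple int) p :
  torus_cas k (@tuple_cons R n p) = cas 1 (thead k) p.1 * torus_cas (behead_tuple k) p.2.
Proof.
rewrite /torus_cas big_ord_recl; congr (_ * _).
apply: eq_bigr => i _.
have e1 : tnth (behead_tuple k) i = tnth k (lift ord0 i).
  rewrite [LHS]tnth_behead; congr tnth; apply: val_inj.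
  by rewrite /= /bump /= inordK // ltnS.
have e2 : tnth (tuple_cons p) (lift ord0 i) = tnth p.2 i by exact: tnthS.
by rewrite e1 e2.
Qed.

Lemma measurable_torus_cas (R : realType) N (k : N.-tuple int) :
  measurable_fun setT (@torus_cas R N k).
Proof.
rewrite /torus_cas; apply: measurable_prod => i _.
by apply: measurableT_comp; [exact: measurable_cas|exact: measurable_tnth].
Qed.

Lemma torus_cas_bnd (R : realType) N (k : N.-tuple int) x :
  `|@torus_cas R N k x| <= Num.sqrt 2 ^+ N.
Proof.
rewrite /torus_cas normr_prod -[N in leRHS]card_ord -prodr_const.
by apply: ler_prod => i _; rewrite normr_ge0/= (le_trans (cas_bnd _ _ _))// divr1.
Qed.

(** In dimension 0 the measure is a Dirac mass and the basis is the constant 1; the inductive step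
    transports the product basis along [tuple_cons]. *)
Lemma torus_cas_basis (R : realType) N :
  orthonormal_basis (torus_measure R N) (@torus_cas R N).
Proof.
elim: N => [|n IHn].
  have d0 (f : 0.-tuple (measurableTypeR R) -> R) : measurable_fun setT f ->
      rint (torus_measure R 0) f = f [tuple].
    move=> mf; rewrite /rint /Rintegral; transitivity (fine (\int[\d_([tuple] : 0.-tuple (measurableTypeR R))]_x (f x)%:E)) => //.
    by rewrite integral_dirac//; [rewrite diracT mul1e|exact/measurable_EFinP].
  have e1 k x : @torus_cas R 0 k x = 1 by rewrite /torus_cas big_ord0.
  split.
  - move=> k; split; first exact: measurable_torus_cas.
    by exists 1 => x; rewrite e1 normr1.
  - move=> i j; rewrite /ip d0; last by apply: measurable_funM; exact: measurable_torus_cas.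
    by rewrite !e1 mulr1 (tuple0 i) (tuple0 j) eqxx.
  - move=> u [mu _] h; apply: aeW => x; have := h [tuple].
    rewrite /ip d0; last by apply: measurable_funM => //; exact: measurable_torus_cas.
    by rewrite e1 mulr1 (tuple0 x).
have [mb ob cb] := orthonormal_basis_prod (cas_basis (@ltr01 R)) IHn.
have mt : measurable_fun setT (@tuple_cons R n) := @measurable_tuple_cons R n.
have mtc k := @measurable_torus_cas R n.+1 k.
split.
- move=> k; split; first exact: measurable_torus_cas.
  by exists (Num.sqrt 2 ^+ n.+1) => x; exact: torus_cas_bnd.
- move=> i j; have := ob (thead i, behead_tuple i) (thead j, behead_tuple j).
  rewrite -pair_eqE /= => h.
  rewrite /ip torus_rint_cons; last 2 first.
  + exact: measurable_funM.
  + apply: (@intg_bnd _ _ _ _ _ ((Num.sqrt 2 ^+ n.+1) * (Num.sqrt 2 ^+ n.+1))).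
      by apply: (measurableT_comp (f := fun x => torus_cas i x * torus_cas j x)) => //; exact: measurable_funM.
    by move=> p; rewrite normrM ler_pM// torus_cas_bnd.
  rewrite (_ : (fun p => _) = (fun p : measurableTypeR R * n.-tuple (measurableTypeR R) =>
    (cas 1 (thead i) p.1 * torus_cas (behead_tuple i) p.2) *
    (cas 1 (thead j) p.1 * torus_cas (behead_tuple j) p.2))); last first.
    by apply/funext => p; rewrite !torus_cas_cons.
  rewrite [LHS]h; congr (_%:R); congr nat_of_bool.
  apply/andP/eqP => [[/eqP h1 /eqP h2]|->//].
  apply: val_inj; rewrite [in LHS](tuple_eta i) [in RHS](tuple_eta j) /= h1.
  by congr (_ :: _); exact: (congr1 val h2).
- move=> u su h; have [mu u2] := su.
  have mu2 : measurable_fun setT (fun x => u x ^+ 2) by exact: measurable_funX.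
  have sc : sqi (finite_prod (interval_measure 1) (torus_measure R n)) (fun p => u (@tuple_cons R n p)).
    split; first exact: measurableT_comp.
    exact: (torus_intg_cons mu2).1 u2.
  have u0 : \forall p \ae finite_prod (interval_measure (1 : R)) (torus_measure R n), u (@tuple_cons R n p) = 0.
    apply: cb => // -[i j].
    pose k : n.+1.-tuple int := [tuple of i :: j].
    have kE p : cas 1 i p.1 * torus_cas j p.2 = torus_cas k (@tuple_cons R n p).
      by rewrite torus_cas_cons; congr (_ * torus_cas _ _); exact: val_inj.
    rewrite -[RHS](h k) /ip.
    rewrite torus_rint_cons; first by congr rint; apply/funext => p; rewrite -kE.
      exact: measurable_funM.
    apply: (sqi_intgM sc); rewrite (_ : (fun x => _) = (fun p => cas 1 i p.1 * torus_cas j p.2)).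
      by have [m [M hM]] := mb (i, j); exact: sqi_bnd m hM.
    by apply/funext => p; rewrite kE.
  have r0 : rint (torus_measure R n.+1) (fun x => u x ^+ 2) = 0.
    have [_ sc2] := sc.
    rewrite torus_rint_cons// -[RHS](rint0 (finite_prod (interval_measure (1 : R)) (torus_measure R n))).
    apply: rint_ae => //; first exact: intg_measurable sc2.
    by apply: filterS u0 => p ->; rewrite expr0n.
  have := rint_eq0 u2 (fun x => sqr_ge0 (u x)) r0.
  by apply: filterS => x /eqP; rewrite sqrf_eq0 => /eqP.
Qed.

Definition torus_eig (R : realType) (N : nat) (k : N.-tuple int) : R :=
  \sum_(i < N) (2 * pi * (tnth k i)%:~R) ^+ 2.

(* The value n%:R at the indices which enumerate no frequency, where
   [enum_basis] vanishes, keeps the sequence tending to +oo. *)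
Definition enum_eig (R : realType) N (n : nat) : R :=
  oapp (@torus_eig R N) n%:R (@pickle_inv (N.-tuple int) n).

Lemma enum_eig_ge0 (R : realType) N n : 0 <= enum_eig R N n.
Proof.
rewrite /enum_eig; case: pickle_inv => [k|] //=.
by apply: sumr_ge0 => i _; exact: sqr_ge0.
Qed.

(** An eigenvalue below L confines each coordinate of the frequency to [-B, B], since (2 pi)^2 >= 1
    and |a| <= a^2 for integers; only finitely many codes are left. *)
Lemma enum_eig_infty (R : realType) N (L : R) :
  exists n0, forall n, (n0 <= n)%N -> L <= enum_eig R N n.
Proof.
pose B := (Num.truncn L).+1.
(* Enumerates the integer points of the cube [-B, B]^N, coordinates being shifted by B. *)
pose tup (f : {ffun 'I_N -> 'I_(B + B).+1}) : N.-tuple int :=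
  [tuple (f i : nat)%:Z - B%:Z | i < N].
pose M := \max_(f : {ffun 'I_N -> 'I_(B + B).+1}) pickle (tup f).
exists (maxn M.+1 B) => n; rewrite geq_max => /andP[Mn Bn].
have LB : L <= B%:R by rewrite ltW// truncnS_gt.
rewrite /enum_eig; have := @pickle_invK (N.-tuple int) n.
case: pickle_inv => [k|] /= kn; last by rewrite (le_trans LB)// ler_nat.
rewrite leNgt; apply/negP => kL; move: Mn; rewrite ltnNge => /negP; apply.
have kB i : (`|tnth k i| <= B)%N.
  rewrite -(ler_nat R) (le_trans _ LB)//; apply: le_trans (ltW kL).
  rewrite /torus_eig (bigD1 i)//= -[leLHS]addr0 lerD ?sumr_ge0//; last first.
    by move=> j _; exact: sqr_ge0.
  rewrite exprMn.
  have -> : ((tnth k i)%:~R : R) ^+ 2 = (absz (tnth k i) ^ 2)%:R.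
    by rewrite natrX natr_absz intr_norm real_normK ?num_real.
  have p1 : 1 <= (2 * pi : R) ^+ 2.
    by rewrite exprn_ege1//; have := pi_ge2 R; lra.
  apply: (@le_trans _ _ (absz (tnth k i) ^ 2)%:R); last exact: ler_peMl.
  by rewrite ler_nat; case: (absz _) => // a; rewrite expnS leq_pmulr// expn_gt0.
rewrite -kn.
have -> : k = tup [ffun i => inord (absz (tnth k i + B%:Z))].
  apply: eq_from_tnth => i; rewrite tnth_mktuple ffunE inordK.
    by have := kB i; lia.
  by have := kB i; lia.
exact: leq_bigmax.
Qed.

(** * Modes in time and the energy inequality *)

Section modes.
Context (R : realType) (T : R) d (X : measurableType d).
Variable m : {finite_measure set X -> \bar R}.
Variable e : nat -> X -> R.
Hypothesis he : hilbert_basis m e.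
Local Notation I := (interval_measure T).
Local Notation Q := (finite_prod I m).
Implicit Types (u v w f g : measurableTypeR R * X -> R).

(** Meaningful at the times where the section of [u] is square-integrable, that is almost everywhere
    for [u] in L^2(Q); other times form a null set. *)
Definition mode u k (t : measurableTypeR R) : R := ip m (fun x => u (t, x)) (e k).

Definition chi (s t x : R) : R := (s < x < t)%R%:R.

(* The integral of p over ]s, t[ `&` [0, T[. *)
Definition prim (p : measurableTypeR R -> R) s t : R := rint I (fun x => p x * chi s t x).

Lemma chi_bnd s t x : `|chi s t x| <= 1.
Proof. by rewrite /chi; case: (s < x < t); rewrite ?normr1 ?normr0. Qed.

Lemma chi_ge0 s t x : 0 <= chi s t x.
Proof. exact: ler0n. Qed.

Lemma measurable_chi d' (Y : measurableType d') (a b c : Y -> measurableTypeR R) :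
  measurable_fun setT a -> measurable_fun setT b -> measurable_fun setT c ->
  measurable_fun setT (fun y => chi (a y) (b y) (c y)).
Proof.
move=> ma mb mc.
apply: (measurableT_comp (f := fun b : bool => b%:R : R)) => //.
by apply: measurable_and; exact: measurable_fun_ltr.
Qed.

Lemma measurable_chi1 s t : measurable_fun setT (chi s t : measurableTypeR R -> R).
Proof. exact: (@measurable_chi _ _ (fun=> s) (fun=> t) id). Qed.

Lemma basis_bnd k : exists2 M, 0 <= M & forall x, `|e k x| <= M.
Proof.
have [/(_ k)[_ [M hM]] _ _ _] := he.
by exists `|M| => // x; rewrite (le_trans (hM x))// ler_norm.
Qed.

Lemma measurable_basis k : measurable_fun setT (e k).
Proof. by have [/(_ k)[]] := he. Qed.

Lemma sqiM_basis u k : sqi Q u -> sqi Q (fun p => u p * e k p.2).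
Proof.
move=> su; have [M _ hM] := basis_bnd k.
apply: (sqiM su) (fun p => hM p.2); apply: measurableT_comp => //.
exact: measurable_basis.
Qed.

Lemma sqi_mode u k : sqi Q u -> sqi I (mode u k).
Proof. by move=> su; exact: sqi_rint2 (sqiM_basis k su). Qed.

Lemma intg_chi (p : measurableTypeR R -> R) s t : intg I p -> intg I (fun x => p x * chi s t x).
Proof. by move=> ipp; exact: intgM ipp (measurable_chi1 s t) (chi_bnd s t). Qed.

Lemma rint_mode u k (b : measurableTypeR R -> R) M : sqi Q u ->
  measurable_fun setT b -> (forall t, `|b t| <= M) ->
  rint I (fun t => mode u k t * b t) = rint Q (fun p => u p * (b p.1 * e k p.2)).
Proof.
move=> su mb bM.
have sb : sqi Q (fun p => u p * e k p.2 * b p.1).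
  apply: (sqiM (sqiM_basis k su)) (fun p => bM p.1); exact: measurableT_comp.
transitivity (rint Q (fun p => u p * e k p.2 * b p.1)); last first.
  by congr rint; apply/funext => p; ring.
have [_ ->] := fubini1 (sqi_intg sb).
have mfu := sqi_mode k su.
have [i1 _] := fubini1 (sqi_intg sb).
apply: rint_ae.
- apply: measurable_funM => //; exact: sqi_measurable mfu.
- exact: intg_measurable i1.
apply: filterS (ae_sqi1 su) => t st /=.
rewrite mulrC -rintZ; last by apply: sqi_intgM => //; exact: basis_sqi.
by congr rint; apply/funext => x; ring.
Qed.

Lemma prim_mode u k s t : sqi Q u ->
  prim (mode u k) s t = rint Q (fun p => u p * (chi s t p.1 * e k p.2)).
Proof.
by move=> su; apply: (rint_mode k su (measurable_chi1 s t) (chi_bnd s t)).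
Qed.

(** Parseval's identity in space at almost every time, integrated by dominated convergence thanks to
    [parseval_bound]. *)
Lemma parseval_time u v (b : measurableTypeR R -> R) M : sqi Q u -> sqi Q v ->
  measurable_fun setT b -> (forall t, `|b t| <= M) ->
  \sum_(k < n) rint I (fun t => mode u k t * mode v k t * b t) @[n --> \oo] -->
  rint Q (fun p => u p * v p * b p.1).
Proof.
move=> su sv mb bM.
have iuv := sqi_intgM su sv.
have iuvb : intg Q (fun p => u p * v p * b p.1).
  by apply: (intgM iuv) (fun p => bM p.1); exact: measurableT_comp.
have [i1 E] := fubini1 iuvb.
rewrite E.
have imk k : intg I (fun t => mode u k t * mode v k t * b t).
  by apply: intgM bM => //; apply: sqi_intgM; exact: sqi_mode.
under eq_cvg do rewrite -rint_sum//.
have [_ u2] := su; have [_ v2] := sv.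
have [iu2 _] := fubini1 u2; have [iv2 _] := fubini1 v2.
apply: (@rdct _ _ _ I _ _ (fun t => M * (rint m (fun x => u (t, x) ^+ 2) +
   rint m (fun x => v (t, x) ^+ 2))) _ _ _ _ _).2.
- by move=> n; apply: intg_measurable; apply: intg_sum.
- exact: intg_measurable i1.
- apply: filterS2 (ae_sqi1 su) (ae_sqi1 sv) => t st tt.
  have -> : rint m (fun x => u (t, x) * v (t, x) * b (t, x).1) =
     ip m (fun x => u (t, x)) (fun x => v (t, x)) * b t.
    rewrite mulrC -rintZ; last exact: sqi_intgM.
    by congr rint; apply/funext => x; ring.
  under eq_cvg do rewrite -mulr_suml.
  by apply: cvgM; [exact: parseval|exact: cvg_cst].
- by apply: intgZ; exact: intgD.
- move=> n; apply: filterS2 (ae_sqi1 su) (ae_sqi1 sv) => t st tt.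
  rewrite -mulr_suml normrM mulrC.
  apply: ler_pM => //; rewrite -!ip_sqr; exact: parseval_bound.
Qed.

End modes.

(** * Iterated time integrals *)

Section triangle.
Context (R : realType) (T : R).
Local Notation I := (interval_measure T).
Local Notation II := (finite_prod I I).
Implicit Types p q : measurableTypeR R -> R.

(** Indicator of the triangle s < z.2 < z.1 < t, the domain of an iterated time integral. *)
Definition tri (s t : R) (z : measurableTypeR R * measurableTypeR R) : R :=
  chi s t z.1 * chi s z.1 z.2.

Lemma tri_bnd s t z : `|tri s t z| <= 1.
Proof. by rewrite normrM mulr_ile1// chi_bnd. Qed.

Lemma tri_ge0 s t z : 0 <= tri s t z.
Proof. by rewrite mulr_ge0// chi_ge0. Qed.

Lemma measurable_tri s t : measurable_fun setT (tri s t).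
Proof.
apply: measurable_funM.
- exact: (@measurable_chi _ _ _ (fun=> s) (fun=> t) fst).
- exact: (@measurable_chi _ _ _ (fun=> s) fst snd).
Qed.

Lemma intg_tri p q s t : sqi I p -> sqi I q ->
  intg II (fun z => p z.1 * q z.2 * tri s t z).
Proof.
move=> sp sq; apply: intgM (measurable_tri s t) (tri_bnd s t).
by apply: sqi_intgM; [exact: sqi_fst|exact: sqi_snd].
Qed.

Lemma rint_tri p q s t : sqi I p -> sqi I q ->
  rint I (fun x => p x * prim T q s x * chi s t x) =
  rint II (fun z => p z.1 * q z.2 * tri s t z).
Proof.
move=> sp sq; have [_ ->] := fubini1 (intg_tri s t sp sq).
congr rint; apply/funext => x.
rewrite /prim mulrAC -rintZ; last by apply: intg_chi; exact: sqi_intg.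
by congr rint; apply/funext => y; rewrite /tri /=; ring.
Qed.

Lemma intg_prim_chi p q s t : sqi I p -> sqi I q ->
  intg I (fun x => p x * prim T q s x * chi s t x).
Proof.
move=> sp sq; have [i1 _] := fubini1 (intg_tri s t sp sq).
rewrite (_ : (fun x => _) =
  (fun x => rint I (fun y => p x * q y * tri s t (x, y)))) //.
apply/funext => x.
rewrite /prim mulrAC -rintZ; last by apply: intg_chi; exact: sqi_intg.
by congr rint; apply/funext => y; rewrite /tri /=; ring.
Qed.

(** The squared primitive is an integral over a square, which consists of the triangle, its mirror
    image and a null diagonal, and the integrand is symmetric. This is the identity P P' = (P^2 /
    2)' without differentiation. *)
Lemma rint_tri_diag p s t : sqi I p ->
  rint II (fun z => p z.1 * p z.2 * tri s t z) = 2^-1 * prim T p s t ^+ 2.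
Proof.
move=> sp.
have i1 := intg_tri s t sp sp.
have mtri' : measurable_fun setT (fun z : measurableTypeR R * measurableTypeR R => tri s t (z.2, z.1)).
  by apply: (measurableT_comp (measurable_tri s t)); exact: measurable_swap.
have spp : intg II (fun z => p z.1 * p z.2).
  by apply: sqi_intgM; [exact: sqi_fst|exact: sqi_snd].
have i2 : intg II (fun z => p z.1 * p z.2 * tri s t (z.2, z.1)).
  by apply: intgM mtri' (fun z => tri_bnd s t _).
have e2 : rint II (fun z => p z.1 * p z.2 * tri s t (z.2, z.1)) =
    rint II (fun z => p z.1 * p z.2 * tri s t z).
  have [_ ->] := fubini2 i2; have [_ ->] := fubini1 i1.
  congr rint; apply/funext => x; congr rint; apply/funext => y /=.
  by rewrite [p x * p y]mulrC.
have sc : sqi I (fun x => p x * chi s t x).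
  exact: sqiM sp (measurable_chi1 s t) (chi_bnd s t).
have e3 : rint II (fun z => (p z.1 * chi s t z.1) * (p z.2 * chi s t z.2)) = prim T p s t ^+ 2.
  have i3 : intg II (fun z => (p z.1 * chi s t z.1) * (p z.2 * chi s t z.2)).
    apply: sqi_intgM; [exact: (sqi_fst _ sc)|exact: (sqi_snd _ sc)].
  have [_ ->] := fubini1 i3; rewrite /=.
  rewrite (_ : (fun x => _) = (fun x => rint I (fun y => p y * chi s t y) * (p x * chi s t x))); last first.
    by apply/funext => x; rewrite rintZ 1?mulrC//; exact: sqi_intg.
  by rewrite rintZ ?expr2//; exact: sqi_intg.
suff : rint II (fun z => p z.1 * p z.2 * tri s t z) + rint II (fun z => p z.1 * p z.2 * tri s t z) = prim T p s t ^+ 2.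
  by move=> <-; field.
have i12 := intgD i1 i2.
have i3 : intg II (fun z => (p z.1 * chi s t z.1) * (p z.2 * chi s t z.2)).
  by apply: sqi_intgM; [exact: (sqi_fst _ sc)|exact: (sqi_snd _ sc)].
rewrite -{2}e2 -rintD// -e3.
have [_ ->] := fubini1 i12; have [_ ->] := fubini1 i3.
congr rint; apply/funext => x; apply: rint_ae.
- exact: (measurable_fun_pair2 x (intg_measurable i12)).
- exact: (measurable_fun_pair2 x (intg_measurable i3)).
apply: filterS (interval_ae_neq T x) => y /= /eqP yx.
have -> : p x * chi s t x * (p y * chi s t y) =
   p x * p y * (chi s t x * chi s t y) by ring.
rewrite -mulrDr; congr (_ * _); rewrite /tri /chi /= -!natrM !mulnb -natrD.
congr (_%:R); move: yx.
case: (ltgtP y x) => // yx _; rewrite !andbT ?andbF /= ?addn0 ?add0n; congr nat_of_bool.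
- by apply/idP/idP => /andP[/andP[? ?] ?]; apply/andP; split; lra.
- by apply/idP/idP => /andP[/andP[? ?] ?]; apply/andP; split; lra.
Qed.

End triangle.

(** * The energy inequality *)

Section energy.
Context (R : realType) (T : R) d (X : measurableType d).
Variable m : {finite_measure set X -> \bar R}.
Variables (e : nat -> X -> R) (lam : nat -> R).
Hypothesis he : hilbert_basis m e.
Hypothesis lam_ge0 : forall k, 0 <= lam k.
Local Notation I := (interval_measure T).
Local Notation Q := (finite_prod I m).
Local Notation II := (finite_prod I I).
Local Notation mode := (mode m e).
Local Notation prim := (prim T).
Implicit Types (u v w f g : measurableTypeR R * X -> R).

(** For almost every pair of times the limit given by Parseval's identity is the integral of a
    product of nonnegative functions. With negative parts the limit is the constant 0, so only the
    sign of that integral has to be known. *)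
Lemma cvg_negpart_pairing f g s t : sqi Q f -> sqi Q g ->
  (forall p, 0 <= f p) -> (forall p, 0 <= g p) ->
  let h n z := \sum_(k < n) mode g k z.1 * mode f k z.2 * tri s t z in
  (forall n, intg II (h n)) /\
  (forall n, intg II (fun z => Num.max (- h n z) 0)) /\
  rint II (fun z => Num.max (- h n z) 0) @[n --> \oo] --> 0.
Proof.
move=> sf sg f0 g0 h.
have ih n : intg II (h n).
  by apply: intg_sum => k; apply: intg_tri; exact: sqi_mode.
have mm n : measurable_fun setT (fun z => Num.max (- h n z) 0).
  apply: measurable_maxr => //; apply: measurableT_comp => //.
  exact: intg_measurable (ih n).
split => //; split.
  move=> n; apply: (intg_dom (mm n) (intg_norm (ih n))) => z.
  rewrite ger0_norm ?le_max ?lexx ?orbT//.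
  by rewrite ge_max normr_ge0 andbT -normrN ler_norm.
have [_ f2] := sf; have [_ g2] := sg.
have [if2 _] := fubini1 f2; have [ig2 _] := fubini1 g2.
rewrite -[X in _ --> X](rint0 II).
apply: (@rdct _ _ _ II _ _ (fun z => rint m (fun x => g (z.1, x) ^+ 2) +
   rint m (fun x => f (z.2, x) ^+ 2)) _ _ _ _ _).2 => //.
- apply: filterS2 (ae_fst I (ae_sqi1 sg)) (ae_snd I (ae_sqi1 sf)) => z sgz sfz.
  have c : h n z @[n --> \oo] -->
      ip m (fun x => g (z.1, x)) (fun x => f (z.2, x)) * tri s t z.
    rewrite /h; under eq_cvg do rewrite -mulr_suml.
    by apply: cvgM; [exact: parseval|exact: cvg_cst].
  set l := _ * tri s t z in c.
  have l0 : 0 <= l.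
    by rewrite mulr_ge0 ?tri_ge0// rint_ge0// => x; rewrite mulr_ge0.
  apply/cvgrPdist_le => eps eps0; have /cvgrPdist_le/(_ _ eps0) c' := c.
  near=> n; have le : `|l - h n z| <= eps by near: n; exact: c'.
   rewrite sub0r normrN ger0_norm ?le_max ?lexx ?orbT//.
  rewrite ge_max (ltW eps0) andbT; apply: le_trans le.
  by apply: le_trans (ler_norm _); rewrite lerDr.
- exact: (intgD (intg_fst I ig2) (intg_snd I if2)).
- move=> n.
  apply: filterS2 (ae_fst I (ae_sqi1 sg)) (ae_snd I (ae_sqi1 sf)) => z sgz sfz.
  rewrite ger0_norm ?le_max ?lexx ?orbT//.
  have b : `|h n z| <= rint m (fun x => g (z.1, x) ^+ 2) + rint m (fun x => f (z.2, x) ^+ 2).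
    rewrite /h -mulr_suml normrM -[leRHS]mulr1.
    apply: ler_pM => //; last exact: tri_bnd.
    by rewrite -!ip_sqr; exact: parseval_bound.
  rewrite ge_max; apply/andP; split; last exact: le_trans b.
  by apply: le_trans b; rewrite -normrN ler_norm.
Unshelve. all: by end_near. Qed.

(* Multiply the equation of each mode of w by the mode of g and sum: the terms
   lam k * prim (mode g k) s t ^+ 2 appear with a favourable sign, and so does the
   contribution of f in the limit, as f and g are non-negative. *)
Lemma energy_inequality (u0 : X -> R) w g f s t K : sqi m u0 -> sqi Q w ->
  sqi Q g -> sqi Q f -> (forall p, 0 <= g p) -> (forall p, 0 <= f p) ->
  (forall k, \forall x \ae I, s < x -> mode w k x =
    ip m u0 (e k) - lam k * prim (mode g k) s x - prim (mode f k) s x) ->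
  rint Q (fun p => w p * g p * chi s t p.1) +
    2^-1 * \sum_(k < K) lam k * prim (mode g k) s t ^+ 2 <=
  rint Q (fun p => u0 p.2 * g p * chi s t p.1).
Proof.
move=> su0 sw sg sf g0 f0 hm.
pose h n z := \sum_(k < n) mode g k z.1 * mode f k z.2 * tri s t z.
have [ih [in_ cn]] : (forall n, intg II (h n)) /\
  (forall n, intg II (fun z => Num.max (- h n z) 0)) /\
  rint II (fun z => Num.max (- h n z) 0) @[n --> \oo] --> 0.
  exact: (cvg_negpart_pairing s t sf sg f0 g0).
have mc := measurable_chi1 s t; have bc := chi_bnd s t.
have cA := parseval_time he sw sg mc bc.
have su0' : sqi Q (fun p => u0 p.2) by exact: sqi_snd.
have cB := parseval_time he su0' sg mc bc.
pose A n := \sum_(k < n) rint I (fun x => mode w k x * mode g k x * chi s t x).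
pose B n := \sum_(k < n) rint I (fun x => mode (fun p => u0 p.2) k x * mode g k x * chi s t x).
have {}cA : A n @[n --> \oo] --> rint Q (fun p => w p * g p * chi s t p.1) := cA.
have {}cB : B n @[n --> \oo] --> rint Q (fun p => u0 p.2 * g p * chi s t p.1) := cB.
pose C n := 2^-1 * \sum_(k < n) lam k * prim (mode g k) s t ^+ 2.
(* Exact balance of the first n modes. The equation is given for x > s only, which is enough since
   [chi s t] vanishes elsewhere. *)
have key n : A n + C n = B n - rint II (h n).
  rewrite /C /h rint_sum; last by move=> k; apply: intg_tri; exact: sqi_mode.
  rewrite /A /B mulr_sumr -big_split -sumrB /=; apply: eq_bigr => k _.
  have sgk := sqi_mode he k sg; have sfk := sqi_mode he k sf.
  have iu : intg I (fun x => ip m u0 (e k) * mode g k x * chi s t x).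
    by apply: intg_chi; apply: intgZ; exact: sqi_intg.
  have iP := intg_prim_chi s t sgk sgk.
  have iF := intg_prim_chi s t sgk sfk.
  have -> : rint I (fun x => mode w k x * mode g k x * chi s t x) =
      rint I (fun x => ip m u0 (e k) * mode g k x * chi s t x -
        (lam k * (mode g k x * prim (mode g k) s x * chi s t x) +
        mode g k x * prim (mode f k) s x * chi s t x)).
    apply: rint_ae.
    - apply: measurable_funM => //; apply: measurable_funM.
        exact: sqi_measurable (sqi_mode he k sw).
      exact: sqi_measurable sgk.
    - exact: intg_measurable (intgB iu (intgD (intgZ (lam k) iP) iF)).
    have FF : Filter (almost_everywhere I) by exact: ae_filter_ringOfSetsType.
    apply: filterS (hm k) => x hx.
    have [sx|xs] := ltP s x; first by rewrite hx//; ring.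
    have -> : chi s t x = 0 by rewrite /chi ltNge xs.
    by ring.
  rewrite rintB//; last exact: (intgD (intgZ (lam k) iP) iF).
  rewrite rintD//; last exact: intgZ.
  rewrite rintZ// !rint_tri// rint_tri_diag//.
  by rewrite -[rint I (fun x => mode (fun p => u0 p.2) k x * _ * _)]/(rint I _); ring.
have homC : {homo C : a b / (a <= b)%N >-> a <= b}.
  apply: homo_leq => //; first by move=> x y z; exact: le_trans.
  move=> n; rewrite /C ler_pM2l// big_ord_recr /= lerDl.
  by rewrite mulr_ge0// sqr_ge0.
rewrite addrC -lerBrDr.
have cl : B n + rint II (fun z => Num.max (- h n z) 0) - A n @[n --> \oo] -->
    rint Q (fun p => u0 p.2 * g p * chi s t p.1) + 0 -
    rint Q (fun p => w p * g p * chi s t p.1).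
  by apply: cvgB => //; exact: cvgD.
rewrite -[X in X - _]addr0 -(cvg_lim (@Rhausdorff R) cl).
apply: limr_ge; first by apply/cvg_ex; eexists; exact: cl.
near=> n.
(* Keeping K of the n modes drops nonnegative terms only. *)
apply: (@le_trans _ _ (C n)); first by apply: homC; near: n; exact: nbhs_infty_ge.
rewrite -[leLHS](addKr (A n)) key addrC lerD2r lerD2l.
rewrite -rintN//; apply: rint_le => //; first exact: intgN.
by move=> z; rewrite le_max lexx.
Unshelve. all: by end_near. Qed.

End energy.

(** * Time windows and Steklov averages *)

Section windows.
Context (R : realType) (T : R).
Hypothesis T0 : 0 < T.
Local Notation I := (interval_measure T).
Local Notation II := (finite_prod I I).
Local Notation prim := (prim T).
Implicit Types p q a : measurableTypeR R -> R.

Lemma prim_sub p s t : intg I p -> 0 <= s -> s < t ->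
  prim p 0 t - prim p 0 s = prim p s t.
Proof.
move=> pp s0 st; rewrite /prim -rintB; [|exact: intg_chi..].
apply: rint_ae.
- exact: intg_measurable (intgB (intg_chi 0 t pp) (intg_chi 0 s pp)).
- exact: intg_measurable (intg_chi s t pp).
apply: filterS (interval_ae_neq T s) => x /eqP xs.
rewrite -mulrBr; congr (_ * _); rewrite /chi.
case: (ltgtP x s) xs => // xs _.
  by rewrite (lt_trans xs st) !andbT subrr.
by rewrite (le_lt_trans s0 xs) andbF subr0.
Qed.

Lemma integral_itv_oo (s t : R) : s <= t ->
  (\int[@lebesgue_measure R]_x (\1_`]s, t[%classic x)%:E = (t - s)%:E)%E.
Proof.
move=> st; have e : @lebesgue_measure R `]s, t[%classic = (t - s)%:E.
  rewrite lebesgue_measure_itv/= lte_fin; case: ltP => // ts.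
  by rewrite (_ : t - s = 0)//; apply/eqP; rewrite subr_eq0 eq_le st ts.
by rewrite integral_indic// setIT; exact: e.
Qed.

(** Only an upper bound, as the interval may stick out of [0, T[. *)
Lemma rint_chi_le s t : s <= t -> rint I (chi s t) <= t - s.
Proof.
move=> st.
rewrite rint_interval; last exact: measurable_chi1.
rewrite Rintegral_mkcond.
rewrite /Rintegral -lee_fin.
have le : (\int[@lebesgue_measure R]_x ((chi s t \_ `[0%R, T[%classic) x)%:E <= (t - s)%:E)%E.
  apply: (@le_trans _ _ (\int[@lebesgue_measure R]_x (\1_`]s, t[%classic x)%:E)%E).
    apply: ge0_le_integral => //.
    - by move=> x _; rewrite patchE lee_fin; case: ifP => _; [exact: chi_ge0|exact: lexx].
    - apply/measurable_EFinP; apply/(measurable_restrictT _ _).1 => //.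
      by apply: measurable_funTS; exact: measurable_chi1.
    - by apply/measurable_EFinP; exact: measurable_indic.
    - move=> x _; rewrite lee_fin patchE; case: ifP => _ //.
      by rewrite indicE mem_setE in_itv.
  by rewrite integral_itv_oo.
rewrite fineK//.
by rewrite ge0_fin_numE ?(le_lt_trans le) ?ltry//; apply: integral_ge0 => x _;
  rewrite patchE lee_fin; case: ifP => _; [exact: chi_ge0|exact: lexx].
Qed.

Lemma rint_chi s t : 0 <= s -> s <= t -> t <= T -> rint I (chi s t) = t - s.
Proof.
move=> s0 st tT; rewrite rint_interval; last exact: measurable_chi1.
rewrite Rintegral_mkcond.
transitivity (\int[@lebesgue_measure R]_x (\1_`]s, t[%classic x : R)).
  congr fine; apply: eq_integral => x _; rewrite patchE indicE !mem_setE !in_itv/=.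
  rewrite /chi; case: ifP => // /negbT h; congr (_%:E).
  case: (boolP (s < x < t)) => // /andP[sx xt].
  by move: h; rewrite (le_trans s0 (ltW sx)) (lt_le_trans xt tT).
by rewrite /Rintegral integral_itv_oo.
Qed.

(** The forward Steklov average multiplied by h, with [p] counted as 0 beyond T. *)
Definition win p h s : R := prim p s (s + h).

Definition wchi (h : R) (z : measurableTypeR R * measurableTypeR R) : R :=
  chi z.1 (z.1 + h) z.2.

Lemma measurable_wchi h : measurable_fun setT (wchi h).
Proof.
apply: (@measurable_chi _ _ _ fst (fun z => z.1 + h) snd) => //.
exact: measurable_funD.
Qed.

(** As a function of its starting point, the window containing t ranges over the interval of length
    h behind t; after Fubini the average thus falls on the other factor. *)
Lemma wchiE h s t : wchi h (s, t) = chi (t - h) t s.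
Proof.
rewrite /wchi /chi /= andbC; congr (_%:R); congr nat_of_bool.
by rewrite ltrBlDr.
Qed.

Lemma intg_wchi a p h : sqi I a -> sqi I p ->
  intg II (fun z => a z.1 * p z.2 * wchi h z).
Proof.
move=> sa sp; apply: (@intgM _ _ _ _ _ _ 1); last 2 first.
- exact: measurable_wchi.
- by move=> z; exact: chi_bnd.
by apply: sqi_intgM; [exact: sqi_fst|exact: sqi_snd].
Qed.

Lemma sqi_win p h : sqi I p -> sqi I (win p h).
Proof.
move=> sp; have s1 : sqi II (fun z => p z.2 * wchi h z).
  apply: (@sqiM _ _ _ _ _ _ 1); [exact: (sqi_snd I sp)|exact: measurable_wchi|].
  by move=> z; exact: chi_bnd.
exact: sqi_rint2 s1.
Qed.

Lemma win_bnd p h s : intg I p -> `|win p h s| <= rint I (fun x => `|p x|).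
Proof.
move=> pp; apply: le_trans (rint_abs (intg_chi _ _ pp)) _.
apply: rint_le; [exact: intg_norm (intg_chi _ _ pp)|exact: intg_norm|].
by move=> x; rewrite normrM ler_piMr// chi_bnd.
Qed.

Lemma rint_win a p h : sqi I a -> sqi I p ->
  rint I (fun s => a s * win p h s) = rint II (fun z => a z.1 * p z.2 * wchi h z).
Proof.
move=> sa sp; have [_ ->] := fubini1 (intg_wchi h sa sp).
congr rint; apply/funext => s; rewrite /win /prim -rintZ.
  by congr rint; apply/funext => x; rewrite mulrA.
by apply: intg_chi; exact: sqi_intg.
Qed.

(** Schur's test: the kernel [wchi h] has integral at most h in either variable, and Young's
    inequality of weight [eta] splits the product. *)
Lemma schur a p h eta : 0 <= h -> 0 < eta -> sqi I a -> sqi I p ->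
  `|rint I (fun s => a s * win p h s)| <= h * (eta^-1 * nrm2 I a + eta * nrm2 I p).
Proof.
move=> h0 e0 sa sp; rewrite rint_win//; have ii := intg_wchi h sa sp.
apply: le_trans (rint_abs ii) _.
have mw := measurable_wchi h.
have wb z : `|wchi h z| <= 1 by exact: chi_bnd.
have w0 z : 0 <= wchi h z by exact: chi_ge0.
have [_ a2] := sa; have [_ p2] := sp.
have ia : intg II (fun z => a z.1 ^+ 2 * wchi h z).
  by apply: (@intgM _ _ _ _ _ _ 1) => //; exact: (intg_fst I a2).
have ip : intg II (fun z => p z.2 ^+ 2 * wchi h z).
  by apply: (@intgM _ _ _ _ _ _ 1) => //; exact: (intg_snd I p2).
apply: (@le_trans _ _ (rint II (fun z => eta^-1 * (a z.1 ^+ 2 * wchi h z) +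
   eta * (p z.2 ^+ 2 * wchi h z)))).
  apply: rint_le; first exact: intg_norm.
    by apply: intgD; exact: intgZ.
  move=> z; rewrite !normrM (ger0_norm (w0 z)).
  rewrite [eta^-1 * (_ * _)]mulrA [eta * (_ * _)]mulrA -mulrDl ler_wpM2r//.
  rewrite -(real_normK (num_real (a z.1))) -(real_normK (num_real (p z.2))).
  move: (`|a z.1|) (`|p z.2|) => x y.
  rewrite -(ler_pM2l e0) mulrDr [eta * (eta^-1 * _)]mulrA mulfV ?gt_eqF// mul1r.
  by have := sqr_ge0 (x - eta * y); nra.
rewrite rintD; [|exact: intgZ..]; rewrite !rintZ// mulrDr; apply: lerD.
- rewrite mulrCA ler_pM2l ?invr_gt0//.
  have [ia1 ->] := fubini1 ia.
  rewrite /nrm2 ip_sqr -rintZ//; apply: rint_le => //; first exact: intgZ.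
  move=> s /=; rewrite rintZ.
    rewrite mulrC ler_wpM2r ?sqr_ge0//.
    have := @rint_chi_le s (s + h); rewrite addrAC subrr add0r; apply.
    by rewrite lerDl.
  apply: (@intg_bnd _ _ _ _ _ 1) => [|x]; last exact: chi_bnd.
  exact: (measurable_chi1 s (s + h)).
- rewrite mulrCA ler_pM2l//.
  have [ip1 ->] := fubini2 ip.
  rewrite /nrm2 ip_sqr -rintZ//; apply: rint_le => //; first exact: intgZ.
  move=> t; rewrite (_ : (fun x => _) = (fun x => p t ^+ 2 * chi (t - h) t x)).
    rewrite rintZ.
      rewrite mulrC ler_wpM2r ?sqr_ge0//.
      have := @rint_chi_le (t - h) t; rewrite (_ : t - (t - h) = h); last by ring.
      apply.
      by rewrite lerBlDr lerDl.
    apply: (@intg_bnd _ _ _ _ _ 1) => [|x]; last exact: chi_bnd.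
    exact: (measurable_chi1 (t - h) t).
  by apply/funext => x; rewrite wchiE.
Qed.

End windows.

Section steklov.
Context (R : realType) (T : R).
Hypothesis T0 : 0 < T.
Local Notation I := (interval_measure T).
Local Notation prim := (prim T).
Local Notation win := (win T).
Implicit Types p a : measurableTypeR R -> R.

Lemma intg_chi_cst s t : intg I (chi s t).
Proof.
apply: (@intg_bnd _ _ _ _ _ 1) => [|x]; last exact: chi_bnd.
exact: (measurable_chi1 s t).
Qed.

Lemma average_cvg a t : continuous (a : R -> R) -> intg I a -> 0 < t -> t < T ->
  (harmonic n)^-1 * rint I (fun s => a s * chi (t - harmonic n) t s) @[n --> \oo] --> a t.
Proof.
move=> ca ia t0 tT; apply/cvgrPdist_le => eps eps0.
have /cvgrPdist_le/(_ _ eps0) := ca t.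
move=> [del /= del0 hdel].
have h0 : @harmonic R n @[n --> \oo] --> 0 := cvg_harmonic.
have /cvgrPdist_lt/(_ _ del0) h1 := h0.
have /cvgrPdist_lt/(_ _ t0) h2 := h0.
near=> n.
have hp : 0 < harmonic n :> R by exact: harmonic_gt0.
have hd : harmonic n < del.
  have : `|0 - harmonic n| < del by near: n; exact: h1.
  by rewrite sub0r normrN gtr0_norm.
have ht : harmonic n < t.
  have : `|0 - harmonic n| < t by near: n; exact: h2.
  by rewrite sub0r normrN gtr0_norm.
set h := harmonic n in hp hd ht *.
have th : 0 <= t - h by rewrite subr_ge0 ltW.
have hth : t - h <= t by rewrite lerBlDr lerDl ltW.
have rc : rint I (chi (t - h) t) = h by rewrite rint_chi// ?(ltW tT)//; ring.
have i1 : intg I (fun s => a s * chi (t - h) t s) by exact: intg_chi.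
have i2 : intg I (fun s => a t * chi (t - h) t s) by apply: intgZ; exact: intg_chi_cst.
have -> : a t - h^-1 * rint I (fun s => a s * chi (t - h) t s) =
   h^-1 * rint I (fun s => a t * chi (t - h) t s - a s * chi (t - h) t s).
  rewrite rintB// rintZ; last exact: intg_chi_cst.
  by rewrite rc; field; rewrite gt_eqF.
rewrite normrM gtr0_norm ?invr_gt0// ler_pdivrMl//.
apply: le_trans (rint_abs (intgB i2 i1)) _.
rewrite -[X in X * _]rc mulrC -rintZ; last exact: intg_chi_cst.
apply: rint_le; first exact: intg_norm (intgB i2 i1).
  by apply: intgZ; exact: intg_chi_cst.
move=> s; rewrite -mulrBl normrM (ger0_norm (chi_ge0 _ _ _)).
rewrite /chi; case: (boolP (_ < _ < _)) => [/andP[s1 s2]|_]; last by rewrite !mulr0.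
rewrite !mulr1; apply: hdel; rewrite /ball_ /=.
by rewrite ltr_norml; apply/andP; split; lra.
Unshelve. all: by end_near. Qed.

(** Fubini moves the average from [p] onto the continuous factor, where it converges pointwise,
    dominated by M |p|. *)
Lemma steklov_continuous a p M : continuous (a : R -> R) ->
  measurable_fun setT a -> (forall x, `|a x| <= M) -> sqi I p ->
  (harmonic n)^-1 * rint I (fun s => a s * win p (harmonic n) s) @[n --> \oo] -->
  rint I (fun t => a t * p t).
Proof.
move=> ca ma aM sp.
have sa : sqi I a by exact: sqi_bnd ma aM.
have ia := sqi_intg sa.
have ipp := sqi_intg sp.
pose A n t := (harmonic n)^-1 * rint I (fun s => a s * chi (t - harmonic n) t s).
have E n : (harmonic n)^-1 * rint I (fun s => a s * win p (harmonic n) s) =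
    rint I (fun t => A n t * p t).
  have ii := intg_wchi (harmonic n) sa sp.
  have [i1 e1] := fubini2 ii.
  rewrite rint_win// e1 -rintZ//; congr rint; apply/funext => t.
  rewrite /A -mulrA; congr (_ * _); rewrite mulrC -rintZ; last exact: intg_chi.
  by congr rint; apply/funext => s; rewrite wchiE /=; ring.
under eq_cvg do rewrite E.
have M0 : 0 <= M by rewrite (le_trans _ (aM 0)).
apply: (@rdct _ _ _ I _ _ (fun t => M * `|p t|) _ _ _ _ _).2.
- move=> n; have ii := intg_wchi (harmonic n) sa sp.
  have [i1 _] := fubini2 ii.
  have := intg_measurable (intgZ (harmonic n)^-1 i1).
  congr measurable_fun; apply/funext => t.
  rewrite /A -mulrA; congr (_ * _); rewrite mulrC -rintZ; last exact: intg_chi.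
  by congr rint; apply/funext => s; rewrite wchiE /=; ring.
- exact: measurable_funM ma (intg_measurable ipp).
- have hT := @interval_aeT _ T (fun t => 0 <= t /\ t < T) (fun t t0 tT => conj t0 tT).
  apply: filterS2 hT (interval_ae_neq T 0) => t [t0 tT] /eqP tn0.
  apply: cvgM; last exact: cvg_cst.
  by apply: average_cvg => //; rewrite lt_neqAle eq_sym tn0.
- by apply: intgZ; exact: intg_norm.
- move=> n; apply: aeW => t; rewrite normrM ler_wpM2r//.
  rewrite /A normrM gtr0_norm ?invr_gt0 ?harmonic_gt0// ler_pdivrMl ?harmonic_gt0//.
  apply: le_trans (rint_abs (intg_chi _ _ ia)) _.
  apply: (@le_trans _ _ (rint I (fun s => M * chi (t - harmonic n) t s))).
    apply: rint_le; first exact: intg_norm (intg_chi _ _ ia).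
      by apply: intgZ; exact: intg_chi_cst.
    by move=> s; rewrite normrM (ger0_norm (chi_ge0 _ _ _)) ler_wpM2r// chi_ge0.
  rewrite rintZ; last exact: intg_chi_cst.
  rewrite mulrC ler_wpM2r//.
  have := @rint_chi_le _ T (t - harmonic n) t; rewrite (_ : t - (t - _) = harmonic n); last by ring.
  by apply; rewrite lerBlDr lerDl harmonic_ge0.
Qed.

(** Approximation of [a] in L^2 by trigonometric polynomials; [schur] makes the error uniform in the
    length of the window. *)
Lemma steklov a p : sqi I a -> sqi I p ->
  (harmonic n)^-1 * rint I (fun s => a s * win p (harmonic n) s) @[n --> \oo] -->
  rint I (fun t => a t * p t).
Proof.
move=> sa sp.
pose e := enum_basis (cas T).
have he : hilbert_basis I e by apply: enum_basisP; exact: cas_basis.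
have ce k : continuous (e k : R -> R).
  rewrite /e /enum_basis; case: pickle_inv => [j|] /= x; last exact: cvg_cst.
  apply: cvgM; first exact: cvg_cst.
  exact: continuous_cos_affine.
have be k : exists M, forall x, `|e k x| <= M by have [/(_ k)[]] := he.
have me k : measurable_fun setT (e k) by have [/(_ k)[]] := he.
have spart J : (harmonic n)^-1 * rint I (fun s => psum e (fun k => ip I a (e k)) J s * win p (harmonic n) s) @[n --> \oo] -->
    rint I (fun t => psum e (fun k => ip I a (e k)) J t * p t).
  have sw n := @sqi_win _ T p (harmonic n) sp.
  have E u : sqi I u -> rint I (fun t => psum e (fun k => ip I a (e k)) J t * u t) =
      \sum_(k < J) ip I a (e k) * rint I (fun t => e k t * u t).
    move=> su; have := ip_suml (mu := I) (index_enum 'I_J) xpredT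
      (F := fun k => fun x => ip I a (e k) * e k x) (h := u).
    rewrite /ip /psum => -> //; last by move=> k; apply: sqiZ; exact: basis_sqi.
    apply: eq_bigr => k _; rewrite -rintZ; last by apply: sqi_intgM => //; exact: basis_sqi.
    by congr rint; apply/funext => x; rewrite mulrA.
  rewrite E//; under eq_cvg do rewrite E// mulr_sumr.
  apply: cvg_bigsum => k; have [M hM] := be k.
  have := @steklov_continuous (e k) p M (ce k) (me k) hM sp.
  move=> h; under eq_cvg do rewrite mulrCA; apply: cvgM => //; exact: cvg_cst.
apply/cvgrPdist_le => eps eps0.
have P0 : 0 <= nrm2 I p by exact: ip_ge0.
(* Makes eta |p|^2 at most eps / 8; with the remainder of [a] below eta eps / 8, both errors of
   approximation are at most eps / 4. *)
pose eta := eps / (8 * (nrm2 I p + 1)).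
have P1 : 0 < nrm2 I p + 1 by lra.
have eta0 : 0 < eta by apply: divr_gt0 => //; apply: mulr_gt0.
have etaP : eta * nrm2 I p <= eps / 8.
  have e1 : eta * (nrm2 I p + 1) = eps / 8 by rewrite /eta; field; rewrite gt_eqF.
  by rewrite -e1 ler_pM2l// lerDl.
have pos : 0 < eta * (eps / 8) by apply: mulr_gt0 => //; exact: divr_gt0.
have /cvgrPdist_le/(_ _ pos)[J _ /(_ J (leqnn J)) /=] := parseval_remainder he sa.
rewrite sub0r normrN ger0_norm ?ip_ge0//.
set aJ := psum _ _ J => rJ.
have saJ : sqi I aJ by exact: psum_sqi.
have sd := sqiB sa saJ.
have /cvgrPdist_le/(_ (eps / 4)) := spart J; rewrite divr_gt0// => /(_ isT).
apply: filterS => n; rewrite -/aJ.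
have hp : 0 < harmonic n :> R by exact: harmonic_gt0.
have bound : eta^-1 * nrm2 I (fun x => a x - aJ x) + eta * nrm2 I p <= eps / 4.
  have : eta^-1 * nrm2 I (fun x => a x - aJ x) <= eps / 8 by rewrite ler_pdivrMl.
  by lra.
have sch : `|(harmonic n)^-1 * rint I (fun s => a s * win p (harmonic n) s) -
   (harmonic n)^-1 * rint I (fun s => aJ s * win p (harmonic n) s)| <= eps / 4.
  rewrite -mulrBr -rintB; [|by apply: sqi_intgM => //; exact: sqi_win..].
  rewrite normrM gtr0_norm ?invr_gt0// ler_pdivrMl//.
  have := schur (T := T) (ltW hp) eta0 sd sp.
  rewrite (_ : (fun s => _) = (fun s => a s * win p (harmonic n) s - aJ s * win p (harmonic n) s)); last first.
    by apply/funext => s; rewrite mulrBl.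
  by move/le_trans; apply; rewrite ler_pM2l.
have lim : `|rint I (fun t => a t * p t) - rint I (fun t => aJ t * p t)| <= eps / 4.
  have := ip_young (mu := I) (f := fun x => a x - aJ x) (g := p) (a := eta^-1).
  rewrite invr_gt0 invrK => /(_ eta0 sd sp); rewrite ipBl// => /le_trans; apply.
  by rewrite [_ * eta]mulrC.
move: sch lim; set x1 := _^-1 * _; set x2 := _^-1 * _; move=> + + h3.
move: (rint _ _) (rint _ _) h3 => y1 y2.
by rewrite !ler_norml => /andP[? ?] /andP[? ?] /andP[? ?]; apply/andP; split; lra.
Qed.

End steklov.

(** * Spectral evolutions *)

Section evolution.
Context (R : realType) (T : R) d (X : measurableType d).
Variable m : {finite_measure set X -> \bar R}.
Variables (e : nat -> X -> R) (lam : nat -> R).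
Hypothesis T0 : 0 < T.
Hypothesis he : hilbert_basis m e.
Hypothesis lam_ge0 : forall k, 0 <= lam k.
Hypothesis lam_infty : forall L, exists n0, forall n, (n0 <= n)%N -> L <= lam n.
Local Notation I := (interval_measure T).
Local Notation Q := (finite_prod I m).
Local Notation mode := (mode m e).
Local Notation prim := (prim T).
Local Notation win := (win T).
Implicit Types (w f g mu : measurableTypeR R * X -> R).

(* The k-th mode of d_t w - Laplacian g = - f, w(0) = u0, integrated in time. *)
Definition evolves (u0 : X -> R) w g f := forall k, \forall x \ae I, mode w k x =
  ip m u0 (e k) - lam k * prim (mode g k) 0 x - prim (mode f k) 0 x.

(** Signs and bounds hold everywhere, for suitable representatives. The upper bound on [mu],
    possibly different for each solution, puts mu w in L^2; quantitative estimates are in terms of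
    the integral of [mu]. *)
Record weak_evolution (u0 : X -> R) w mu f : Prop := WeakEvolution {
  we_u0 : sqi m u0;
  we_w : sqi Q w;
  we_f : sqi Q f;
  we_w0 : forall p, 0 <= w p;
  we_f0 : forall p, 0 <= f p;
  we_mmu : measurable_fun setT mu;
  we_mu0 : forall p, 0 <= mu p;
  we_mub : exists B, forall p, mu p <= B;
  we_eq : evolves u0 w (fun p => mu p * w p) f }.

Lemma we_g u0 w mu f : weak_evolution u0 w mu f -> sqi Q (fun p => mu p * w p).
Proof.
case=> _ sw _ w0 _ mmu mu0 [B hB] _.
have := sqiM sw mmu (M := B); rewrite (_ : (fun x => w x * mu x) = (fun p => mu p * w p)).
  by apply => p; rewrite ger0_norm.
by apply/funext => p; rewrite mulrC.
Qed.

Lemma cvg_pairing u0 g s t : sqi m u0 -> sqi Q g ->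
  \sum_(k < n) ip m u0 (e k) * prim (mode g k) s t @[n --> \oo] -->
  rint Q (fun p => u0 p.2 * g p * chi s t p.1).
Proof.
move=> su0 sg.
have h := parseval_time he (sqi_snd I su0) sg (measurable_chi1 s t) (chi_bnd s t).
have E n : \sum_(k < n) ip m u0 (e k) * prim (mode g k) s t =
    \sum_(k < n) rint I (fun x => mode (fun p => u0 p.2) k x * mode g k x * chi s t x).
  apply: eq_bigr => k _; rewrite -rintZ; last first.
    by apply: intg_chi; apply: sqi_intg; exact: sqi_mode.
  by congr rint; apply/funext => x; rewrite mulrA.
by under eq_cvg do rewrite E.
Qed.

(** Beyond [K], Young's inequality gives a V <= del a^2 + V^2 / del and V^2 <= lam V^2 / L; Bessel's
    inequality sums the first part, the hypothesis on [C] the second. *)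
Lemma pairing_tail u0 g s t C K L del : sqi m u0 -> sqi Q g ->
  (forall n, \sum_(k < n) lam k * prim (mode g k) s t ^+ 2 <= C) ->
  0 < L -> 0 < del -> (forall k, (K <= k)%N -> L <= lam k) ->
  rint Q (fun p => u0 p.2 * g p * chi s t p.1) <=
  \sum_(k < K) ip m u0 (e k) * prim (mode g k) s t + del * nrm2 m u0 + C / (del * L).
Proof.
move=> su0 sg YC L0 d0 KL.
have c := cvg_pairing (s := s) (t := t) su0 sg.
rewrite -(cvg_lim (@Rhausdorff R) c).
apply: limr_le; first by apply/cvg_ex; eexists; exact: c.
near=> n.
have Kn : (K <= n)%N by near: n; exact: nbhs_infty_ge.
pose a k := ip m u0 (e k); pose V k := prim (mode g k) s t.
apply: (@le_trans _ _ (\sum_(k < n) ((if (k < K)%N then a k * V k else 0) +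
   del * a k ^+ 2 + (del * L)^-1 * (lam k * V k ^+ 2)))).
  apply: ler_sum => k _; rewrite -/(a k) -/(V k).
  have h1 : 0 <= del * a k ^+ 2 by rewrite mulr_ge0 ?sqr_ge0// ltW.
  have h2 : 0 <= (del * L)^-1 * (lam k * V k ^+ 2).
    apply: mulr_ge0; first by rewrite invr_ge0 mulr_ge0// ltW.
    by rewrite mulr_ge0// sqr_ge0.
  case: ltnP => kK; first by lra.
  have h3 : del^-1 * V k ^+ 2 <= (del * L)^-1 * (lam k * V k ^+ 2).
    rewrite invfM -mulrA ler_pM2l ?invr_gt0// ler_pdivlMl//.
    by rewrite ler_wpM2r ?sqr_ge0 ?KL.
  have h4 : a k * V k <= del * a k ^+ 2 + del^-1 * V k ^+ 2.
    rewrite -(ler_pM2l d0) mulrDr [del * (del^-1 * _)]mulrA mulfV ?gt_eqF// mul1r.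
    move: (a k) (V k) => x y; have := sqr_ge0 (del * x - y); have := sqr_ge0 (del * x).
    by have := sqr_ge0 y; nra.
  by lra.
rewrite !big_split /= -!mulr_sumr -!addrA; apply: lerD.
  rewrite -big_mkcond /= -(big_ord_widen _ (fun k => a k * V k) Kn).
  exact: lexx.
apply: lerD.
  by rewrite ler_pM2l//; exact: bessel.
rewrite mulrC; apply: ler_wpM2r; last exact: YC.
by rewrite invr_ge0 mulr_ge0// ltW.
Unshelve. all: by end_near. Qed.

(** By positivity only the L^1 norm of [g] enters, and this is the norm that will be bounded
    uniformly. *)
Lemma prim_mode_bnd g k M s t : sqi Q g -> (forall p, 0 <= g p) ->
  0 <= M -> (forall x, `|e k x| <= M) -> `|prim (mode g k) s t| <= M * rint Q g.
Proof.
move=> sg g0 M0 hM; rewrite (prim_mode he)//.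
have mm : measurable_fun setT (fun p : measurableTypeR R * X => chi s t p.1 * e k p.2).
  apply: measurable_funM; first exact: (measurableT_comp (measurable_chi1 s t)).
  by apply: measurableT_comp => //; exact: measurable_basis he _.
have bb (p : measurableTypeR R * X) : `|chi s t p.1 * e k p.2| <= M.
  by rewrite normrM -[M]mul1r ler_pM// chi_bnd.
have ig := intgM (sqi_intg sg) mm bb.
apply: le_trans (rint_abs ig) _; rewrite -rintZ; last exact: sqi_intg.
apply: rint_le; [exact: intg_norm|by apply: intgZ; exact: sqi_intg|].
by move=> p; rewrite normrM mulrC (ger0_norm (g0 p)) ler_wpM2r.
Qed.

(** Finitely many modes, among them all those with eigenvalue below 1, are bounded through the
    integral G of g; the others are absorbed by the sum of the lam_k (int g_k)^2. Then G is bounded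
    by a small multiple of the energy, as mu w <= al mu w^2 + mu / al. *)
Lemma apriori C0 A : 0 <= C0 -> 0 <= A -> exists2 C, 0 <= C & forall u0 w mu f,
  weak_evolution u0 w mu f -> nrm2 m u0 <= C0 -> rint Q mu <= A ->
  [/\ rint Q (fun p => w p * (mu p * w p)) <= C,
      rint Q (fun p => mu p * w p) <= C &
      forall t n, \sum_(k < n) lam k *
        prim (mode (fun p => mu p * w p) k) 0 t ^+ 2 <= C].
Proof.
move=> C00 A0; have [K0 hK0] := lam_infty 1.
have /choice [E hE] k : exists M, 0 <= M /\ forall x, `|e k x| <= M.
  by have [M M0 hM] := basis_bnd he k; exists M.
pose D := \sum_(k < K0) (C0 + 1) * E k.
have D0 : 0 <= D.
  by apply: sumr_ge0 => k _; rewrite mulr_ge0//; [lra|case: (hE k)].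
(* [C1] will bound the energy and [C2] the integral of g. The factor 2 D + 1 is 1 / al, with al
   small enough that 2 D al times the energy is at most the energy. *)
pose C1 := 2 * D * (A * (2 * D + 1)) + 2 * C0.
pose C2 := C1 + A * (2 * D + 1).
have AD : 0 <= A * (2 * D + 1) by rewrite mulr_ge0//; lra.
have C10 : 0 <= C1 by rewrite /C1; have := mulr_ge0 D0 AD; lra.
have C20 : 0 <= C2 by rewrite /C2; lra.
have DC2 : 0 <= D * C2 by exact: mulr_ge0.
exists (C1 + C2 + 4 * (D * C2) + 4 * C0); first lra.
move=> u0 w mu f W uC muA; have sg := we_g W.
case: W => su0 sw sf w0 f0 mmu mu0 [B muB] hev.
set g := fun p => mu p * w p in sg hev *.
have g0 p : 0 <= g p by rewrite mulr_ge0.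
set G := rint Q g; have G0 : 0 <= G by exact: rint_ge0.
have iwg := sqi_intgM sw sg.
pose Xt t := rint Q (fun p => w p * g p * chi 0 t p.1).
pose Y t n := \sum_(k < n) lam k * prim (mode g k) 0 t ^+ 2.
have Xt0 t : 0 <= Xt t.
  by apply: rint_ge0 => p; rewrite mulr_ge0 ?chi_ge0// mulr_ge0.
pose Rt t := rint Q (fun p => u0 p.2 * g p * chi 0 t p.1).
have en t n : Xt t + 2^-1 * Y t n <= Rt t.
  apply: (energy_inequality he lam_ge0) su0 sw sg sf g0 f0 _ => k.
  have FF : Filter (almost_everywhere I) by exact: ae_filter_ringOfSetsType.
  by apply: filterS (hev k).
have uk k : `|ip m u0 (e k)| <= C0 + 1.
  have h : ip m u0 (e k) ^+ 2 <= C0.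
    apply: le_trans uC; apply: le_trans (bessel he k.+1 su0).
    by rewrite big_ord_recr /= lerDr sumr_ge0// => i _; exact: sqr_ge0.
  by apply: sqr_le_norm; [lra|nra].
have Rb t : Rt t <= 2 * (D * G) + 2 * C0 - Xt t.
  (* By [en], a quarter of Y is at most half of Rt - Xt, so what the high modes cost is absorbed in
     the left-hand side. *)
  suff : Rt t <= D * G + C0 + 2^-1 * (Rt t - Xt t) by lra.
  have c := cvg_pairing (s := 0) (t := t) su0 sg.
  rewrite {1}/Rt -(cvg_lim (@Rhausdorff R) c).
  apply: limr_le; first by apply/cvg_ex; eexists; exact: c.
  near=> n.
  have Kn : (K0 <= n)%N by near: n; exact: nbhs_infty_ge.
  have Yn : 4^-1 * Y t n <= 2^-1 * (Rt t - Xt t) by have := en t n; lra.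
  apply: le_trans (_ : D * G + C0 + 4^-1 * Y t n <= _); last by lra.
  pose a k := ip m u0 (e k); pose V k := prim (mode g k) 0 t.
  apply: (@le_trans _ _ (\sum_(k < n) ((if (k < K0)%N then (C0 + 1) * E k * G else 0) +
     a k ^+ 2 + 4^-1 * (lam k * V k ^+ 2)))).
    apply: ler_sum => k _; rewrite -/(a k) -/(V k).
    have h1 : 0 <= a k ^+ 2 by exact: sqr_ge0.
    have h2 : 0 <= 4^-1 * (lam k * V k ^+ 2).
      by rewrite mulr_ge0// mulr_ge0// sqr_ge0.
    case: ltnP => kK.
      suff : a k * V k <= (C0 + 1) * E k * G by lra.
      apply: le_trans (ler_norm _) _; rewrite normrM -mulrA; apply: ler_pM => //.
        exact: uk.
      by have [? ?] := hE k; exact: prim_mode_bnd.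
    have h3 : 4^-1 * V k ^+ 2 <= 4^-1 * (lam k * V k ^+ 2).
      by rewrite ler_pM2l// ler_peMl ?sqr_ge0 ?hK0.
    by move: h1 h2 h3; move: (a k) (V k) (lam k) => x y l; have := sqr_ge0 (x - 2^-1 * y); nra.
  rewrite !big_split /= -mulr_sumr; apply: lerD; last exact: lexx.
  apply: lerD; last by apply: le_trans uC; exact: bessel.
  rewrite -big_mkcond /= -(big_ord_widen _ (fun k => (C0 + 1) * E k * G) Kn).
  by rewrite -mulr_suml.
have fin t n : 2 * Xt t + 2^-1 * Y t n <= 2 * (D * G) + 2 * C0.
  by have := en t n; have := Rb t; lra.
pose XX := rint Q (fun p => w p * g p).
have XT : XX = Xt T.
  apply: rint_ae; first exact: intg_measurable iwg.
    apply: measurable_funM; first exact: intg_measurable iwg.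
    exact: (measurableT_comp (measurable_chi1 0 T)).
  have hT := @interval_aeT _ T (fun t => 0 <= t /\ t < T) (fun t t0 tT => conj t0 tT).
  have h2 : \forall t \ae I, chi 0 T t = 1.
    apply: filterS2 hT (interval_ae_neq T 0) => t [t0 tT] /eqP tn0.
    by rewrite /chi tT lt_neqAle eq_sym tn0 t0.
  by apply: filterS (ae_fst m h2) => p ->; rewrite mulr1.
have XX0 : 0 <= XX by rewrite XT.
have Y0 t n : 0 <= Y t n.
  by apply: sumr_ge0 => k _; rewrite mulr_ge0// sqr_ge0.
pose al := (2 * D + 1)^-1.
have D1 : 0 < 2 * D + 1 by lra.
have al0 : 0 < al by rewrite invr_gt0.
have imu : intg Q mu.
  by apply: (@intg_bnd _ _ _ _ _ B) => // p; rewrite ger0_norm.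
have Gle : G <= al * XX + A * (2 * D + 1).
  apply: (@le_trans _ _ (rint Q (fun p => al * (w p * g p) + al^-1 * mu p))).
    apply: rint_le; [exact: sqi_intg|by apply: intgD; exact: intgZ|].
    move=> p; rewrite /g; have := mu0 p; have := w0 p.
    move: (mu p) (w p) => a b b0 a0.
    rewrite -(ler_pM2l al0) mulrDr [al * (al^-1 * _)]mulrA mulfV ?gt_eqF// mul1r.
    suff : 0 <= a * (al * b * (al * b) - al * b + 1) by lra.
    by rewrite mulr_ge0//; have := sqr_ge0 (al * b - 2^-1); nra.
  rewrite rintD; [|exact: intgZ..]; rewrite !rintZ// lerD2l /al invrK mulrC.
  by rewrite ler_wpM2r// ltW.
have DalX : 2 * D * (al * XX) <= XX.
  rewrite mulrA ler_piMl// /al ler_pdivrMr//; lra.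
have XC1 : XX <= C1.
  have h1 : 2 * XX <= 2 * (D * G) + 2 * C0.
    by have := fin T 0%N; rewrite -XT /Y big_ord0 mulr0 addr0.
  have h2 : D * G <= D * (al * XX + A * (2 * D + 1)) by rewrite ler_wpM2l.
  by rewrite /C1; lra.
have al1 : al <= 1 by rewrite invf_le1//; lra.
have GC2 : G <= C2.
  apply: le_trans Gle _; rewrite /C2 lerD2r; apply: le_trans XC1.
  by rewrite ler_piMl.
split; [rewrite -/XX; lra|rewrite -/G; lra|].
move=> t n; rewrite -/(Y t n).
have h1 := fin t n; have h2 := Xt0 t.
have h3 : D * G <= D * C2 by rewrite ler_wpM2l.
by lra.
Unshelve. all: by end_near. Qed.

End evolution.

(** * The energy inequality on windows *)

Section energy_windows.
Context (R : realType) (T : R) d (X : measurableType d).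
Variable m : {finite_measure set X -> \bar R}.
Variables (e : nat -> X -> R) (lam : nat -> R).
Hypothesis T0 : 0 < T.
Hypothesis he : hilbert_basis m e.
Hypothesis lam_ge0 : forall k, 0 <= lam k.
Local Notation I := (interval_measure T).
Local Notation Q := (finite_prod I m).
Local Notation mode := (mode m e).
Local Notation prim := (prim T).
Local Notation win := (win T).
Local Notation evolution := (@weak_evolution R T d X m e lam).

Variables (u0 : X -> R) (w mu f : measurableTypeR R * X -> R).
Hypothesis W : evolution u0 w mu f.
Local Notation g := (fun p => mu p * w p).

Let sg : sqi Q g := we_g W.
Let g0 p : 0 <= g p. Proof. by case: W => *; rewrite mulr_ge0. Qed.

(** Almost every s satisfies the equations of all modes at once, by countability; subtracting them
    from the equations at x restarts the evolution with datum w(s, .). *)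
Lemma evolves_from : \forall s \ae I, (0 <= s /\ s < T) /\ forall k, \forall x \ae I,
  s < x -> mode w k x = mode w k s - lam k * prim (mode g k) s x - prim (mode f k) s x.
Proof.
case: W => su0 sw sf w0 f0 mmu mu0 muB hev.
have FF : Filter (almost_everywhere I) by exact: ae_filter_ringOfSetsType.
have hT := @interval_aeT _ T (fun t => 0 <= t /\ t < T) (fun t t0 tT => conj t0 tT).
have hall := ae_forall_countable hev.
apply: filterS2 hT hall => s [s0 sT] hs; split=> // k.
apply: filterS (hev k) => x hx sx.
rewrite hx (hs k) -(prim_sub _ s0 sx); last exact: sqi_intg (sqi_mode he k sg).
rewrite -(prim_sub _ s0 sx); last exact: sqi_intg (sqi_mode he k sf).
move: (ip m u0 (e k)) (prim (mode g k) 0 x) (prim (mode g k) 0 s).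
by move: (prim (mode f k) 0 x) (prim (mode f k) 0 s) (lam k) => *; ring.
Qed.

Variable C : R.
Hypothesis YC : forall t n, \sum_(k < n) lam k * prim (mode g k) 0 t ^+ 2 <= C.

(** Covers the times t < h, to which an average over windows does not give full weight. *)
Lemma energy_layer h K L del : 0 < L -> 0 < del ->
  (forall k, (K <= k)%N -> L <= lam k) ->
  rint Q (fun p => w p * g p * chi 0 h p.1) <=
  \sum_(k < K) ip m u0 (e k) * prim (mode g k) 0 h + del * nrm2 m u0 + C / (del * L).
Proof.
move=> L0 d0 KL; case: W => su0 sw sf w0 f0 mmu mu0 muB hev.
apply: le_trans (pairing_tail he lam_ge0 su0 sg (YC h) L0 d0 KL).
have FF : Filter (almost_everywhere I) by exact: ae_filter_ringOfSetsType.
have := energy_inequality (s := 0) he lam_ge0 h 0%N su0 sw sg sf g0 f0.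
rewrite big_ord0 mulr0 addr0; apply=> k.
by apply: filterS (hev k).
Qed.

(** The primitive from s is a difference of two primitives from 0, and (x - y)^2 <= 2 x^2 + 2
    y^2. *)
Lemma window_bound s t n : 0 <= s -> s < t ->
  \sum_(k < n) lam k * prim (mode g k) s t ^+ 2 <= 4 * C.
Proof.
move=> s0 st.
apply: (@le_trans _ _ (\sum_(k < n) (2 * (lam k * prim (mode g k) 0 t ^+ 2) +
   2 * (lam k * prim (mode g k) 0 s ^+ 2)))).
  apply: ler_sum => k _; rewrite -(prim_sub _ s0 st); last exact: sqi_intg (sqi_mode he k sg).
  have := lam_ge0 k; move: (lam k) (prim _ 0 t) (prim _ 0 s) => l x y l0.
  have : 0 <= l * (x + y) ^+ 2 by rewrite mulr_ge0// sqr_ge0.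
  by nra.
rewrite big_split /= -!mulr_sumr.
by have := YC t n; have := YC s n; lra.
Qed.

Lemma energy_window h K L del : 0 < h -> 0 < L -> 0 < del ->
  (forall k, (K <= k)%N -> L <= lam k) ->
  \forall s \ae I, rint Q (fun p => w p * g p * chi s (s + h) p.1) <=
  \sum_(k < K) mode w k s * win (mode g k) h s +
    del * rint m (fun x => w (s, x) ^+ 2) + 4 * C / (del * L).
Proof.
move=> h0 L0 d0 KL; case: W => su0 sw sf w0 f0 mmu mu0 muB hev.
have FF : Filter (almost_everywhere I) by exact: ae_filter_ringOfSetsType.
apply: filterS2 evolves_from (ae_sqi1 sw) => s [[s0 sT] hs] sws.
have sh : s < s + h by rewrite ltrDl.
rewrite -ip_sqr.
apply: le_trans (pairing_tail he lam_ge0 sws sg (fun n => window_bound n s0 sh) L0 d0 KL).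
have := energy_inequality (s := s) he lam_ge0 (s + h) 0%N sws sw sg sf g0 f0.
by rewrite big_ord0 mulr0 addr0; apply.
Qed.

(** Integrate [energy_window] in s. By Fubini, a time t receives as weight the length of the set of
    s in [0, T[ with s < t < s + h, which equals h when t >= h. *)
Lemma energy_average h K L del : 0 < h -> 0 < L -> 0 < del ->
  (forall k, (K <= k)%N -> L <= lam k) ->
  h * rint Q (fun p => w p * g p * (h <= p.1)%R%:R) <=
  \sum_(k < K) rint I (fun s => mode w k s * win (mode g k) h s) +
    del * nrm2 Q w + 4 * C / (del * L) * T.
Proof.
move=> h0 L0 d0 KL; case: (W) => su0 sw sf w0 f0 mmu mu0 muB hev.
have iwg := sqi_intgM sw sg.
pose F (z : measurableTypeR R * (measurableTypeR R * X)) : R :=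
  w z.2 * g z.2 * chi z.1 (z.1 + h) z.2.1.
have mF : measurable_fun setT (fun z : measurableTypeR R * (measurableTypeR R * X) =>
    chi z.1 (z.1 + h) z.2.1).
  apply: (@measurable_chi _ _ _ fst (fun z => z.1 + h) (fun z => z.2.1)) => //.
    exact: measurable_funD.
  exact: measurableT_comp.
have iF : intg (finite_prod I Q) F.
  apply: (@intgM _ _ _ _ _ _ 1) => //; first exact: (intg_snd I iwg).
  by move=> z; exact: chi_bnd.
have [i1 e1] := fubini1 iF; have [i2 e2] := fubini2 iF.
apply: (@le_trans _ _ (rint (finite_prod I Q) F)).
  rewrite e2 -rintZ; last first.
    apply: (@intgM _ _ _ _ _ _ 1) => //.
      apply: (measurableT_comp (f := fun b : bool => b%:R : R)) => //.
      by apply: measurable_fun_ler.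
    by move=> p; case: (h <= p.1); rewrite ?normr1 ?normr0.
  apply: rint_le_ae => //.
    apply: intgZ; apply: (@intgM _ _ _ _ _ _ 1) => //.
      apply: (measurableT_comp (f := fun b : bool => b%:R : R)) => //.
      by apply: measurable_fun_ler.
    by move=> p; case: (h <= p.1); rewrite ?normr1 ?normr0.
  have hT := @interval_aeT _ T (fun t => 0 <= t /\ t < T) (fun t t0 tT => conj t0 tT).
  apply: filterS (ae_fst m hT) => p [p0 pT].
  have wg0 : 0 <= w p * g p by exact: mulr_ge0.
  rewrite /F /=.
  have -> : (fun x => w p * g p * chi x (x + h) p.1) =
    (fun x => w p * g p * chi (p.1 - h) p.1 x).
    by apply/funext => x; rewrite -(wchiE h x p.1).
  rewrite rintZ; last exact: intg_chi_cst.
  rewrite mulrCA; apply: ler_wpM2l => //.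
  (* Before time h it is enough that the weight is nonnegative. *)
  case: (leP h p.1) => hp; last by rewrite (_ : false%:R = 0 :> R)// mulr0; apply: rint_ge0 => x; exact: chi_ge0.
  rewrite (_ : true%:R = 1 :> R)// mulr1 rint_chi; [|lra..].
  by have -> : p.1 - (p.1 - h) = h by ring.
rewrite e1.
have sgk k := sqi_mode he k sg; have swk k := sqi_mode he k sw.
have ik k : intg I (fun s => mode w k s * win (mode g k) h s).
  by apply: sqi_intgM => //; exact: sqi_win.
have [_ w2] := sw; have [iw2 ew2] := fubini1 w2.
have iT : intg I (fun=> 4 * C / (del * L)).
  by apply: (@intg_bnd _ _ _ _ _ `|4 * C / (del * L)|).
have -> : \sum_(k < K) rint I (fun s => mode w k s * win (mode g k) h s) +
    del * nrm2 Q w + 4 * C / (del * L) * T =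
  rint I (fun s => \sum_(k < K) mode w k s * win (mode g k) h s +
    del * rint m (fun x => w (s, x) ^+ 2) + 4 * C / (del * L)).
  have i12 := intgD (intg_sum (index_enum 'I_K) xpredT (fun k => ik k)) (intgZ del iw2).
  rewrite rintD// rintD//; last 2 first.
    exact: (intg_sum (index_enum 'I_K) xpredT (fun k => ik k)).
    exact: intgZ.
  rewrite rint_interval_cst// rint_sum// rintZ// /nrm2 ip_sqr ew2.
  by [].
apply: rint_le_ae => //.
- apply: intgD => //; apply: (intgD _ (intgZ del iw2)).
  exact: (intg_sum (index_enum 'I_K) xpredT (fun k => ik k)).
- exact: energy_window.
Qed.

End energy_windows.

(** * Strong compactness *)

Lemma sqr_le_norm1 (R : realFieldType) (a b : R) : a ^+ 2 <= b -> `|a| <= b + 1.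
Proof. by move=> ab; rewrite ler_norml; apply/andP; split; nra. Qed.

(** From |sqrt a - sqrt b| <= sqrt a + sqrt b. It turns L^1 convergence of the coefficients into L^2
    convergence of their square roots. *)
Lemma sqr_sqrt_sub (R : rcfType) (a b : R) : 0 <= a -> 0 <= b ->
  (Num.sqrt a - Num.sqrt b) ^+ 2 <= `|a - b|.
Proof.
move=> a0 b0; rewrite -{2}(sqr_sqrtr a0) -{2}(sqr_sqrtr b0).
move: (sqrtr_ge0 a) (sqrtr_ge0 b); move: (Num.sqrt a) (Num.sqrt b) => x y x0 y0.
rewrite subr_sqr normrM (ger0_norm (addr_ge0 x0 y0)).
rewrite -(real_normK (num_real (x - y))) expr2 ler_wpM2l//.
by rewrite ler_norml; apply/andP; split; lra.
Qed.

Lemma sqrt_ratio_bnd (R : rcfType) (a b c B : R) : 0 < c -> c <= a -> 0 <= b -> b <= B ->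
  (Num.sqrt a - Num.sqrt b) ^+ 2 / a <= 1 + B / c.
Proof.
move=> c0 ca b0 bB; have a0 : 0 < a by exact: lt_le_trans ca.
rewrite ler_pdivrMr//.
have := sqr_sqrtr (ltW a0); have := sqr_sqrtr b0.
move: (sqrtr_ge0 a) (sqrtr_ge0 b); move: (Num.sqrt a) (Num.sqrt b) => x y x0 y0 yb xa.
have h : B <= B / c * a.
  by rewrite mulrAC ler_pdivlMr// ler_wpM2l// (le_trans b0).
by rewrite mulrDl mul1r; have := mulr_ge0 x0 y0; nra.
Qed.

Section compactness.
Context (R : realType) (T : R) d (X : measurableType d).
Variable m : {finite_measure set X -> \bar R}.
Variables (e : nat -> X -> R) (lam : nat -> R).
Hypothesis T0 : 0 < T.
Hypothesis he : hilbert_basis m e.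
Hypothesis lam_ge0 : forall k, 0 <= lam k.
Hypothesis lam_infty : forall L, exists n0, forall n, (n0 <= n)%N -> L <= lam n.
Local Notation I := (interval_measure T).
Local Notation Q := (finite_prod I m).
Variable bQ : nat -> measurableTypeR R * X -> R.
Hypothesis hbQ : hilbert_basis Q bQ.
Local Notation mode := (mode m e).
Local Notation prim := (prim T).
Local Notation win := (win T).

Variables (u0 : nat -> X -> R) (w mu f : nat -> measurableTypeR R * X -> R).
Variables (mul wl : measurableTypeR R * X -> R) (c B C0 : R).
Hypothesis c0 : 0 < c.
Hypothesis muc : forall n p, c <= mu n p.
Hypothesis mulc : forall p, c <= mul p.
Hypothesis mulB : forall p, mul p <= B.
Hypothesis mmul : measurable_fun setT mul.
Hypothesis W : forall n, weak_evolution T m e lam (u0 n) (w n) (mu n) (f n).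
Hypothesis u0C : forall n, nrm2 m (u0 n) <= C0.
Hypothesis mu_cvg : rint Q (fun p => `|mu n p - mul p|) @[n --> \oo] --> 0.
Hypothesis swl : sqi Q wl.
Hypothesis w_weak : forall v, sqi Q v -> ip Q (w n) v @[n --> \oo] --> ip Q wl v.

Let sw n : sqi Q (w n). Proof. by case: (W n). Qed.
Let mmu n : measurable_fun setT (mu n). Proof. by case: (W n). Qed.
Let mu0 n p : 0 <= mu n p. Proof. exact: le_trans (ltW c0) (muc n p). Qed.
Let mul0 p : 0 <= mul p. Proof. exact: le_trans (ltW c0) (mulc p). Qed.
Let imu n : intg Q (mu n).
Proof.
have [Bn hB] := we_mub (W n).
by apply: (@intg_bnd _ _ _ _ _ Bn) => // p; rewrite ger0_norm.
Qed.
Let imul : intg Q mul.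
Proof. by apply: (@intg_bnd _ _ _ _ _ B) => // p; rewrite ger0_norm. Qed.
Let idmu n : intg Q (fun p => `|mu n p - mul p|).
Proof. by apply: intg_norm; exact: intgB. Qed.

Let g n p := mu n p * w n p.
Let gl p := mul p * wl p.
(** Its squared norm is the energy; it is bounded in L^2 uniformly, whereas [g n] is so in L^1. *)
Let y n p := Num.sqrt (mu n p) * w n p.
Let yl p := Num.sqrt (mul p) * wl p.
Let r n p := Num.sqrt (mu n p) - Num.sqrt (mul p).

Let sg n : sqi Q (g n). Proof. exact: we_g (W n). Qed.

Let msqrt (h : measurableTypeR R * X -> R) : measurable_fun setT h ->
  measurable_fun setT (fun p => Num.sqrt (h p)).
Proof.
move=> mh; apply: measurableT_comp => //.
by apply: continuous_measurable_fun; exact: sqrt_continuous.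
Qed.

Let sqrt_bnd (a b : R) : 0 <= a -> a <= b -> `|Num.sqrt a| <= 1 + b.
Proof.
move=> a0 ab; rewrite ger0_norm ?sqrtr_ge0//.
have := sqr_sqrtr a0; have := sqrtr_ge0 a; move: (Num.sqrt a) => x x0 xa.
by have := sqr_ge0 (x - 1); nra.
Qed.

Let sy n : sqi Q (y n).
Proof.
have [Bn hB] := we_mub (W n).
rewrite (_ : y n = (fun p => w n p * Num.sqrt (mu n p))); last first.
  by apply/funext => p; rewrite mulrC.
by apply: (sqiM (sw n) (msqrt (mmu n))) (fun p => sqrt_bnd (mu0 n p) (hB p)).
Qed.

Let syl : sqi Q yl.
Proof.
rewrite (_ : yl = (fun p => wl p * Num.sqrt (mul p))); last first.
  by apply/funext => p; rewrite mulrC.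
by apply: (sqiM swl (msqrt mmul)) (fun p => sqrt_bnd (mul0 p) (mulB p)).
Qed.

Let sgl : sqi Q gl.
Proof.
rewrite (_ : gl = (fun p => wl p * mul p)); last first.
  by apply/funext => p; rewrite mulrC.
by apply: (sqiM swl mmul (M := B)) => p; rewrite ger0_norm.
Qed.

Let mr n : measurable_fun setT (r n).
Proof. by apply: measurable_funB; exact: msqrt. Qed.

Let sr n : sqi Q (r n).
Proof.
split; first exact: mr.
apply: intg_dom (idmu n) _; first by apply: measurable_funX; exact: mr.
by move=> p; rewrite ger0_norm ?sqr_ge0// sqr_sqrt_sub.
Qed.

Lemma nrm2_r_cvg : nrm2 Q (r n) @[n --> \oo] --> 0.
Proof.
apply: (@squeeze_cvgr _ _ _ _ (fun=> 0) (fun n => rint Q (fun p => `|mu n p - mul p|))).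
- near=> n; rewrite ip_ge0 /=; rewrite /nrm2 ip_sqr; apply: rint_le => //.
    by case: (sr n).
  by move=> p; exact: sqr_sqrt_sub.
- exact: cvg_cst.
- exact: mu_cvg.
Unshelve. all: by end_near. Qed.

(** The convergence of [mu n] bounds its integral, as [apriori] requires; the bound on [w n] then
    follows from w^2 <= c^-1 mu w^2. *)
Lemma uniform_bounds : exists2 C, 0 <= C & forall n,
  [/\ nrm2 Q (y n) <= C, nrm2 Q (w n) <= C, rint Q (g n) <= C &
   forall t k, \sum_(i < k) lam i * prim (mode (g n) i) 0 t ^+ 2 <= C].
Proof.
have C00 : 0 <= C0 by apply: le_trans (u0C 0%N); exact: ip_ge0.
have [M hM] : exists M, forall n, rint Q (fun p => `|mu n p - mul p|) <= M.
  have /cvg_seq_bounded[M [_ /(_ (M + 1))]] := cvgP _ mu_cvg.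
  rewrite ltrDl ltr01 => /(_ isT) hM; exists (M + 1) => n.
  by apply: le_trans (hM n Logic.I); exact: ler_norm.
have A0 : 0 <= `|M| + rint Q mul by rewrite addr_ge0// rint_ge0.
have [C Cge0 hC] := apriori T he lam_ge0 lam_infty C00 A0.
have c1 : 0 <= c^-1 by rewrite invr_ge0 ltW.
exists (C + c^-1 * C); first by rewrite addr_ge0// mulr_ge0.
move=> n; have [|h1 h2 h3] := hC _ _ _ _ (W n) (u0C n).
  apply: (@le_trans _ _ (rint Q (fun p => `|mu n p - mul p| + mul p))).
    apply: rint_le => //; first exact: intgD.
    by move=> p; rewrite -lerBlDr ler_norm.
  by rewrite rintD// lerD2r (le_trans (hM n))// ler_norm.
have cC : 0 <= c^-1 * C by rewrite mulr_ge0.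
have E : nrm2 Q (y n) = rint Q (fun p => w n p * (mu n p * w n p)).
  congr rint; apply/funext => p; rewrite /y.
  by rewrite mulrACA -expr2 sqr_sqrtr//; ring.
split.
- by rewrite E (le_trans h1)// lerDl.
- apply: (@le_trans _ _ (c^-1 * C)); last by rewrite lerDr.
  apply: (@le_trans _ _ (c^-1 * rint Q (fun p => w n p * (mu n p * w n p)))).
    have iwg : intg Q (fun p => w n p * (mu n p * w n p)) := sqi_intgM (sw n) (sg n).
    rewrite /nrm2 ip_sqr -[leRHS](rintZ _ iwg); apply: rint_le; first by case: (sw n).
      exact: intgZ.
    move=> p; rewrite ler_pdivlMl//.
    have := sqr_ge0 (w n p); have := muc n p; move: (mu n p) (w n p) => a b ca b2.
    have : 0 <= (a - c) * b ^+ 2 by rewrite mulr_ge0// subr_ge0.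
    by nra.
  by rewrite ler_wpM2l.
- by apply: le_trans h2 _; rewrite lerDl.
- by move=> t k; apply: le_trans (h3 t k) _; rewrite lerDl.
Qed.

Lemma ip_vanish (a b : nat -> measurableTypeR R * X -> R) C :
  (forall n, sqi Q (a n)) -> (forall n, sqi Q (b n)) ->
  (forall n, nrm2 Q (a n) <= C) -> nrm2 Q (b n) @[n --> \oo] --> 0 ->
  ip Q (a n) (b n) @[n --> \oo] --> 0.
Proof.
move=> sa sb aC b0; apply: cvg_sqr0.
apply: (@squeeze_cvgr _ _ _ _ (fun=> 0) (fun n => C * nrm2 Q (b n))).
- near=> n; rewrite sqr_ge0/=; apply: le_trans (cauchy_schwarz (sa n) (sb n)) _.
  by rewrite ler_wpM2r ?ip_ge0//; exact: aC.
- exact: cvg_cst.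
- by rewrite -[X in _ --> X](mulr0 C); apply: cvgM => //; exact: cvg_cst.
Unshelve. all: by end_near. Qed.

Let nrm2_rM (phi : measurableTypeR R * X -> R) (M : R) :
  measurable_fun setT phi -> (forall p, `|phi p| <= M) ->
  nrm2 Q (fun p => r n p * phi p) @[n --> \oo] --> 0.
Proof.
move=> mphi hM.
apply: (@squeeze_cvgr _ _ _ _ (fun=> 0) (fun n => M ^+ 2 * nrm2 Q (r n))).
- near=> n; rewrite ip_ge0/= /nrm2 !ip_sqr.
  have srp := sqiM (sr n) mphi hM.
  rewrite -rintZ; last by case: (sr n).
  apply: rint_le; [by case: srp|by apply: intgZ; case: (sr n)|].
  move=> p; rewrite exprMn mulrC ler_wpM2r ?sqr_ge0//.
  rewrite -(real_normK (num_real (phi p))) lerXn2r ?nnegrE//.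
  exact: le_trans (hM p).
- exact: cvg_cst.
- rewrite -[X in _ --> X](mulr0 (M ^+ 2)).
  by apply: cvgM; [exact: cvg_cst|exact: nrm2_r_cvg].
Unshelve. all: by end_near. Qed.

(** sqrt(mu_n) w_n = sqrt(mul) w_n + r_n w_n. The last term, a product of a null and a bounded
    sequence of L^2, tends to 0 in L^1: hence the bounded test function. *)
Lemma y_weak_bnd (phi : measurableTypeR R * X -> R) M :
  measurable_fun setT phi -> (forall p, `|phi p| <= M) ->
  ip Q (y n) phi @[n --> \oo] --> ip Q yl phi.
Proof.
move=> mphi hM; have [C Cge0 hC] := uniform_bounds.
have sphi := sqi_bnd Q mphi hM.
have sp1 : sqi Q (fun p => phi p * Num.sqrt (mul p)).
  exact: (sqiM sphi (msqrt mmul)) (fun p => sqrt_bnd (mul0 p) (mulB p)).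
have sp2 n : sqi Q (fun p => r n p * phi p) := sqiM (sr n) mphi hM.
have E n : ip Q (y n) phi = ip Q (w n) (fun p => phi p * Num.sqrt (mul p)) +
    ip Q (w n) (fun p => r n p * phi p).
  rewrite /ip -rintD; [|exact: sqi_intgM..].
  by congr rint; apply/funext => p; rewrite /y /r; ring.
have -> : ip Q yl phi = ip Q wl (fun p => phi p * Num.sqrt (mul p)) + 0.
  by rewrite addr0; congr rint; apply/funext => p; rewrite /yl; ring.
under eq_cvg do rewrite E; apply: cvgD; first exact: w_weak.
apply: ip_vanish => //; first by move=> n; have [_ h _ _] := hC n; exact: h.
exact: nrm2_rM hM.
Qed.

(** The same splitting one step further: g_n = sqrt(mul) y_n + r_n y_n. *)
Lemma g_weak_bnd (phi : measurableTypeR R * X -> R) M :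
  measurable_fun setT phi -> (forall p, `|phi p| <= M) ->
  rint Q (fun p => g n p * phi p) @[n --> \oo] --> rint Q (fun p => gl p * phi p).
Proof.
move=> mphi hM; have [C Cge0 hC] := uniform_bounds.
have sp2 n : sqi Q (fun p => r n p * phi p) := sqiM (sr n) mphi hM.
have M0 : 0 <= M by apply: le_trans (hM point).
have msq : measurable_fun setT (fun p => phi p * Num.sqrt (mul p)).
  by apply: measurable_funM => //; exact: msqrt.
have bsq p : `|phi p * Num.sqrt (mul p)| <= M * (1 + B).
  by rewrite normrM; apply: ler_pM => //; exact: sqrt_bnd.
have sp1 := sqi_bnd Q msq bsq.
have E n : rint Q (fun p => g n p * phi p) =
    ip Q (y n) (fun p => phi p * Num.sqrt (mul p)) + ip Q (y n) (fun p => r n p * phi p).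
  rewrite /ip -rintD; [|exact: sqi_intgM..].
  congr rint; apply/funext => p; rewrite /g /y /r.
  by rewrite -{1}(sqr_sqrtr (mu0 n p)); ring.
have -> : rint Q (fun p => gl p * phi p) = ip Q yl (fun p => phi p * Num.sqrt (mul p)) + 0.
  rewrite addr0; congr rint; apply/funext => p; rewrite /gl /yl.
  by rewrite -{1}(sqr_sqrtr (mul0 p)); ring.
under eq_cvg do rewrite E; apply: cvgD; first exact: y_weak_bnd bsq.
apply: ip_vanish => //; first by move=> n; have [h _ _ _] := hC n; exact: h.
exact: nrm2_rM hM.
Qed.

(** Bounded test functions suffice, because the basis of L^2(Q) consists of them and [y n] is
    bounded in L^2. *)
Lemma y_weak v : sqi Q v -> ip Q (y n) v @[n --> \oo] --> ip Q yl v.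
Proof.
move=> sv; have [C Cge0 hC] := uniform_bounds.
apply: (weak_cvg_basis hbQ (C := C)) => //.
- by move=> n; have [] := hC n.
- move=> k; have [/(_ k)[mk [M hM]] _ _ _] := hbQ; exact: y_weak_bnd hM.
Qed.

Lemma prim_mode_cvg k s t :
  prim (mode (g n) k) s t @[n --> \oo] --> prim (mode gl k) s t.
Proof.
have [M M0 hM] := basis_bnd he k.
rewrite (prim_mode he)//; under eq_cvg do rewrite (prim_mode he)//.
apply: (@g_weak_bnd _ (1 * M)).
  apply: measurable_funM; first exact: (measurableT_comp (measurable_chi1 s t)).
  by apply: measurableT_comp => //; exact: measurable_basis he _.
by move=> p; rewrite normrM ler_pM// chi_bnd.
Qed.

Lemma nrm2_mode_le u k : sqi Q u -> nrm2 I (mode u k) <= nrm2 Q u.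
Proof.
move=> su; have [_ u2] := su; have [iu2 eu2] := fubini1 u2.
rewrite /nrm2 !ip_sqr eu2; apply: rint_le_ae => //.
  by case: (sqi_mode he k su).
apply: filterS (ae_sqi1 su) => s ss; rewrite -ip_sqr.
apply: le_trans (bessel he k.+1 ss); rewrite big_ord_recr /= lerDr.
by apply: sumr_ge0 => i _; exact: sqr_ge0.
Qed.

Lemma rint_win_cvg k h :
  rint I (fun s => mode (w n) k s * win (mode (g n) k) h s) @[n --> \oo] -->
  rint I (fun s => mode wl k s * win (mode gl k) h s).
Proof.
have [C Cge0 hC] := uniform_bounds.
have [M M0 hM] := basis_bnd he k.
have smg n := sqi_mode he k (sg n); have smgl := sqi_mode he k sgl.
have smw n := sqi_mode he k (sw n).
have swin p : sqi I p -> sqi I (win p h) := @sqi_win _ T p h.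
pose D n s := win (mode (g n) k) h s - win (mode gl k) h s.
have sD n : sqi I (D n) by apply: sqiB; exact: swin.
pose bl := rint I (fun x => `|mode gl k x|).
have Dn2 : nrm2 I (D n) @[n --> \oo] --> 0.
  rewrite -[X in _ --> X](rint0 I).
  apply: (@rdct _ _ _ I _ _ (fun=> (M * C + bl) ^+ 2) _ _ _ _ _).2 => //.
  - by move=> n; apply: measurable_funM; exact: sqi_measurable (sD n).
  - apply: aeW => s; rewrite -[X in _ --> X](mulr0 0).
    have h0 : D n s @[n --> \oo] --> 0.
      rewrite -[X in _ --> X](subrr (win (mode gl k) h s)).
      by apply: cvgB; [exact: prim_mode_cvg|exact: cvg_cst].
    exact: cvgM.
  - by apply: (@intg_bnd _ _ _ _ _ `|(M * C + bl) ^+ 2|).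
  - move=> n; apply: aeW => s; rewrite -expr2 normrX lerXn2r ?nnegrE//.
      by rewrite addr_ge0 ?mulr_ge0// rint_ge0.
    apply: le_trans (ler_normB _ _) _; apply: lerD; last first.
      by apply: win_bnd; exact: sqi_intg.
    have gn0 p : 0 <= g n p by rewrite mulr_ge0//; case: (W n).
    apply: le_trans (prim_mode_bnd he s (s + h) (sg n) gn0 M0 hM) _.
    by rewrite ler_wpM2l//; have [_ _ h3 _] := hC n.
have E n : rint I (fun s => mode (w n) k s * win (mode (g n) k) h s) =
    ip I (mode (w n) k) (D n) + rint Q (fun p => w n p * (win (mode gl k) h p.1 * e k p.2)).
  rewrite -(rint_mode he k (sw n) (sqi_measurable (swin _ smgl))
    (fun s => win_bnd _ s (sqi_intg smgl))).
  rewrite /ip -rintD; [|by apply: sqi_intgM => //; exact: swin..].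
  by congr rint; apply/funext => s; rewrite /D mulrBr subrK.
under eq_cvg do rewrite E.
rewrite -(add0r (rint I (fun s => mode wl k s * win (mode gl k) h s))); apply: cvgD.
  apply: cvg_sqr0.
  apply: (@squeeze_cvgr _ _ _ _ (fun=> 0) (fun n => C * nrm2 I (D n))).
  - near=> n; rewrite sqr_ge0/=; apply: le_trans (cauchy_schwarz (smw n) (sD n)) _.
    rewrite ler_wpM2r ?ip_ge0//; apply: le_trans (nrm2_mode_le k (sw n)) _.
    by have [_ h2 _ _] := hC n.
  - exact: cvg_cst.
  - by rewrite -[X in _ --> X](mulr0 C); apply: cvgM => //; exact: cvg_cst.
rewrite (rint_mode he k swl (sqi_measurable (swin _ smgl))
    (fun s => win_bnd _ s (sqi_intg smgl))).
apply: w_weak; apply: (@sqiM _ _ _ _ _ _ M).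
- by apply: sqi_fst; exact: swin.
- by apply: measurableT_comp => //; exact: measurable_basis he _.
- by move=> p.
Unshelve. all: by end_near. Qed.

Lemma prim_harmonic_cvg (p : measurableTypeR R -> R) : intg I p ->
  prim p 0 (harmonic n) @[n --> \oo] --> 0.
Proof.
move=> pp; rewrite -[X in _ --> X](rint0 I).
apply: (@rdct _ _ _ I _ _ (fun x => `|p x|) _ _ _ _ _).2 => //.
- by move=> n; exact: intg_measurable (intg_chi _ _ pp).
- have hT := @interval_aeT _ T (fun t => 0 <= t /\ t < T) (fun t t0 tT => conj t0 tT).
  apply: filterS2 hT (interval_ae_neq T 0) => x [x0 _] /eqP xn0.
  have xp : 0 < x by rewrite lt_neqAle eq_sym xn0.
  apply: cvg_near_cst.
  have h0 : @harmonic R n @[n --> \oo] --> 0 := cvg_harmonic.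
  have /cvgrPdist_lt/(_ _ xp) := h0; apply: filterS => n.
  rewrite sub0r normrN gtr0_norm ?harmonic_gt0// => hx.
  by rewrite /chi [x < _]ltNge (ltW hx) andbF mulr0.
- exact: intg_norm.
- by move=> n; apply: aeW => x; rewrite normrM ler_piMr// chi_bnd.
Qed.

Lemma sum_nrm2_mode_le u n : sqi Q u ->
  \sum_(k < n) nrm2 I (mode u k) <= nrm2 Q u.
Proof.
move=> su; have [_ u2] := su; have [iu2 eu2] := fubini1 u2.
have i2 k : intg I (fun x => mode u k x ^+ 2) by case: (sqi_mode he k su).
rewrite /nrm2 ip_sqr eu2; under eq_bigr do rewrite ip_sqr.
rewrite -rint_sum//; apply: rint_le_ae => //; first exact: intg_sum.
by apply: filterS (ae_sqi1 su) => s ss; rewrite -ip_sqr; exact: bessel.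
Qed.

(* Average the energy inequality started at time s over the windows ]s, s + h[.
   For fixed h the windowed modes of g n converge strongly, so they pair with the
   weakly convergent modes of w n; then let h tend to 0. *)
Lemma limsup_energy eps : 0 < eps ->
  \forall n \near \oo, nrm2 Q (y n) <= nrm2 Q yl + 10 * eps.
Proof.
move=> e0; have [C Cge0 hC] := uniform_bounds.
have C00 : 0 <= C0 by apply: le_trans (u0C 0%N); exact: ip_ge0.
have smgl k := sqi_mode he k sgl; have smwl k := sqi_mode he k swl.
pose S := nrm2 Q yl.
have cS : \sum_(k < n) rint I (fun t => mode wl k t * mode gl k t) @[n --> \oo] --> S.
  have b1 : forall t : measurableTypeR R, `|(1 : R)| <= 1 by move=> _; rewrite normr1.
  have mc : measurable_fun [set: measurableTypeR R] (fun=> 1 : R) by [].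
  have h := parseval_time he swl sgl (b := fun=> 1) mc b1.
  have E n : \sum_(k < n) rint I (fun t => mode wl k t * mode gl k t) =
      \sum_(k < n) rint I (fun t => mode wl k t * mode gl k t * 1).
    by apply: eq_bigr => k _; congr rint; apply/funext => t; rewrite mulr1.
  have -> : S = rint Q (fun p => wl p * gl p * 1).
    congr rint; apply/funext => p; rewrite /yl /gl.
    by rewrite mulrACA -expr2 sqr_sqrtr//; ring.
  by under eq_cvg do rewrite E.
(* By [schur], mode k contributes at most h [bet k] to the windowed sum, for every h. The cut [K]
   will depend on h; the modes between [K0] and [K] are then controlled by the tail of [Sb], chosen
   before h. *)
pose bet k := nrm2 I (mode wl k) + nrm2 I (mode gl k).
pose Sb n := \sum_(k < n) bet k.
have Sb_nd : {homo Sb : a b / (a <= b)%N >-> a <= b}.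
  apply: homo_leq => //; first by move=> x z t; exact: le_trans.
  by move=> n; rewrite /Sb big_ord_recr /= lerDl addr_ge0// ip_ge0.
have cSb : cvgn Sb.
  apply: nondecreasing_is_cvgn => //; exists (nrm2 Q wl + nrm2 Q gl) => _ [n _ <-].
  by rewrite /Sb big_split lerD// sum_nrm2_mode_le.
have [K0 [K0S K0b]] : exists K0,
    `|S - \sum_(k < K0) rint I (fun t => mode wl k t * mode gl k t)| <= eps /\
    forall K, Sb K - Sb K0 <= eps.
  have /cvgrPdist_le/(_ _ e0) h1 := cS.
  have /cvgrPdist_le/(_ _ e0) h2 := cSb.
  have [K0 [k1 k2]] := filter_ex (filterI h1 h2).
  exists K0; split => // K; have lK := nondecreasing_cvgn_le Sb_nd cSb K.
  by move: k2; rewrite ler_distl => /andP[k2 k3]; move: lK k2 k3; move: (limn Sb) => l *; lra.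
pose ak k h := rint I (fun s => mode wl k s * win (mode gl k) h s).
(* For the initial layer: [d1] brings the term of the datum below eps, then [L1] that of the high
   modes. *)
pose d1 := eps / (C0 + 1); have C1 : 0 < C0 + 1 by lra.
have d10 : 0 < d1 by exact: divr_gt0.
have d1C : d1 * C0 <= eps.
  have e1 : d1 * (C0 + 1) = eps by rewrite /d1 divfK// gt_eqF.
  by rewrite -[leRHS]e1 ler_pM2l// lerDl.
pose L1 := (C + 1) / (d1 * eps).
have C2 : 0 < C + 1 by lra.
have L10 : 0 < L1 by apply: divr_gt0 => //; exact: mulr_gt0.
have L1C : C / (d1 * L1) <= eps.
  rewrite ler_pdivrMr; last exact: mulr_gt0.
  have -> : eps * (d1 * L1) = C + 1.
    by rewrite /L1; field; rewrite !gt_eqF//.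
  by rewrite lerDl.
have [K1 hK1] := lam_infty L1.
have st : (harmonic n)^-1 * \sum_(k < K0) ak k (harmonic n) @[n --> \oo] -->
    \sum_(k < K0) rint I (fun t => mode wl k t * mode gl k t).
  under eq_cvg do rewrite mulr_sumr.
  by apply: cvg_bigsum => k; exact: steklov.
have pr : \sum_(k < K1) (C0 + 1) * `|prim (mode gl k) 0 (harmonic n)| @[n --> \oo] --> 0.
  have E0 : \sum_(k < K1) (C0 + 1) * `|(0 : R)| = 0.
    by rewrite big1// => k _; rewrite normr0 mulr0.
  rewrite -[X in _ --> X]E0.
  apply: cvg_bigsum => k; apply: cvgM; first exact: cvg_cst.
  by apply: cvg_norm; apply: prim_harmonic_cvg; exact: sqi_intg.
have [N [stN prN]] : exists N,
    `|\sum_(k < K0) rint I (fun t => mode wl k t * mode gl k t) -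
      (harmonic N)^-1 * \sum_(k < K0) ak k (harmonic N)| <= eps /\
    \sum_(k < K1) (C0 + 1) * `|prim (mode gl k) 0 (harmonic N)| <= eps.
  have /cvgrPdist_le/(_ _ e0) h1 := st.
  have /cvgrPdist_le/(_ _ e0) h2 := pr.
  have [N [n1 n2]] := filter_ex (filterI h1 h2).
  exists N; split => //; apply: le_trans n2; rewrite sub0r normrN.
  exact: ler_norm.
have h0 : 0 < harmonic N :> R by exact: harmonic_gt0.
set h := harmonic N in h0 stN prN.
(* The factor h anticipates the division of the averaged inequality by h. Thus [L2], and with it
   [K], can be chosen only after h. *)
pose d2 := h * eps / (C + 1).
have he0 : 0 < h * eps by exact: mulr_gt0.
have d20 : 0 < d2 by exact: divr_gt0.
have d2C : d2 * C <= h * eps.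
  have e1 : d2 * (C + 1) = h * eps by rewrite /d2 divfK// gt_eqF.
  by rewrite -[leRHS]e1 ler_pM2l// lerDl.
pose L2 := (4 * C * T + 1) / (d2 * (h * eps)).
have CT : 0 <= 4 * C * T by rewrite !mulr_ge0// ltW.
have CT1 : 0 < 4 * C * T + 1 by apply: ltr_wpDl.
have L20 : 0 < L2 by apply: divr_gt0 => //; exact: mulr_gt0.
have L2C : 4 * C / (d2 * L2) * T <= h * eps.
  rewrite mulrAC ler_pdivrMr; last exact: mulr_gt0.
  have -> : h * eps * (d2 * L2) = 4 * C * T + 1.
    by rewrite /L2; field; rewrite !gt_eqF//.
  by rewrite lerDl.
have [K2 hK2] := lam_infty L2.
pose K := maxn K0 K2.
have KL2 k : (K <= k)%N -> L2 <= lam k.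
  by move=> Kk; apply: hK2; rewrite (leq_trans (leq_maxr _ _) Kk).
have aK : \sum_(k < K) ak k h <= h * (S + 3 * eps).
  have sch k : ak k h <= h * bet k.
    apply: le_trans (ler_norm _) _.
    have := schur (ltW h0) (@ltr01 R) (smwl k) (smgl k).
    by rewrite (invr1 R) !mul1r.
  have tail : \sum_(k < K) ak k h - \sum_(k < K0) ak k h <= h * (Sb K - Sb K0).
    have KK : (K0 <= K)%N by exact: leq_maxl.
    rewrite /Sb -!(big_mkord xpredT (fun k => ak k h)) -!(big_mkord xpredT bet).
    rewrite !(big_cat_nat (leq0n K0) KK) /= ![_ + _ - _]addrAC !subrr !add0r.
    by rewrite mulr_sumr; apply: ler_sum => k _; exact: sch.
  have t2 : \sum_(k < K0) ak k h <= h * (S + 2 * eps).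
    rewrite -ler_pdivrMl//.
    by move: stN K0S; rewrite !ler_distl => /andP[? ?] /andP[? ?]; lra.
  have t3 : h * (Sb K - Sb K0) <= h * eps by rewrite ler_pM2l// K0b.
  have -> : h * (S + 3 * eps) = h * (S + 2 * eps) + h * eps by ring.
  by lra.
have cK : \sum_(k < K) rint I (fun s => mode (w n) k s * win (mode (g n) k) h s)
    @[n --> \oo] --> \sum_(k < K) ak k h.
  by apply: cvg_bigsum => k; exact: rint_win_cvg.
have cK1 : \sum_(k < K1) (C0 + 1) * `|prim (mode (g n) k) 0 h| @[n --> \oo] -->
    \sum_(k < K1) (C0 + 1) * `|prim (mode gl k) 0 h|.
  apply: cvg_bigsum => k; apply: cvgM; first exact: cvg_cst.
  by apply: cvg_norm; exact: prim_mode_cvg.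
near=> n.
have n1 : `|\sum_(k < K) ak k h -
    \sum_(k < K) rint I (fun s => mode (w n) k s * win (mode (g n) k) h s)| <= h * eps.
  by near: n; move/cvgrPdist_le : cK; exact.
have n2 : `|\sum_(k < K1) (C0 + 1) * `|prim (mode gl k) 0 h| -
    \sum_(k < K1) (C0 + 1) * `|prim (mode (g n) k) 0 h| | <= eps.
  by near: n; move/cvgrPdist_le : cK1; exact.
have [yC wC gC YC] := hC n.
have iwg : intg Q (fun p => w n p * g n p) := sqi_intgM (sw n) (sg n).
(* h (S + 3 eps) bounds the windowed modes of the limits; one more h eps each pays for the passage
   from the limits to n, for the norm of [w n] and for the high modes. *)
have av : rint Q (fun p => w n p * g n p * (h <= p.1)%R%:R) <= S + 6 * eps.
  rewrite -(ler_pM2l h0).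
  apply: le_trans (energy_average T0 he lam_ge0 (W n) YC h0 L20 d20 KL2) _.
  have w1 : d2 * nrm2 Q (w n) <= h * eps.
    by apply: le_trans d2C; rewrite ler_pM2l.
  have Z0 : \sum_(k < K) rint I (fun s => mode (w n) k s * win (mode (g n) k) h s)
      <= h * (S + 3 * eps) + h * eps.
    move: n1; rewrite ler_distl => /andP[n1 _]; rewrite -lerBlDr.
    exact: le_trans n1 aK.
  have -> : h * (S + 6 * eps) = h * (S + 3 * eps) + h * eps + h * eps + h * eps by ring.
  exact: lerD (lerD Z0 w1) L2C.
have la : rint Q (fun p => w n p * g n p * chi 0 h p.1) <= 4 * eps.
  apply: le_trans (energy_layer he lam_ge0 (W n) YC h L10 d10 hK1) _.
  have u1 : d1 * nrm2 m (u0 n) <= eps by apply: le_trans d1C; rewrite ler_pM2l.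
  have s1 : \sum_(k < K1) ip m (u0 n) (e k) * prim (mode (g n) k) 0 h <=
      \sum_(k < K1) (C0 + 1) * `|prim (mode (g n) k) 0 h|.
    apply: ler_sum => k _; apply: le_trans (ler_norm _) _.
    rewrite normrM ler_wpM2r//.
    have [su0 _ _ _ _ _ _ _ _] := W n.
    have b2 : ip m (u0 n) (e k) ^+ 2 <= C0.
      apply: le_trans (u0C n); apply: le_trans (bessel he k.+1 su0).
      by rewrite big_ord_recr /= lerDr sumr_ge0// => i _; exact: sqr_ge0.
    exact: sqr_le_norm1.
  have Z1 : \sum_(k < K1) ip m (u0 n) (e k) * prim (mode (g n) k) 0 h <= eps + eps.
    move: n2; rewrite ler_distl => /andP[n2 _]; apply: le_trans s1 _.
    by rewrite -lerBlDr; exact: le_trans n2 prN.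
  have -> : 4 * eps = eps + eps + eps + eps by ring.
  exact: lerD (lerD Z1 u1) L1C.
have yE : nrm2 Q (y n) = rint Q (fun p => w n p * g n p).
  congr rint; apply/funext => p; rewrite /y /g.
  by rewrite mulrACA -expr2 sqr_sqrtr//; ring.
have mb : measurable_fun setT (fun p : measurableTypeR R * X => (h <= p.1)%R%:R : R).
  apply: (measurableT_comp (f := fun b : bool => b%:R : R)) => //.
  by apply: measurable_fun_ler.
have i1 : intg Q (fun p => w n p * g n p * chi 0 h p.1).
  apply: (@intgM _ _ _ _ _ _ 1) => //; last by move=> p; exact: chi_bnd.
  exact: (measurableT_comp (measurable_chi1 0 h)).
have i2 : intg Q (fun p => w n p * g n p * (h <= p.1)%R%:R).
  apply: (@intgM _ _ _ _ _ _ 1) => // p.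
  by case: (h <= p.1); rewrite ?normr1 ?normr0.
rewrite yE -/S.
apply: (@le_trans _ _ (rint Q (fun p => w n p * g n p * chi 0 h p.1 +
   w n p * g n p * (h <= p.1)%R%:R))).
  apply: rint_le_ae => //; first exact: intgD.
  have hT := @interval_aeT _ T (fun t => 0 <= t /\ t < T) (fun t t0 tT => conj t0 tT).
  have hT2 : \forall t \ae I, chi 0 h t + (h <= t)%R%:R = 1 :> R.
    apply: filterS2 hT (interval_ae_neq T 0) => t [t0 tT] /eqP tn0.
    have tp : 0 < t by rewrite lt_neqAle eq_sym tn0.
    by rewrite /chi tp /=; case: ltP; rewrite ?addr0 ?add0r.
  by apply: filterS (ae_fst m hT2) => p hp; rewrite -mulrDr hp mulr1.
have -> : S + 10 * eps = 4 * eps + (S + 6 * eps) by ring.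
by rewrite rintD//; exact: lerD.
Unshelve. all: by end_near. Qed.

End compactness.

(** * From weak to strong convergence with a variable weight *)

Section weighted_strong.
Context d (X : measurableType d) (R : realType).
Variables (Q : {finite_measure set X -> \bar R}) (bQ : nat -> X -> R).
Hypothesis hbQ : hilbert_basis Q bQ.

(** Use v^2 <= 2 (v - b)^2 + 2 b^2 with b a bounded partial sum of v: the bound on [q] controls the
    first part and its convergence in L^1 the second, without extracting an almost everywhere
    convergent subsequence. *)
Lemma rint_mul_sqr_cvg0 (q : nat -> X -> R) (v : X -> R) (D : R) :
  (forall n, measurable_fun setT (q n)) -> (forall n x, 0 <= q n x <= D) ->
  rint Q (q n) @[n --> \oo] --> 0 -> sqi Q v ->
  rint Q (fun x => q n x * v x ^+ 2) @[n --> \oo] --> 0.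
Proof.
move=> mq qD q0 sv; have D0 : 0 <= D by have /andP[] := qD 0%N point; exact: le_trans.
have qa n x : `|q n x| <= D by case/andP : (qD n x) => h1 h2; rewrite ger0_norm.
have iq n : intg Q (q n) := intg_bnd Q (mq n) (qa n).
have iqs u n : sqi Q u -> intg Q (fun x => q n x * u x ^+ 2).
  move=> [mu u2]; rewrite (_ : (fun _ => _) = fun x => u x ^+ 2 * q n x).
    exact: intgM (mq n) (qa n).
  by apply/funext => x; rewrite mulrC.
apply/cvgrPdist_le => eps e0; have D1 : 0 < 4 * (D + 1) by lra.
have /cvgrPdist_le/(_ _ (divr_gt0 e0 D1)) := parseval_remainder hbQ sv.
move=> [K _ /(_ K (leqnn K))] /=; rewrite sub0r normrN.
set a := fun k : nat => ip Q v (bQ k) => hK; have [M M0 hM] := psum_bnd hbQ a K.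
have M1 : 0 < 4 * (M ^+ 2 + 1) by have := sqr_ge0 M; lra.
have /cvgrPdist_le/(_ _ (divr_gt0 e0 M1)) := q0.
have sp := psum_sqi hbQ a K; have svp := sqiB sv sp.
apply: filterS => n; rewrite !sub0r !normrN => hn.
rewrite ger0_norm; last first.
  by apply: rint_ge0 => x; rewrite mulr_ge0 ?sqr_ge0//; case/andP : (qD n x).
apply: (@le_trans _ _ (2 * D * nrm2 Q (fun x => v x - psum bQ a K x) +
   2 * M ^+ 2 * rint Q (q n))).
  rewrite /nrm2 ip_sqr -!rintZ//; last by case: svp.
  rewrite -rintD//; last 2 first.
    by apply: intgZ; case: svp.
    exact: intgZ.
  apply: rint_le; first exact: iqs.
    apply: intgD; [by apply: intgZ; case: svp|exact: intgZ].
  move=> x; case/andP : (qD n x) => h1 h2; have := hM x; move: (psum _ _ _ _) => b hb.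
  have b2 : b ^+ 2 <= M ^+ 2 by rewrite -(real_normK (num_real b)) lerXn2r ?nnegrE.
  have t1 : q n x * b ^+ 2 <= q n x * M ^+ 2 by rewrite ler_wpM2l.
  have t2 : q n x * (v x - b) ^+ 2 <= D * (v x - b) ^+ 2 by rewrite ler_wpM2r ?sqr_ge0.
  have t3 : q n x * v x ^+ 2 <= q n x * (2 * (v x - b) ^+ 2 + 2 * b ^+ 2).
    by rewrite ler_wpM2l//; have := sqr_ge0 (v x - 2 * b); lra.
  by move: t3; rewrite mulrDr mulrCA [q n x * (2 * _)]mulrCA; lra.
have hK' := le_trans (ler_norm _) hK; have hn' := le_trans (ler_norm _) hn.
move: hK' hn'; rewrite !ler_pdivlMr//; clear -D0 M0 e0 svp.
have := ip_ge0 Q (fun x => v x - psum bQ a K x); rewrite -/(nrm2 _ _).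
move: (nrm2 _ _) (rint _ _) => z1 z2 z0 h1 h2.
have t1 : D * z1 <= (D + 1) * z1 by rewrite ler_wpM2r// lerDl.
have [z20|/ltW z20] := leP 0 z2.
  have t2 : M ^+ 2 * z2 <= (M ^+ 2 + 1) * z2 by rewrite ler_wpM2r// lerDl.
  by lra.
have t2 : M ^+ 2 * z2 <= 0 by rewrite mulr_ge0_le0// sqr_ge0.
by lra.
Qed.

Variables (w mu : nat -> X -> R) (mul wl : X -> R) (c B : R).
Hypotheses (c0 : 0 < c) (muc : forall n x, c <= mu n x).
Hypotheses (mulc : forall x, c <= mul x) (mulB : forall x, mul x <= B).
Hypotheses (mmu : forall n, measurable_fun setT (mu n)) (mmul : measurable_fun setT mul).
Hypotheses (imu : forall n, intg Q (mu n)) (sw : forall n, sqi Q (w n)) (swl : sqi Q wl).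
Let y n x := Num.sqrt (mu n x) * w n x.
Let yl x := Num.sqrt (mul x) * wl x.
Hypotheses (sy : forall n, sqi Q (y n)) (syl : sqi Q yl).
Hypothesis mu_cvg : rint Q (fun x => `|mu n x - mul x|) @[n --> \oo] --> 0.
Hypothesis y_weak : ip Q (y n) yl @[n --> \oo] --> nrm2 Q yl.
Hypothesis y_limsup : forall eps, 0 < eps ->
  \forall n \near \oo, nrm2 Q (y n) <= nrm2 Q yl + eps.

(** Expanding the square, weak convergence gives the cross term and the upper limit gives the norm
    of [y n]. *)
Let y_strong : nrm2 Q (fun x => y n x - yl x) @[n --> \oo] --> 0.
Proof.
apply/cvgrPdist_le => eps e0; have e3 : 0 < eps / 3 by lra.
have /cvgrPdist_le/(_ _ e3) h := y_weak.
near=> n; rewrite sub0r normrN ger0_norm; last exact: ip_ge0.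
rewrite nrm2_subr//.
have : nrm2 Q (y n) <= nrm2 Q yl + eps / 3 by near: n; exact: y_limsup.
have : `|nrm2 Q yl - ip Q (y n) yl| <= eps / 3 by near: n.
by rewrite ler_distl => /andP[? ?] ?; lra.
Unshelve. all: by end_near. Qed.

(** Divide sqrt(mu) (w - wl) = (y - yl) - (sqrt(mu) - sqrt(mul)) wl by sqrt(mu) >= sqrt(c). After
    squaring, wl^2 is multiplied by a ratio that is bounded and tends to 0 in L^1. *)
Lemma weighted_strong : nrm2 Q (fun x => w n x - wl x) @[n --> \oo] --> 0.
Proof.
have mul0 x : 0 <= mul x by rewrite (le_trans (ltW c0)).
have mu0 n x : 0 < mu n x by exact: lt_le_trans (muc n x).
have msqrt h : measurable_fun setT h -> measurable_fun setT (fun x : X => Num.sqrt (h x : R)).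
  move=> mh; apply: measurableT_comp => //.
  by apply: continuous_measurable_fun; exact: sqrt_continuous.
pose q n x := (Num.sqrt (mu n x) - Num.sqrt (mul x)) ^+ 2 / mu n x.
have q0 n x : 0 <= q n x by rewrite divr_ge0 ?sqr_ge0// ltW.
have qD n x : 0 <= q n x <= 1 + B / c by rewrite q0/= sqrt_ratio_bnd.
have mq n : measurable_fun setT (q n).
  apply: measurable_funM.
    by apply: measurable_funX; apply: measurable_funB; exact: msqrt.
  rewrite (_ : (fun _ => _) = fun x => mu n x `^ (-1)).
    exact: measurableT_comp (measurable_powR _) (mmu n).
  by apply/funext => x; rewrite powR_inv1// ltW.
have qa n x : `|q n x| <= 1 + B / c by case/andP : (qD n x) => h1 h2; rewrite ger0_norm.
have iq n : intg Q (q n) := intg_bnd Q (mq n) (qa n).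
have imul : intg Q mul by apply: (intg_bnd Q mmul) => x; rewrite ger0_norm.
have qcvg : rint Q (q n) @[n --> \oo] --> 0.
  apply: (@squeeze_cvgr _ _ _ _ (fun=> 0)
    (fun n => c^-1 * rint Q (fun x => `|mu n x - mul x|))).
  - near=> n; rewrite rint_ge0//= -rintZ; last by apply: intg_norm; exact: intgB.
    apply: rint_le => //; first by apply: intgZ; apply: intg_norm; exact: intgB.
    move=> x; rewrite /q [leRHS]mulrC.
    apply: ler_pM; [exact: sqr_ge0|by rewrite invr_ge0 ltW| |].
      by rewrite sqr_sqrt_sub// ltW.
    by rewrite lef_pV2 ?posrE.
  - exact: cvg_cst.
  - by rewrite -[X in _ --> X](mulr0 c^-1); apply: cvgM => //; exact: cvg_cst.
have qv := rint_mul_sqr_cvg0 mq qD qcvg swl.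
apply: (@squeeze_cvgr _ _ _ _ (fun=> 0) (fun n =>
  2 / c * nrm2 Q (fun x => y n x - yl x) + 2 * rint Q (fun x => q n x * wl x ^+ 2))).
- near=> n; rewrite ip_ge0/=.
  have sd := sqiB (sw n) swl; have syd := sqiB (sy n) syl.
  have iqw : intg Q (fun x => q n x * wl x ^+ 2).
    rewrite (_ : (fun _ => _) = fun x => wl x ^+ 2 * q n x).
      by apply: intgM (mq n) (qa n); case: swl.
    by apply/funext => x; rewrite mulrC.
  rewrite /nrm2 !ip_sqr -!rintZ//; last by case: syd.
  rewrite -rintD; [|by apply: intgZ; case: syd|exact: intgZ].
  apply: rint_le; first by case: sd.
    by apply: intgD; apply: intgZ => //; case: syd.
  move=> x; rewrite /y /yl /q.
  have := sqr_sqrtr (ltW (mu0 n x)); have := muc n x.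
  have := mu0 n x; move: (mu n x) (Num.sqrt (mu n x)) (Num.sqrt (mul x)) (w n x) (wl x) => m a b u v m0 cm am.
  have i0 : 0 < m^-1 by rewrite invr_gt0.
  have ic : m^-1 <= c^-1 by rewrite lef_pV2 ?posrE.
  have -> : (u - v) ^+ 2 = m^-1 * ((a * u - b * v) - (a - b) * v) ^+ 2.
    have -> : a * u - b * v - (a - b) * v = a * (u - v) by ring.
    by rewrite exprMn am mulrA mulVf ?mul1r// gt_eqF.
  set P := a * u - b * v; set S := (a - b) * v.
  apply: (@le_trans _ _ (m^-1 * (2 * P ^+ 2 + 2 * S ^+ 2))).
    by rewrite ler_pM2l//; have := sqr_ge0 (P + S); lra.
  rewrite mulrDr; apply: lerD.
    by rewrite mulrCA -mulrA ler_pM2l// ler_wpM2r// sqr_ge0.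
  by rewrite /S exprMn [leRHS](_ : _ = m^-1 * (2 * ((a - b) ^+ 2 * v ^+ 2)))//; ring.
- exact: cvg_cst.
- rewrite -[X in _ --> X](addr0 0); apply: cvgD.
    by rewrite -[X in _ --> X](mulr0 (2 / c)); apply: cvgM => //; exact: cvg_cst.
  by rewrite -[X in _ --> X](mulr0 2); apply: cvgM => //; exact: cvg_cst.
Unshelve. all: by end_near. Qed.

End weighted_strong.

Lemma cvg_extraction (T : topologicalType) (u : nat -> T) (l : T) (s : nat -> nat) :
  extraction s -> u n @[n --> \oo] --> l -> u (s n) @[n --> \oo] --> l.
Proof.
move=> hs ul; apply: (cvg_comp _ _ _ ul) => A [N _ hN].
have sn n : (n <= s n)%N.
  by elim: n => // n IH; apply: leq_ltn_trans IH _; exact: hs.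
by exists N => // n /= Nn; apply: hN; exact: leq_trans Nn (sn n).
Qed.

(** The torus enters only through orthonormal bases of bounded functions, in space and in
    space-time, and through eigenvalues tending to infinity. *)
Theorem evolution_compactness (R : realType) (T : R) d (X : measurableType d)
    (m : {finite_measure set X -> \bar R}) (e : nat -> X -> R) (lam : nat -> R)
    (bQ : nat -> measurableTypeR R * X -> R)
    (u0 : nat -> X -> R) (w mu f : nat -> measurableTypeR R * X -> R)
    (mul : measurableTypeR R * X -> R) (c B C0 : R) :
  let Q := finite_prod (interval_measure T) m in
  0 < T -> hilbert_basis m e -> (forall k, 0 <= lam k) ->
  (forall L, exists n0, forall n, (n0 <= n)%N -> L <= lam n) ->
  hilbert_basis Q bQ -> 0 < c -> (forall n p, c <= mu n p) ->
  (forall p, c <= mul p) -> (forall p, mul p <= B) -> measurable_fun setT mul ->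
  (forall n, weak_evolution T m e lam (u0 n) (w n) (mu n) (f n)) ->
  (forall n, nrm2 m (u0 n) <= C0) ->
  rint Q (fun p => `|mu n p - mul p|) @[n --> \oo] --> 0 ->
  exists2 s : nat -> nat, extraction s &
    exists2 wl, sqi Q wl & nrm2 Q (fun p => w (s n) p - wl p) @[n --> \oo] --> 0.
Proof.
move=> Q T0 he lam_ge0 lam_infty hbQ c0 muc mulc mulB mmul W u0C mu_cvg.
have [C Cge0 hC] := uniform_bounds he lam_ge0 lam_infty c0 muc mulc mulB mmul W u0C mu_cvg.
have sw n : sqi Q (w n) by case: (W n).
have [|s hs [wl swl w_weak]] := weak_compactness hbQ sw (C := C).
  by move=> n; have [] := hC n.
exists s => //; exists wl => //.
have mu_cvgs := cvg_extraction hs mu_cvg.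
have Ws n := W (s n); have u0Cs n := u0C (s n); have mucs n := muc (s n).
have mmu n : measurable_fun setT (mu n) by case: (W n).
have muB n : exists B, forall p, mu n p <= B by exact: we_mub (W n).
have mu0 n p : 0 <= mu n p by exact: le_trans (ltW c0) (muc n p).
have mul0 p : 0 <= mul p by exact: le_trans (ltW c0) (mulc p).
have sqrtM (h v : measurableTypeR R * X -> R) D : measurable_fun setT h ->
    (forall p, 0 <= h p) -> (forall p, h p <= D) -> sqi Q v ->
    sqi Q (fun p => Num.sqrt (h p) * v p).
  move=> mh h0 hD sv; have mn : measurable_fun setT (fun p => Num.sqrt (h p)).
    apply: measurableT_comp mh.
    by apply: continuous_measurable_fun; exact: sqrt_continuous.
  rewrite (_ : (fun _ => _) = fun p => v p * Num.sqrt (h p)); last first.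
    by apply/funext => p; rewrite mulrC.
  apply: (sqiM sv mn (M := 1 + D)) => p; rewrite ger0_norm ?sqrtr_ge0//.
  have := sqr_sqrtr (h0 p); have := hD p; have := sqrtr_ge0 (h p).
  by move: (Num.sqrt _) => x x0 xD xh; have := sqr_ge0 (x - 1); nra.
apply: (weighted_strong hbQ c0 mucs mulc mulB) => //.
- move=> n; have [Bn hB] := muB (s n).
  by apply: (@intg_bnd _ _ _ _ _ Bn) => // p; rewrite ger0_norm.
- by move=> n; have [Bn hB] := muB (s n); exact: sqrtM hB _.
- exact: sqrtM mulB _.
- exact: (y_weak he lam_ge0 lam_infty hbQ c0 mucs mulc mulB mmul Ws u0Cs mu_cvgs swl
    w_weak (sqrtM _ _ _ mmul mul0 mulB swl)).
- move=> eps e0; have e10 : 0 < eps / 10 by rewrite divr_gt0.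
  have := limsup_energy T0 he lam_ge0 lam_infty c0 mucs mulc mulB mmul Ws u0Cs mu_cvgs swl
    w_weak e10.
  by apply: filterS => n; rewrite mulrC divfK.
Qed.

(** * Smooth test functions *)

(** e^(-1/x) with powers of 1/x in front: the derivative of [flat k] is a combination of [flat k.+1]
    and [flat k.+2], so the family is closed under differentiation, including at 0. *)
Definition flat (R : realType) (k : nat) (x : R) : R :=
  if 0 < x then x^-1 ^+ k * expR (- x^-1) else 0.

Section flat.
Context (R : realType).
Implicit Types x : R.

(** Comparison of exp with its Taylor term of degree k + 2. A quadratic bound makes the derivative
    at 0 exist and vanish. *)
Lemma flat_quad k x : `|flat k x| <= k.+2`!%:R * x ^+ 2.
Proof.
rewrite /flat; case: ifPn => [x0|_]; last first.
  by rewrite normr0 mulr_ge0// sqr_ge0.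
have i0 : 0 < x^-1 by rewrite invr_gt0.
rewrite ger0_norm; last by rewrite mulr_ge0 ?expR_ge0 ?exprn_ge0 ?ltW.
have C0 : 0 < k.+2`!%:R :> R by rewrite ltr0n fact_gt0.
have h : x^-1 ^+ k.+2 <= k.+2`!%:R * expR x^-1.
  rewrite -ler_pdivrMl// mulrC; apply: le_trans (expR_ge1Dxn k.+1 (ltW i0)).
  by rewrite lerDr.
set C := _%:R in C0 h *.
rewrite expRN ler_pdivrMr ?expR_gt0//.
have -> : x^-1 ^+ k = x ^+ 2 * x^-1 ^+ k.+2.
  by rewrite -(addn2 k) (exprD _ k 2) mulrCA -exprMn mulfV ?expr1n ?mulr1// gt_eqF.
by rewrite [leRHS]mulrAC [leRHS]mulrC ler_pM2l ?exprn_gt0.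
Qed.

Lemma is_derive_flat k x :
  is_derive x 1 (@flat R k) (flat k.+2 x - k%:R * flat k.+1 x).
Proof.
have [x0|x0|->] := ltgtP x 0.
- have E j : flat j x = 0 by rewrite /flat ltNge (ltW x0).
  rewrite !E mulr0 subr0.
  apply: (@near_eq_is_derive _ _ _ (cst 0)).
  near=> y; have y0 : y < 0 by near: y; exact: lt_nbhsl.
  by rewrite /flat ltNge (ltW y0).
- have i0 : x != 0 by rewrite gt_eqF.
  have dV : is_derive x 1 (fun y : R => y^-1) (- x ^- 2).
    have := @is_deriveV _ id x 1 1 i0 (is_derive_id _ _).
    by rewrite /GRing.scale/= mulr1.
  have dE : is_derive x 1 (fun y : R => expR (- y^-1)) (expR (- x^-1) * x ^- 2).
    have dN := is_deriveN dV; rewrite opprK in dN.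
    exact: (@is_derive1_comp _ expR (fun y => - y^-1)).
  have dM : is_derive x 1 (fun y : R => y^-1 ^+ k * expR (- y^-1))
      (flat k.+2 x - k%:R * flat k.+1 x).
    have D := is_deriveM (is_deriveX k dV) dE; rewrite exprfctE in D.
    suff <- : x^-1 ^+ k * (expR (- x^-1) * x ^- 2) +
        expR (- x^-1) * (k%:R * x^-1 ^+ k.-1 * - x ^- 2) =
      flat k.+2 x - k%:R * flat k.+1 x by exact: D.
    rewrite /flat x0 -exprVn; case: (k) => [|j] /=; last by rewrite !exprS; ring.
    by rewrite !mul0r !mulr0 !expr0 !exprS expr0; ring.
  apply: near_eq_is_derive dM; near=> y; have y0 : 0 < y by near: y; exact: lt_nbhsr.
  by rewrite /flat y0.
- have E j : flat j 0 = 0 :> R by rewrite /flat ltxx.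
  rewrite !E mulr0 subr0; set C : R := k.+2`!%:R.
  have C0 : 0 <= C by [].
  have h : h^-1 *: ((@flat R k \o shift 0) (h *: 1) - flat k 0) @[h --> 0^'] --> (0 : R).
    apply/cvgrPdist_le => e e0; near=> h.
    have h0 : h != 0 by near: h; exact: nbhs_dnbhs_neq.
    rewrite E sub0r normrN subr0 /= addr0 /GRing.scale/= mulr1.
    rewrite normrM normfV ler_pdivrMl ?normr_gt0//.
    apply: le_trans (flat_quad k h) _; rewrite -/C.
    rewrite -(real_normK (num_real h)) expr2 mulrCA ler_wpM2l//.
    have : `|h| < e / (C + 1).
      near: h; apply: dnbhs0_lt; rewrite divr_gt0//.
      by rewrite ltr_wpDl.
    rewrite ltr_pdivlMr ?ltr_wpDl// => /ltW; apply: le_trans.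
    by rewrite mulrC ler_wpM2l// lerDl.
  by apply: DeriveDef; [exact: cvgP h|exact: cvg_lim h].
Unshelve. all: by end_near. Qed.

Lemma continuous_flat k : continuous (@flat R k).
Proof.
move=> x; apply: differentiable_continuous; apply/derivable1_diffP.
by case: (is_derive_flat k x).
Qed.

End flat.

(** * A class of smooth functions *)

Section elementary.
Context (R : realType) (V : normedModType R).
Implicit Types (f g : V -> R) (v x : V).

(** Restricted to the line through x directed by v, this is the one-variable chain rule. *)
Lemma is_derive_comp_real (h : R -> R) f x v (dh df : R) :
  is_derive (f x) 1 h dh -> is_derive x v f df ->
  is_derive x v (fun y => h (f y)) (dh * df).
Proof.
move=> hd [fd fe].
pose F (s : R) := f (s *: v + x).
have lim_eq (G : V -> R) :
    (fun s : R => s^-1 *: (((fun s : R => G (s *: v + x)) \o shift 0) (s *: (1 : R)) - G (0 *: v + x))) =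
    (fun s : R => s^-1 *: ((G \o shift x) (s *: v) - G x)).
  by apply/funext => s /=; rewrite scale0r add0r addr0 /GRing.scale/= mulr1.
have Fd : is_derive (0 : R) 1 F df.
  apply: DeriveDef; first by rewrite /derivable /F lim_eq.
  by rewrite -fe /derive /F lim_eq.
have hF : is_derive (0 : R) 1 (h \o F) (dh * df).
  by apply: is_derive1_comp; rewrite /F scale0r add0r.
case: hF => Gd Ge; move: Gd Ge; rewrite /derivable /derive /F.
have := lim_eq (fun y => h (f y)) => /= -> Gd Ge.
exact: DeriveDef.
Qed.

Lemma is_derive_line f x v (d : R) :
  (forall s : R, f (s *: v + x) = s * d + f x) -> is_derive x v f d.
Proof.
move=> fE; have h : s^-1 *: ((f \o shift x) (s *: v) - f x) @[s --> (0 : R)^'] --> d.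
  apply: cvg_near_cst; near=> s; rewrite /= fE addrK /GRing.scale/= mulKf//.
  by near: s; exact: nbhs_dnbhs_neq.
by apply: DeriveDef; [exact: cvgP h|exact: cvg_lim h].
Unshelve. all: by end_near. Qed.

(** A syntactic class of continuous functions stable under directional derivatives; smoothness,
    which quantifies over lists of directions, then follows by induction on the list. *)
Inductive elementary : (V -> R) -> Prop :=
| elem_lin l : (forall (s : R) v x, l (s *: v + x) = s * l v + l x) -> continuous l ->
    elementary l
| elem_cst c : elementary (fun=> c)
| elem_add f g : elementary f -> elementary g -> elementary (fun x => f x + g x)
| elem_mul f g : elementary f -> elementary g -> elementary (fun x => f x * g x)
| elem_exp f : elementary f -> elementary (fun x => expR (f x))
| elem_cos f : elementary f -> elementary (fun x => cos (f x))
| elem_sin f : elementary f -> elementary (fun x => sin (f x))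
| elem_flat k f : elementary f -> elementary (fun x => flat k (f x)).

Lemma elementary_continuous f : elementary f -> continuous f.
Proof.
elim=> [l _ cl|c|{}f g _ cf _ cg|{}f g _ cf _ cg|{}f _ cf|{}f _ cf|{}f _ cf|k {}f _ cf] x.
- exact: cl.
- exact: cvg_cst.
- by apply: cvgD; [exact: cf|exact: cg].
- by apply: cvgM; [exact: cf|exact: cg].
- by apply: continuous_comp (cf x) _; exact: continuous_expR.
- by apply: continuous_comp (cf x) _; exact: continuous_cos.
- by apply: continuous_comp (cf x) _; exact: continuous_sin.
- by apply: continuous_comp (cf x) _; exact: continuous_flat.
Qed.

Lemma elementary_derive f v : elementary f ->
  exists2 df, elementary df & forall x, is_derive x v f (df x).
Proof.
elim=> [l hl _|c|{}f g _ [df ef Df] _ [dg eg Dg]|{}f g ef' [df ef Df] eg' [dg eg Dg]|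
  {}f ef' [df ef Df]|{}f ef' [df ef Df]|{}f ef' [df ef Df]|k {}f ef' [df ef Df]].
- exists (fun=> l v); first exact: elem_cst.
  by move=> x; apply: is_derive_line => s.
- by exists (fun=> 0) => [|x]; [exact: elem_cst|exact: is_derive_cst].
- exists (fun x => df x + dg x) => [|x]; first exact: elem_add.
  exact: is_deriveD (Df x) (Dg x).
- exists (fun x => f x * dg x + g x * df x) => [|x].
    by apply: elem_add; exact: elem_mul.
  exact: is_deriveM (Df x) (Dg x).
- exists (fun x => expR (f x) * df x) => [|x].
    by apply: elem_mul => //; exact: elem_exp.
  by apply: is_derive_comp_real (Df x); exact: is_derive_expR.
- exists (fun x => - 1 * sin (f x) * df x) => [|x].
    by apply: elem_mul => //; apply: elem_mul; [exact: elem_cst|exact: elem_sin].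
  by rewrite mulN1r; apply: is_derive_comp_real (Df x); exact: is_derive_cos.
- exists (fun x => cos (f x) * df x) => [|x].
    by apply: elem_mul => //; exact: elem_cos.
  by apply: is_derive_comp_real (Df x); exact: is_derive_sin.
- exists (fun x => (flat k.+2 (f x) + - k%:R * flat k.+1 (f x)) * df x) => [|x].
    apply: elem_mul => //; apply: elem_add; first exact: elem_flat.
    by apply: elem_mul; [exact: elem_cst|exact: elem_flat].
  by rewrite mulNr; apply: is_derive_comp_real (Df x); exact: is_derive_flat.
Qed.

Lemma elementary_smooth f : elementary f -> smooth f.
Proof.
move=> ef vs; suff e : elementary (iter_derive f vs).
  split; first exact: elementary_continuous.
  by move=> x v; have [df _ /(_ x) []] := elementary_derive v e.
elim: vs => //= v vs /(elementary_derive v) [df edf Ddf].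
rewrite (_ : 'D_v _ = df)//; apply/funext => x.
by case: (Ddf x).
Qed.

Lemma elem_prod (I : Type) (s : seq I) (F : I -> V -> R) :
  (forall i, elementary (F i)) -> elementary (fun x => \prod_(i <- s) F i x).
Proof.
move=> eF; elim: s => [|i s IH].
  by rewrite (_ : (fun _ => _) = fun=> 1); [exact: elem_cst|apply/funext => x; rewrite big_nil].
rewrite (_ : (fun _ => _) = fun x => F i x * \prod_(j <- s) F j x).
  exact: elem_mul.
by apply/funext => x; rewrite big_cons.
Qed.

End elementary.

(** * From distributional solutions to spectral evolutions *)

Section du_bois_reymond.
Context (R : realType) (T : R).
Local Notation I := (interval_measure T).

(** Cauchy's formula for repeated integration: exchange the integrals over the triangle. *)
Lemma rint_prim_chi (p : measurableTypeR R -> R) s : sqi I p -> 0 <= s -> s <= T ->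
  rint I (fun x => prim T p 0 x * chi 0 s x) = rint I (fun t => p t * ((s - t) * chi 0 s t)).
Proof.
move=> sp s0 sT; have s1 : sqi I (fun=> 1) by apply: (@sqi_bnd _ _ _ _ _ 1) => // x; rewrite normr1.
transitivity (rint I (fun x => 1 * prim T p 0 x * chi 0 s x)).
  by congr rint; apply/funext => x; rewrite mul1r.
rewrite rint_tri// (fubini2 (intg_tri 0 s s1 sp)).2; congr rint; apply/funext => y.
rewrite /tri /=.
have [/andP[y0 ys]|ny] := boolP (0 < y < s); last first.
  rewrite [in RHS]/chi (negbTE ny) !mulr0 -[RHS](rint0 I); congr rint; apply/funext => x.
  rewrite /chi; case: (ltP 0 y) ny => y0 ny; last by rewrite !mulr0.
  case: (ltP y x) => yx; last by rewrite !mulr0.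
  by rewrite [x < s]ltNge (le_trans _ (ltW yx)) ?andbF ?mul0r ?mulr0// leNgt.
rewrite [in RHS]/chi y0 ys mulr1 -(rint_chi (ltW y0) (ltW ys) sT).
rewrite -rintZ; last first.
  apply: (@intg_bnd _ _ _ _ _ 1); first exact: measurable_chi1.
  by move=> x; exact: chi_bnd.
congr rint; apply/funext => x; rewrite mul1r /chi y0 /=.
by have [yx|yx] := ltP y x; rewrite /= ?mulr0 ?mulr1// (lt_trans y0 yx).
Qed.

(** Left continuity of the primitive; it reaches the endpoint T, where no tested identity is
    available. *)
Lemma prim_cvg_end (p : measurableTypeR R -> R) (s : R) : intg I p ->
  prim T p 0 (s - harmonic n) @[n --> \oo] --> prim T p 0 s.
Proof.
move=> pp; apply: (@rdct _ _ _ I _ _ (fun x => `|p x|) _ _ _ _ _).2 => //.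
- by move=> n; exact: intg_measurable (intg_chi _ _ pp).
- exact: intg_measurable (intg_chi _ _ pp).
- apply: aeW => x; apply: cvg_near_cst.
  have [xs|sx] := ltP x s.
    have h0 : @harmonic R n @[n --> \oo] --> 0 := cvg_harmonic.
    have xp : 0 < s - x by rewrite subr_gt0.
    have /cvgrPdist_lt/(_ _ xp) := h0; apply: filterS => n.
    rewrite sub0r normrN gtr0_norm ?harmonic_gt0// => hx.
    by rewrite /chi xs ltrBrDl -ltrBrDr hx.
  near=> n; rewrite /chi [x < s]ltNge sx [x < _]ltNge (le_trans _ sx)//.
  by rewrite lerBlDr lerDl harmonic_ge0.
- exact: intg_norm.
- by move=> n; apply: aeW => x; rewrite normrM ler_piMr// chi_bnd.
Unshelve. all: by end_near. Qed.

(** By [rint_prim_chi] the hypothesis says that [a] and A0 + prim p have the same primitive; their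
    difference integrates to 0 over every interval. *)
Lemma du_bois_reymond (a p : measurableTypeR R -> R) A0 : 0 < T -> sqi I a -> sqi I p ->
  (forall s, 0 < s -> s < T ->
    prim T a 0 s = s * A0 + rint I (fun t => p t * ((s - t) * chi 0 s t))) ->
  \forall x \ae I, a x = A0 + prim T p 0 x.
Proof.
move=> T0 sa sp h.
have s1 : sqi I (fun=> 1) by apply: (@sqi_bnd _ _ _ _ _ 1) => // x; rewrite normr1.
have ichi s t : intg I (chi s t).
  apply: (@intg_bnd _ _ _ _ _ 1); first exact: measurable_chi1.
  by move=> x; exact: chi_bnd.
have ip s : intg I (fun x => prim T p 0 x * chi 0 s x).
  have := intg_prim_chi 0 s s1 sp.
  by congr (intg _ _); apply/funext => x; rewrite mul1r.
pose u x := a x * chi 0 T x - A0 * chi 0 T x - prim T p 0 x * chi 0 T x.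
have iu : intg I u.
  apply: intgB; [apply: intgB|exact: ip]; last exact: intgZ.
  by apply: intg_chi; exact: sqi_intg.
have u0 s : 0 <= s -> s < T -> prim T u 0 s = 0.
  rewrite le_eqVlt => /orP[/eqP <- _|s0 sT].
    rewrite -[RHS](rint0 I); congr rint; apply/funext => x.
    by rewrite /chi; case: ltP => //= x0; rewrite ?mulr0// [x < 0]ltNge (ltW x0) mulr0.
  have i1 := intg_chi 0 s (sqi_intg sa); have i2 := intgZ A0 (ichi 0 s).
  transitivity (rint I (fun x => a x * chi 0 s x - A0 * chi 0 s x - prim T p 0 x * chi 0 s x)).
    congr rint; apply/funext => x; rewrite /u /chi.
    have [/andP[x0 xs]|] := boolP (0 < x < s); last by rewrite !mulr0 !subrr.
    by rewrite x0 (lt_trans xs sT) /= !mulr1.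
  rewrite rintB//; last exact: intgB.
  rewrite rintB// -/(prim T a 0 s) h// rintZ// rint_chi//; try exact: ltW.
  by rewrite rint_prim_chi//; try exact: ltW; ring.
have uT s : 0 <= s -> s <= T -> prim T u 0 s = 0.
  move=> s0; rewrite le_eqVlt => /orP[/eqP ->|]; last exact: u0.
  apply/esym; apply: (cvg_unique _ _ (@prim_cvg_end u T iu)) => //.
  apply: cvg_near_cst.
  have h0 : @harmonic R n @[n --> \oo] --> 0 := cvg_harmonic.
  have /cvgrPdist_lt/(_ _ T0) := h0; apply: filterS => n.
  rewrite sub0r normrN gtr0_norm ?harmonic_gt0// => hx.
  by rewrite u0// ?subr_ge0 ?(ltW hx)// ltrBlDr ltrDl harmonic_gt0.
have /(intervals_ae0 T0 iu) hu : forall s t, 0 <= s -> s < t -> t <= T ->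
    rint I (fun x => u x * (s < x < t)%R%:R) = 0.
  move=> s t s0 st tT; have := prim_sub iu s0 st.
  by rewrite !uT ?subrr// ?(le_trans s0 (ltW st))// (le_trans (ltW st) tT).
have hT := @interval_aeT _ T (fun t => 0 <= t /\ t < T) (fun t t0 tT => conj t0 tT).
have hT2 : \forall t \ae I, chi 0 T t = 1 :> R.
  apply: filterS2 hT (interval_ae_neq T 0) => t [t0 tT] /eqP tn0.
  by rewrite /chi tT lt_neqAle eq_sym tn0 t0.
have FF : Filter (almost_everywhere I) by exact: ae_filter_ringOfSetsType.
apply: filterS2 hT2 hu => x; rewrite /u => -> /eqP; rewrite !mulr1 -addrA -opprD subr_eq0.
by move/eqP.
Qed.

End du_bois_reymond.

Section ramp.
Context (R : realType).
Implicit Types (s t x : R).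

(* A smooth approximation of the positive part of s - t. *)
Definition ramp n s t := (s - t) * flat 0 (n.+1%:R * (s - t)).

Lemma flat_bnd k x : (k <= 1)%N -> `|flat k x| <= 1.
Proof.
move=> k1; rewrite /flat; case: ifPn => [x0|_]; last by rewrite normr0.
have i0 : 0 < x^-1 by rewrite invr_gt0.
rewrite ger0_norm; last by rewrite mulr_ge0 ?expR_ge0 ?exprn_ge0 ?ltW.
rewrite expRN ler_pdivrMr ?expR_gt0// mul1r (le_trans _ (expR_ge1Dx _))//.
by case: k k1 => [|[|//]] _; rewrite ?expr0 ?expr1 ?lerDl ?lerDr// ltW.
Qed.

Lemma is_derive_ramp n s t :
  is_derive t 1 (ramp n s) (- (flat 0 (n.+1%:R * (s - t)) + flat 1 (n.+1%:R * (s - t)))).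
Proof.
have d1 : is_derive t 1 (fun t => s - t) (-1).
  by apply: is_derive_line => h; rewrite /GRing.scale/=; ring.
have d2 : is_derive t 1 (fun t => n.+1%:R * (s - t)) (- n.+1%:R).
  by apply: is_derive_line => h; rewrite /GRing.scale/=; ring.
have d3 := @is_derive_comp_real _ _ (@flat R 0) (fun t => n.+1%:R * (s - t)) t 1 _ _
    (is_derive_flat 0 _) d2.
have := is_deriveM d1 d3; rewrite -[_ * _]/(ramp n s).
suff -> : (s - t) *: ((flat 2 (n.+1%:R * (s - t)) - 0 * flat 1 (n.+1%:R * (s - t))) * - n.+1%:R) +
    flat 0 (n.+1%:R * (s - t)) *: (-1) =
    - (flat 0 (n.+1%:R * (s - t)) + flat 1 (n.+1%:R * (s - t))) by [].
rewrite /GRing.scale/= mul0r subr0.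
(* x [flat 2 x] = [flat 1 x]: the factor n + 1 of the inner derivative is absorbed by s - t. *)
have <- : n.+1%:R * (s - t) * flat 2 (n.+1%:R * (s - t)) = flat 1 (n.+1%:R * (s - t)).
  rewrite /flat; case: ifPn => [y0|_]; last by rewrite mulr0.
  by rewrite mulrA exprS mulrA mulfV ?mul1r// gt_eqF.
by ring.
Qed.

Lemma flat_cvg k x : (k <= 1)%N ->
  flat k (n.+1%:R * x) @[n --> \oo] --> (((0 < x) && (k == 0%N))%:R : R).
Proof.
move=> k1; have [x0|x0] := ltP 0 x; last first.
  apply: cvg_near_cst; near=> n; rewrite /flat ifF//.
  by apply/negbTE; rewrite -leNgt mulr_ge0_le0.
have h0 : @harmonic R n * x^-1 @[n --> \oo] --> 0.
  by rewrite -[X in _ --> X](mul0r x^-1); apply: cvgM; [exact: cvg_harmonic|exact: cvg_cst].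
have E n : flat k (n.+1%:R * x) = (harmonic n * x^-1) ^+ k * expR (- (harmonic n * x^-1)).
  by rewrite /flat mulr_gt0// invfM.
under eq_cvg do rewrite E.
have -> : (true && (k == 0%N))%:R = (0 : R) ^+ k * expR (- 0) :> R.
  by rewrite oppr0 expR0 mulr1 expr0n.
apply: cvgM; first exact: (cvg_comp _ _ h0 (@exprn_continuous R k 0)).
by apply: continuous_cvg; [exact: continuous_expR|exact: cvgN].
Unshelve. all: by end_near. Qed.

Lemma measurable_flat k : measurable_fun [set: measurableTypeR R] (@flat R k).
Proof. by apply: continuous_measurable_fun; exact: continuous_flat. Qed.

Lemma measurable_flat_affine k n s :
  measurable_fun [set: measurableTypeR R] (fun t => flat k (n.+1%:R * (s - t))).
Proof.
apply: (measurableT_comp (@measurable_flat k)).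
by apply: measurable_funM => //; exact: measurable_funB.
Qed.

Lemma measurable_ramp n s : measurable_fun [set: measurableTypeR R] (ramp n s).
Proof.
apply: measurable_funM; first exact: measurable_funB.
exact: measurable_flat_affine.
Qed.

Variable T : R.
Local Notation I := (interval_measure T).

Let interval_ae_in : \forall t \ae I, 0 < t < T.
Proof.
have hT := @interval_aeT _ T (fun t => 0 <= t /\ t < T) (fun t h1 h2 => conj h1 h2).
have FF : Filter (almost_everywhere I) by exact: ae_filter_ringOfSetsType.
apply: filterS2 hT (interval_ae_neq T 0) => t [t0 tT] /eqP tn0.
by rewrite tT lt_neqAle eq_sym tn0 t0.
Qed.

(** On ]0, T[, [ramp n s] tends to the positive part of s - t, and the sum of the two [flat] terms,
    which is minus its derivative, to the indicator of t < s, both boundedly. *)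
Lemma ramp_limit (a p : measurableTypeR R -> R) A0 s : 0 < s -> s < T ->
  sqi I a -> sqi I p ->
  (forall n, rint I (fun t => a t * (flat 0 (n.+1%:R * (s - t)) + flat 1 (n.+1%:R * (s - t)))) =
    ramp n s 0 * A0 + rint I (fun t => p t * ramp n s t)) ->
  prim T a 0 s = s * A0 + rint I (fun t => p t * ((s - t) * chi 0 s t)).
Proof.
move=> s0 sT sa sp h; have ma := sqi_measurable sa; have mp := sqi_measurable sp.
have FF : Filter (almost_everywhere I) by exact: ae_filter_ringOfSetsType.
have l1 : rint I (fun t => a t * (flat 0 (n.+1%:R * (s - t)) + flat 1 (n.+1%:R * (s - t))))
    @[n --> \oo] --> prim T a 0 s.
  apply: (@rdct _ _ _ I _ _ (fun x => 2 * `|a x|) _ _ _ _ _).2 => //.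
  - move=> n; apply: measurable_funM => //.
    by apply: measurable_funD; exact: measurable_flat_affine.
  - exact: intg_measurable (intg_chi _ _ (sqi_intg sa)).
  - apply: filterS interval_ae_in => t /andP[t0 tT].
    apply: cvgM; first exact: cvg_cst.
    have -> : chi 0 s t = ((0 < s - t) && true)%:R + ((0 < s - t) && false)%:R.
      by rewrite /chi t0 andbT andbF addr0 subr_gt0.
    by apply: cvgD; exact: flat_cvg.
  - by apply: intgZ; apply: intg_norm; exact: sqi_intg.
  - move=> n; apply: aeW => t; rewrite normrM mulrC ler_wpM2r//.
    by rewrite (le_trans (ler_normD _ _))// (natrD _ 1 1) lerD// flat_bnd.
have l2 : rint I (fun t => p t * ramp n s t) @[n --> \oo] -->
    rint I (fun t => p t * ((s - t) * chi 0 s t)).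
  apply: (@rdct _ _ _ I _ _ (fun x => T * `|p x|) _ _ _ _ _).2 => //.
  - by move=> n; apply: measurable_funM => //; exact: measurable_ramp.
  - apply: measurable_funM => //; apply: measurable_funM; first exact: measurable_funB.
    exact: measurable_chi1.
  - apply: filterS interval_ae_in => t /andP[t0 tT].
    apply: cvgM; first exact: cvg_cst.
    apply: cvgM; first exact: cvg_cst.
    have -> : chi 0 s t = ((0 < s - t) && true)%:R.
      by rewrite /chi t0 andbT subr_gt0.
    exact: flat_cvg.
  - by apply: intgZ; apply: intg_norm; exact: sqi_intg.
  - move=> n; apply: filterS interval_ae_in => t /andP[t0 tT].
    rewrite normrM mulrC ler_wpM2r// normrM -[leRHS]mulr1 ler_pM ?flat_bnd//.
    by rewrite ler_norml; apply/andP; split; lra.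
have l3 : ramp n s 0 @[n --> \oo] --> s.
  rewrite -[X in _ --> X]mulr1 /ramp; under eq_cvg do rewrite subr0.
  apply: cvgM; first exact: cvg_cst.
  by have := @flat_cvg 0 s isT; rewrite s0.
have l4 : ramp n s 0 * A0 + rint I (fun t => p t * ramp n s t) @[n --> \oo] -->
    s * A0 + rint I (fun t => p t * ((s - t) * chi 0 s t)).
  by apply: cvgD => //; apply: cvgM => //; exact: cvg_cst.
move: l1; under eq_cvg do rewrite h.
by move=> l1; exact: (cvg_unique _ l1 l4).
Qed.

End ramp.

Section cas_derive.
Context (R : realType).

Definition dcas (j : int) (x : R) : R :=
  - (Num.sqrt (2 / 1) * (j%:~R * (2 * pi / 1))) * sin (j%:~R * (2 * pi / 1) * x + - (pi / 4)).

Lemma is_derive_cas j (x : R) : is_derive x 1 (cas 1 j : R -> R) (dcas j x).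
Proof.
rewrite /cas /dcas; set a := _%:~R * _; set b := - (pi / 4); set q := Num.sqrt _.
have h := is_derive_affine (is_derive_cos (a * x + b)).
have := is_deriveZ q h; rewrite /GRing.scale/=.
by have -> : q * (a * - sin (a * x + b)) = - (q * a) * sin (a * x + b) by ring.
Qed.

Lemma is_derive_dcas j (x : R) :
  is_derive x 1 (dcas j) (- (2 * pi * j%:~R) ^+ 2 * cas 1 j x).
Proof.
rewrite /cas /dcas; set a := _%:~R * _; set b := - (pi / 4); set q := Num.sqrt _.
have h := is_derive_affine (is_derive_sin (a * x + b)).
have := is_deriveZ (- (q * a)) h; rewrite /GRing.scale/=.
have -> : - (q * a) * (a * cos (a * x + b)) =
  - (2 * pi * j%:~R) ^+ 2 * (q * cos (a * x + b)); last by [].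
by rewrite /a divr1; ring.
Qed.

Lemma cas_periodic j (x : R) : cas 1 j (x + 1) = cas 1 j x.
Proof.
rewrite /cas; congr (_ * _); rewrite -!sinDpihalf.
rewrite -[RHS](sin_int_period j); congr sin; rewrite divr1; ring.
Qed.

End cas_derive.

(** * The test functions *)

Section test_fun.
Context (R : realType) (N : nat).
Local Notation V := (R * 'rV[R]_N)%type.
Implicit Types (p v : V) (k : N.-tuple int).

(** The exponential performs on the test function the change of unknown w = e^(-K t) z; the ramp
    vanishes for t >= s, which makes the support compact in [0, T[; the product over the coordinates
    is an eigenfunction of the Laplacian. *)
Definition test_fun (K s : R) n k : V -> R := fun p =>
  (expR (- K * p.1) * ramp n s p.1) * \prod_(i < N) cas 1 (tnth k i) (p.2 0 i).

Lemma elem_eq (f g : V -> R) : f =1 g -> elementary f -> elementary g.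
Proof. by move=> /funext ->. Qed.

Lemma elem_fst : elementary (fun p => p.1).
Proof. by apply: elem_lin => // p; exact: cvg_fst. Qed.

Lemma elem_coord i : elementary (fun p => p.2 0 i).
Proof.
apply: elem_lin => [s v x|p]; first by rewrite !mxE.
by apply: (@continuous_comp _ _ _ snd (fun M : 'rV[R]_N => M 0 i)); [exact: cvg_snd|exact: coord_continuous].
Qed.

Lemma elementary_test_fun K s n k : elementary (test_fun K s n k).
Proof.
have es : elementary (fun p => s - p.1).
  apply: (@elem_eq (fun p => s + (- 1) * p.1)) => [p|]; first by rewrite mulN1r.
  apply: elem_add; first exact: elem_cst.
  by apply: elem_mul; [exact: elem_cst|exact: elem_fst].
apply: elem_mul.
  apply: elem_mul.
    by apply: elem_exp; apply: elem_mul; [exact: elem_cst|exact: elem_fst].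
  apply: elem_mul => //; apply: elem_flat.
  by apply: elem_mul => //; exact: elem_cst.
apply: elem_prod => i; apply: elem_mul; first exact: elem_cst.
apply: elem_cos; apply: elem_add; last exact: elem_cst.
by apply: elem_mul; [exact: elem_cst|exact: elem_coord].
Qed.

Lemma test_fun_test (T K s : R) n k : 0 < s -> s < T -> test_function T (test_fun K s n k).
Proof.
move=> s0 sT; split.
- exact: elementary_smooth (elementary_test_fun _ _ _ _).
- move=> t x i; congr (_ * _); apply: eq_bigr => j _ /=.
  rewrite !mxE eqxx /=; have [->|ji] := eqVneq j i; first by rewrite cas_periodic.
  by rewrite addr0.
- exists `[0, s]%classic.
    split; first exact: segment_compact.
    move=> t /=; rewrite !in_itv /= => /andP[-> ts].
    exact: le_lt_trans ts sT.
  move=> t x /=; rewrite !in_itv /= => /andP[t0 tT] /negP; rewrite t0 /= -ltNge => st.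
  rewrite /test_fun /= /ramp /flat ifF ?mulr0 ?mul0r//.
  by apply/negbTE; rewrite -leNgt mulr_ge0_le0// subr_le0 ltW.
Qed.

(** Along v only one factor varies: [l] grows at unit speed and [G] is constant. *)
Lemma derive_line (h : R -> R) (l G : V -> R) v p dh :
  (forall (s : R) x, l (s *: v + x) = s + l x) -> (forall (s : R) x, G (s *: v + x) = G x) ->
  is_derive (l p) 1 h dh -> 'D_v (fun q => h (l q) * G q) p = dh * G p.
Proof.
move=> hl hG hd.
have dl : is_derive p v l 1 by apply: is_derive_line => s; rewrite hl mulr1.
have dG : is_derive p v G 0 by apply: is_derive_line => s; rewrite hG mulr0 add0r.
have [_ E] := is_deriveM (is_derive_comp_real hd dl) dG.
by apply: etrans E _; rewrite /GRing.scale/= mulr0 add0r mulr1 mulrC.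
Qed.

Lemma dt_test_fun K s n k p : dt (test_fun K s n k) p =
  expR (- K * p.1) * (- (flat 0 (n.+1%:R * (s - p.1)) + flat 1 (n.+1%:R * (s - p.1)))
     - K * ramp n s p.1) * \prod_(i < N) cas 1 (tnth k i) (p.2 0 i).
Proof.
have dE : is_derive p.1 1 (fun t => expR (- K * t)) (expR (- K * p.1) * - K).
  have dK : is_derive p.1 1 (fun t => - K * t) (- K).
    by apply: is_derive_line => h; rewrite /GRing.scale/=; ring.
  exact: (@is_derive_comp_real _ _ expR (fun t => - K * t) _ 1 _ _ (is_derive_expR _) dK).
have dR := is_deriveM dE (is_derive_ramp n s p.1).
rewrite /dt /test_fun (derive_line (l := fun q => q.1) _ _ dR) /=.
- by rewrite /GRing.scale/=; congr (_ * _); ring.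
- by move=> h x; rewrite /GRing.scale/= mulr1.
- by move=> h x; apply: eq_bigr => i _; rewrite scaler0 add0r.
Qed.

Lemma laplacian_test_fun K s n k p :
  laplacian (test_fun K s n k) p = - torus_eig R k * test_fun K s n k p.
Proof.
rewrite /laplacian /torus_eig -sumrN mulr_suml; apply: eq_bigr => i _.
pose G (q : V) : R := (expR (- K * q.1) * ramp n s q.1) *
  \prod_(j < N | j != i) cas 1 (tnth k j) (q.2 0 j).
have GE (q : V) : G q = (expR (- K * q.1) * ramp n s q.1) *
  \prod_(j < N | j != i) cas 1 (tnth k j) (q.2 0 j) by [].
have hG (h : R) (x : V) : G (h *: (0, delta_mx 0 i) + x) = G x.
  rewrite !GE /= scaler0 add0r; congr (_ * _); apply: eq_bigr => j ji.
  by rewrite !mxE eqxx /= (negbTE ji) mulr0 add0r.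
have hl (h : R) (x : V) : (h *: ((0, delta_mx 0 i) : V) + x).2 0 i = h + x.2 0 i.
  by rewrite !mxE !eqxx mulr1.
have E : test_fun K s n k = fun q => cas 1 (tnth k i) (q.2 0 i) * G q.
  by apply/funext => q; rewrite GE /test_fun (bigD1 i)//= mulrCA.
have E1 : dx (test_fun K s n k) i = fun q => dcas (tnth k i) (q.2 0 i) * G q.
  apply/funext => q; rewrite /dx E.
  exact: (derive_line hl hG (is_derive_cas _ _)).
rewrite E1 /dx (derive_line hl hG (is_derive_dcas _ _)) E.
exact/esym/mulrA.
Qed.

End test_fun.

Lemma opp_balance (R : realFieldType) (a b c r l : R) :
  - (- a - b - c) = r + (b - l) -> a = r - c - l.
Proof. by move=> h; lra. Qed.

Section ae.
Context d (X : measurableType d) (R : realType) (mu : {measure set X -> \bar R}).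
Variables P P' : X -> Prop.

Lemma ae_imp : (\forall x \ae mu, P x) -> (forall x, P x -> P' x) ->
  \forall x \ae mu, P' x.
Proof. by move=> hP PP'; apply: filterS hP. Qed.

Lemma ae_and : (\forall x \ae mu, P x) -> (\forall x \ae mu, P' x) ->
  \forall x \ae mu, P x /\ P' x.
Proof. by move=> hP hP'; exact: filterI. Qed.

End ae.

Lemma rint_ae_imp d (X : measurableType d) (R : realType) (mu : {measure set X -> \bar R})
    (P : X -> Prop) (f g : X -> R) :
  (\forall x \ae mu, P x) -> (forall x, P x -> f x = g x) ->
  measurable_fun setT f -> measurable_fun setT g -> rint mu f = rint mu g.
Proof.
by move=> hP fg mf mg; apply: rint_ae => //; exact: ae_imp hP fg.
Qed.

(** * The equation of each mode *)

Section weak_form.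
Context (R : realType) (T : R) (N : nat).
Hypothesis T0 : 0 < T.
Local Notation m := (torus_measure R N).
Local Notation I := (interval_measure T).
Local Notation Q := (finite_prod I m).
Local Notation e := (enum_basis (@torus_cas R N)).
Local Notation lam := (enum_eig R N).
Local Notation mode := (mode m e).
Let he : hilbert_basis m e := enum_basisP (torus_cas_basis R N).

Variables (K : R) (mu Rc z w g f : spacetime R N -> R) (z0 : torus R N -> R).
Hypotheses (mmu : measurable_fun setT mu) (mRc : measurable_fun setT Rc).
Hypotheses (mz : measurable_fun setT z) (sz0 : sqi m z0).
Hypotheses (sw : sqi Q w) (sg : sqi Q g) (sf : sqi Q f).
Hypothesis wE : \forall p \ae Q, expR (- K * p.1) * z p = w p.
Hypothesis gE : \forall p \ae Q, mu p * w p = g p.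
Hypothesis fE : \forall p \ae Q, (K - Rc p) * w p = f p.
Hypothesis sol : is_solution T mu (fun p => Rc p * z p) z0 z.

Let bump j s t : R := flat 0 (j.+1%:R * (s - t)) + flat 1 (j.+1%:R * (s - t)).
(* [ramp] is unbounded as t tends to -oo, whereas [rint_mode] wants a bounded
   function of time. *)
Let cut j s t : R := ramp j s t * (0 <= t)%R%:R.

Let measurable_bump j s : measurable_fun [set: measurableTypeR R] (bump j s).
Proof. by apply: measurable_funD; exact: measurable_flat_affine. Qed.

Let bump_bnd j s t : `|bump j s t| <= 2.
Proof. by rewrite (le_trans (ler_normD _ _))// (natrD _ 1 1) lerD// flat_bnd. Qed.

Let measurable_cut j s : measurable_fun [set: measurableTypeR R] (cut j s).
Proof.
apply: measurable_funM; first exact: measurable_ramp.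
apply: (measurableT_comp (f := fun b : bool => b%:R : R)) => //.
exact: measurable_fun_ler.
Qed.

Let cut_bnd j s t : `|cut j s t| <= `|s|.
Proof.
rewrite /cut /ramp; have [t0|t0] := leP 0 t; last by rewrite mulr0 normr0.
rewrite mulr1; have [st|st] := ltP t s; last first.
  rewrite /flat ifF ?mulr0 ?normr0//; apply/negbTE.
  by rewrite -leNgt mulr_ge0_le0// subr_le0.
rewrite normrM -[leRHS]mulr1 ler_pM ?flat_bnd//.
by rewrite !ger0_norm ?subr_ge0 ?(ltW st)// ?lerBlDr ?lerDl// (le_trans t0 (ltW st)).
Qed.

Let ae_time : \forall t \ae I, 0 <= t.
Proof. exact: interval_aeT. Qed.

Let rint_ramp p j s : sqi I p ->
  rint I (fun t => p t * ramp j s t) = rint I (fun t => p t * cut j s t).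
Proof.
move=> [mp _]; apply: rint_ae.
- by apply: measurable_funM => //; exact: measurable_ramp.
- by apply: measurable_funM => //; exact: measurable_cut.
by apply: (ae_imp ae_time) => t t0; rewrite /cut t0 mulr1.
Qed.

Section mode.
Variables (n : nat) (k : N.-tuple int).
Hypothesis nk : pickle_inv n = Some k.

Let eE : e n = torus_cas k. Proof. by rewrite /enum_basis nk. Qed.
Let lamE : lam n = torus_eig R k. Proof. by rewrite /enum_eig nk. Qed.

Let test j s p : test_fun K s j k (to_row_st p) =
  expR (- K * p.1) * ramp j s p.1 * e n p.2.
Proof. by rewrite eE; congr (_ * _); apply: eq_bigr => i _; rewrite mxE. Qed.

Let sqb (b : measurableTypeR R -> R) (M : R) :
  measurable_fun [set: measurableTypeR R] b -> (forall t, `|b t| <= M) ->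
  sqi Q (fun p => b p.1 * e n p.2).
Proof.
move=> mb bM; have [C C0 hC] := basis_bnd he n.
have M0 : 0 <= M := le_trans (normr_ge0 _) (bM 0).
apply: (@sqi_bnd _ _ _ _ _ (M * C)); last by move=> p; rewrite normrM ler_pM.
apply: measurable_funM; first exact: measurableT_comp.
by apply: measurableT_comp => //; exact: measurable_basis he n.
Qed.

(** Tested with [test_fun], the derivative of the exponential produces a term in K w, which cancels
    the one contained in e^(-K t) R z = K w - f. *)
Let weak_mode j s : 0 < s -> s < T ->
  rint Q (fun p => w p * (bump j s p.1 * e n p.2)) = ramp j s 0 * ip m z0 (e n) -
  lam n * rint Q (fun p => g p * (cut j s p.1 * e n p.2)) -
  rint Q (fun p => f p * (cut j s p.1 * e n p.2)).
Proof.
move=> s0 sT; have [_ _ /(_ _ (test_fun_test K j k s0 sT))] := sol.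
have sB := sqb (measurable_bump j s) (bump_bnd j s).
have sC := sqb (measurable_cut j s) (cut_bnd j s).
have iB : intg Q (fun p => w p * (bump j s p.1 * e n p.2)) := sqi_intgM sw sB.
have iw : intg Q (fun p => w p * (cut j s p.1 * e n p.2)) := sqi_intgM sw sC.
have ig : intg Q (fun p => g p * (cut j s p.1 * e n p.2)) := sqi_intgM sg sC.
have if_ : intg Q (fun p => f p * (cut j s p.1 * e n p.2)) := sqi_intgM sf sC.
have ae : \forall p \ae Q, expR (- K * p.1) * z p = w p /\ 0 <= p.1.
  exact: ae_and wE (ae_fst m ae_time).
have aeg : \forall p \ae Q,
    (expR (- K * p.1) * z p = w p /\ 0 <= p.1) /\ mu p * w p = g p by exact: ae_and.
have aef : \forall p \ae Q,
    (expR (- K * p.1) * z p = w p /\ 0 <= p.1) /\ (K - Rc p) * w p = f p by exact: ae_and.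
have mfst (h : measurableTypeR R -> R) : measurable_fun setT h ->
  measurable_fun setT (fun p : spacetime R N => h p.1) by move=> mh; exact: measurableT_comp.
have mE : measurable_fun setT (fun p : spacetime R N => expR (- K * p.1)).
  apply: (mfst (fun t => expR (- K * t))); apply: continuous_measurable_fun => t.
  apply: continuous_comp; last exact: continuous_expR.
  by apply: cvgM; [exact: cvg_cst|exact: cvg_id].
have men : measurable_fun setT (fun p : spacetime R N => e n p.2).
  by apply: measurableT_comp => //; exact: measurable_basis he n.
have mr := mfst _ (@measurable_ramp R j s); have mb := mfst _ (measurable_bump j s).
have E1 : rint Q (fun p => z p * (dt (test_fun K s j k) (to_row_st p)
      + mu p * laplacian (test_fun K s j k) (to_row_st p))) =
    - rint Q (fun p => w p * (bump j s p.1 * e n p.2)) -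
    K * rint Q (fun p => w p * (cut j s p.1 * e n p.2)) -
    lam n * rint Q (fun p => g p * (cut j s p.1 * e n p.2)).
  have i3 := intgZ K iw; have i4 := intgZ (lam n) ig; have i5 := intgN iB.
  have i6 := intgB i5 i3.
  rewrite -rintN// -!rintZ// -rintB// -rintB//.
  have EE : (fun p => z p * (dt (test_fun K s j k) (to_row_st p)
      + mu p * laplacian (test_fun K s j k) (to_row_st p))) =
    (fun p => z p * (expR (- K * p.1) * (- bump j s p.1 - K * ramp j s p.1) * e n p.2
       + mu p * (- lam n * (expR (- K * p.1) * ramp j s p.1 * e n p.2)))).
    apply/funext => p; rewrite laplacian_test_fun test -lamE dt_test_fun.
    congr (_ * (_ * _ + _)); rewrite eE.
    by apply: eq_bigr => i _; rewrite mxE.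
  rewrite EE; apply: (rint_ae_imp aeg).
  - by move=> p [[wp tp] gp]; rewrite -gp -wp /cut tp mulr1; ring.
  - apply: measurable_funM => //; apply: measurable_funD.
      apply: measurable_funM => //; apply: measurable_funM => //.
      apply: measurable_funB; first exact: measurableT_comp.
      exact: measurable_funM.
    apply: measurable_funM => //; apply: measurable_funM => //.
    by apply: measurable_funM => //; exact: measurable_funM.
  - exact: intg_measurable (intgB i6 i4).
have E2 : rint m (fun x => z0 x * test_fun K s j k (0, to_row x)) =
    ramp j s 0 * ip m z0 (e n).
  rewrite -rintZ; last by apply: sqi_intgM => //; exact: basis_sqi.
  congr rint; apply/funext => x.
  have := test j s (0, x); rewrite /to_row_st /= => ->.
  by rewrite mulr0 expR0; ring.
have E3 : rint Q (fun p => Rc p * z p * test_fun K s j k (to_row_st p)) =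
    K * rint Q (fun p => w p * (cut j s p.1 * e n p.2)) -
    rint Q (fun p => f p * (cut j s p.1 * e n p.2)).
  have i3 := intgZ K iw.
  rewrite -rintZ// -rintB//.
  under eq_fun do rewrite test.
  apply: (rint_ae_imp aef).
  - by move=> p [[wp tp] fp]; rewrite -fp -wp /cut tp mulr1; ring.
  - apply: measurable_funM => //; first exact: measurable_funM.
    by apply: measurable_funM => //; exact: measurable_funM.
  - exact: intg_measurable (intgB i3 if_).
rewrite -[LHS]/(- rint Q _) E1 -[RHS]/(rint m _ + rint Q _) E2 E3.
exact: opp_balance.
Qed.

(** The limit of the ramps gives the equation integrated once more in time; du Bois-Reymond's lemma
    removes this integration. *)
Lemma solution_mode : \forall t \ae I, mode w n t =
  ip m z0 (e n) - lam n * prim T (mode g n) 0 t - prim T (mode f n) 0 t.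
Proof.
have smw := sqi_mode he n sw; have smg := sqi_mode he n sg; have smf := sqi_mode he n sf.
have sp := sqiB (sqiZ (- lam n) smg) smf.
have := @du_bois_reymond _ T (mode w n) _ (ip m z0 (e n)) T0 smw sp.
have H : forall s, 0 < s -> s < T -> prim T (mode w n) 0 s = s * ip m z0 (e n) +
    rint I (fun t => (- lam n * mode g n t - mode f n t) * ((s - t) * chi 0 s t)).
  move=> s s0 sT; apply: ramp_limit => // j.
  rewrite (rint_mode he n sw (measurable_bump j s) (bump_bnd j s)) weak_mode//.
  rewrite rint_ramp// -addrA; congr (_ + _).
  have [c1 c2] := (measurable_cut j s, cut_bnd j s).
  have ig := intgM (sqi_intg smg) c1 c2; have if_ := intgM (sqi_intg smf) c1 c2.
  rewrite -(rint_mode he n sg c1 c2) -(rint_mode he n sf c1 c2).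
  have i3 := intgZ (- lam n) ig.
  rewrite -mulNr -rintZ// -rintB//; congr rint; apply/funext => t; ring.
move=> /(_ H) h; apply: (ae_imp h) => t ->.
have i1 := intg_chi 0 t (sqi_intg smg); have i2 := intg_chi 0 t (sqi_intg smf).
have i3 := intgZ (- lam n) i1.
rewrite -addrA; congr (_ + _); rewrite /prim -mulNr -rintZ// -rintB//.
by congr rint; apply/funext => x; ring.
Qed.

End mode.

Lemma solution_evolves : evolves T m e lam z0 w g f.
Proof.
move=> n; case nk : (@pickle_inv (N.-tuple int) n) => [k|]; first exact: solution_mode nk.
(* At an index that enumerates no frequency, every term of the equation is 0. *)
have e0 : e n = fun=> 0 by rewrite /enum_basis nk.
have m0 h : mode h n = fun=> 0.
  by apply/funext => t; rewrite -[LHS]/(ip m _ (e n)) e0 ip_cst0.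
have p0 t : prim T (fun=> 0) 0 t = 0.
  by rewrite -[RHS](rint0 I); congr rint; apply/funext => x; rewrite mul0r.
by apply: aeW => t; rewrite !m0 !p0 e0 ip_cst0 mulr0 !subr0.
Qed.

End weak_form.

(** * Lebesgue norms and truncations *)

Section norms.
Context d (X : measurableType d) (R : realType).
Variable mu : {finite_measure set X -> \bar R}.
Implicit Types f : X -> R.

Lemma Lfun_measurable p f : f \in Lfun mu p -> measurable_fun setT f.
Proof. by move=> /sub_Lfun_mfun; rewrite inE. Qed.

Lemma Lfun2_sqi f : f \in Lfun mu 2%:E -> sqi mu f.
Proof. by move=> hf; split; [exact: Lfun_measurable hf|exact: Lfun2_integrable_sqr]. Qed.

Lemma Lnorm2_sqi f : sqi mu f -> 'N[mu]_2%:E [EFin \o f]%E = (Num.sqrt (nrm2 mu f))%:E.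
Proof.
move=> [mf f2]; rewrite unlock /=.
have -> : (\int[mu]_x `|(f x)%:E| `^ 2 = (nrm2 mu f)%:E)%E.
  rewrite /nrm2 ip_sqr rintE//; apply: eq_integral => x _.
  by rewrite abse_EFin poweR_EFin powR_mulrn// real_normK ?num_real.
by rewrite poweR_EFin powR12_sqrt// ip_ge0.
Qed.

Lemma sqi_Lfun2 f : sqi mu f -> f \in Lfun mu 2%:E.
Proof.
move=> sf; have := sf => -[mf _]; rewrite inE; apply/andP; split; rewrite inE//=.
by rewrite /finite_norm Lnorm2_sqi// ltry.
Qed.

Lemma Lnorm2_le f M : sqi mu f -> ('N[mu]_2%:E [EFin \o f] <= M%:E)%E ->
  nrm2 mu f <= M ^+ 2.
Proof.
move=> sf; rewrite Lnorm2_sqi// lee_fin => fM.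
rewrite -[leLHS](sqr_sqrtr (ip_ge0 mu f)) lerXn2r ?nnegrE ?sqrtr_ge0//.
exact: le_trans (sqrtr_ge0 _) fM.
Qed.

Lemma Lnorm2_cvg0 (fn : nat -> X -> R) : (forall n, sqi mu (fn n)) ->
  nrm2 mu (fn n) @[n --> \oo] --> 0 ->
  'N[mu]_2%:E [EFin \o fn n]%E @[n --> \oo] --> 0%E.
Proof.
move=> sf f0; under eq_cvg do rewrite Lnorm2_sqi//.
apply: cvg_EFin; first exact: nearW.
rewrite -[X in _ --> X](@sqrtr0 R).
by apply: continuous_cvg => //; exact: sqrt_continuous.
Qed.

Lemma Lfuny_bnd f : f \in Lfun mu +oo%E -> exists M, \forall x \ae mu, `|f x| <= M.
Proof.
move=> /sub_Lfun_finLfun; rewrite inE /= /finite_norm unlock; case: ifPn => [m0|].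
  by move=> h; apply: (@ess_supr_bounded _ _ _ mu (fun x => `|f x|)).
(* The total mass is 0: the norm carries no information, but every property holds almost
   everywhere. *)
rewrite -leNgt => m0 _; exists 0; exists setT; split => //.
by apply/eqP; rewrite eq_le m0 measure_ge0.
Qed.

Lemma Lnorm1_cvg0 (fn : nat -> X -> R) :
  'N[mu]_1%:E [EFin \o fn n]%E @[n --> \oo] --> 0%E ->
  rint mu (fun x => `|fn n x|) @[n --> \oo] --> 0.
Proof.
under eq_cvg do rewrite Lnorm1.
move=> /fine_cvgP[_]; apply: cvg_trans; apply: near_eq_cvg.
exact: nearW.
Qed.

End norms.

(** * Truncated representatives *)

Section clip.
Context (R : realDomainType).
Implicit Types a b x y : R.

Definition clip a b x := Num.max a (Num.min x b).

Lemma clip_ge a b x : a <= clip a b x.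
Proof. by rewrite le_max lexx. Qed.

Lemma clip_le a b x : a <= b -> clip a b x <= b.
Proof. by move=> ab; rewrite ge_max ab ge_min lexx orbT. Qed.

Lemma clip_id a b x : a <= x -> x <= b -> clip a b x = x.
Proof. by move=> ax xb; rewrite /clip min_l// max_r. Qed.

(** Only the cut from below can move y, and it moves it towards x. No upper bound on x is involved:
    the coefficients [mu n] have bounds that depend on n. *)
Lemma clip_dist a b x y : a <= x -> y <= b -> `|x - clip a b y| <= `|x - y|.
Proof.
move=> ax yb; rewrite /clip (min_l yb); have [ay|/ltW ya] := leP a y => //.
by rewrite !ger0_norm ?subr_ge0 ?lerB ?(le_trans ya).
Qed.

End clip.

Lemma measurable_clip d (X : measurableType d) (R : realType) (a b : R) (f : X -> R) :
  measurable_fun setT f -> measurable_fun setT (fun x => clip a b (f x)).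
Proof.
move=> mf; apply: (@measurable_maxr _ _ _ _ (fun=> a) (fun x => Num.min (f x) b)) => //.
exact: (@measurable_minr _ _ _ _ f (fun=> b)).
Qed.

Section exp_window.
Context (R : realType) (T : R).

(* Cut off outside [0, T[ to make it bounded on the whole line. *)
Definition exp_win (K t : R) : R := expR (K * t) * (0 <= t < T)%R%:R.

Lemma exp_win_bnd K t : `|exp_win K t| <= expR (`|K| * T).
Proof.
rewrite /exp_win; case: (boolP (0 <= t < T)) => [/andP[t0 tT]|_]; last first.
  by rewrite mulr0 normr0 expR_ge0.
rewrite mulr1 ger0_norm ?expR_ge0// ler_expR (le_trans (ler_norm _))//.
by rewrite normrM (ger0_norm t0) ler_wpM2l// ltW.
Qed.

Lemma measurable_exp_win K : measurable_fun [set: measurableTypeR R] (exp_win K).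
Proof.
apply: measurable_funM.
  apply: continuous_measurable_fun => t.
  apply: continuous_comp; last exact: continuous_expR.
  by apply: cvgM; [exact: cvg_cst|exact: cvg_id].
apply: (measurableT_comp (f := fun b : bool => b%:R : R)) => //.
by apply: measurable_and; [exact: measurable_fun_ler|exact: measurable_fun_ltr].
Qed.

Lemma exp_win_ge0 K t : 0 <= exp_win K t.
Proof. by rewrite mulr_ge0// expR_ge0. Qed.

Lemma exp_winE K t : 0 <= t -> t < T -> exp_win K t = expR (K * t).
Proof. by move=> t0 tT; rewrite /exp_win t0 tT mulr1. Qed.

End exp_window.

Lemma spacetime_ae_time (R : realType) (T : R) (N : nat) :
  \forall p \ae spacetime_measure T N, 0 <= p.1 /\ p.1 < T.
Proof.
have h := @interval_aeT _ T (fun t => 0 <= t /\ t < T) (fun t t0 tT => conj t0 tT).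
exact: (ae_fst (torus_measure R N) h).
Qed.

(** Signs and bounds are made valid everywhere by changing representatives: |z| for z, and
    truncations of mu and of K - R, all equal to the original functions almost everywhere. *)
Lemma solution_weak_evolution (R : realType) (T : R) (N : nat) (c K : R)
    (z0 : torus R N -> R) (mu Rc z : spacetime R N -> R) :
  let Q := spacetime_measure T N in
  0 < T -> 0 < c -> z0 \in Lfun (torus_measure R N) 2%:E -> mu \in Lfun Q +oo%E ->
  Rc \in Lfun Q +oo%E -> z \in Lfun Q 2%:E -> (\forall p \ae Q, 0 <= z p) ->
  (\forall p \ae Q, c <= mu p) -> (\forall p \ae Q, Rc p <= K) ->
  is_solution T mu (fun p => Rc p * z p) z0 z ->
  exists mu' f, [/\ weak_evolution T (torus_measure R N) (enum_basis (@torus_cas R N))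
      (enum_eig R N) z0 (fun p => exp_win T (- K) p.1 * `|z p|) mu' f,
    forall p, c <= mu' p & \forall p \ae Q, mu' p = mu p].
Proof.
move=> Q T0 c0 hz0 hmu hRc hz z_ge0 muc RcK sol.
have mmu := Lfun_measurable hmu; have mRc := Lfun_measurable hRc.
have mz := Lfun_measurable hz; have sz := Lfun2_sqi hz.
have [B hB] := Lfuny_bnd hmu; have [D hD] := Lfuny_bnd hRc.
pose w p := exp_win T (- K) p.1 * `|z p|.
pose mu' p := clip c (Num.max c B) (mu p).
pose f p := clip 0 (`|K| + `|D|) (K - Rc p) * w p.
have D0 : 0 <= `|K| + `|D| by exact: addr_ge0.
have cB : c <= Num.max c B by rewrite le_max lexx.
have mmu' : measurable_fun setT mu' by exact: measurable_clip.
have mf : measurable_fun setT (fun p => clip 0 (`|K| + `|D|) (K - Rc p)).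
  by apply: measurable_clip; exact: measurable_funB.
have time := spacetime_ae_time T N.
have saz : sqi Q (fun p => `|z p|).
  split; first exact: measurableT_comp.
  have [_] := sz; congr (intg _ _); apply/funext => p.
  by rewrite real_normK ?num_real.
have sw : sqi Q w.
  rewrite (_ : w = fun p => `|z p| * exp_win T (- K) p.1); last first.
    by apply/funext => p; rewrite mulrC.
  apply: (sqiM saz) (fun p => exp_win_bnd T (- K) p.1).
  exact: (measurableT_comp (measurable_exp_win T (- K))).
have w0 p : 0 <= w p by rewrite mulr_ge0// exp_win_ge0.
have sf : sqi Q f.
  rewrite (_ : f = fun p => w p * clip 0 (`|K| + `|D|) (K - Rc p)); last first.
    by apply/funext => p; rewrite mulrC.
  apply: (sqiM sw mf (M := `|K| + `|D|)) => p.
  by rewrite ger0_norm ?clip_ge// clip_le.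
have mu'0 p : 0 <= mu' p by exact: le_trans (ltW c0) (clip_ge _ _ _).
have mu'B p : mu' p <= Num.max c B by exact: clip_le.
have muE : \forall p \ae Q, mu' p = mu p.
  apply: (ae_imp (ae_and muc hB)) => p [h1 h2]; apply: clip_id => //.
  by rewrite le_max (le_trans (ler_norm _) h2) orbT.
have sg : sqi Q (fun p => mu' p * w p).
  rewrite (_ : (fun _ => _) = fun p => w p * mu' p); last first.
    by apply/funext => p; rewrite mulrC.
  by apply: (sqiM sw mmu' (M := Num.max c B)) => p; rewrite ger0_norm.
exists mu', f; split => //; last by move=> p; exact: clip_ge.
apply: WeakEvolution => //.
- exact: Lfun2_sqi.
- by move=> p; rewrite mulr_ge0// clip_ge.
- by exists (Num.max c B).
apply: (solution_evolves T0 mmu mRc mz (Lfun2_sqi hz0) sw sg sf _ _ _ sol).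
- by apply: (ae_imp (ae_and time z_ge0)) => p [[h1 h2] h3]; rewrite /w exp_winE// ger0_norm.
- by apply: (ae_imp muE) => p ->.
- apply: (ae_imp (ae_and RcK hD)) => p [h1 h2]; rewrite /f clip_id// ?subr_ge0//.
  rewrite (le_trans (ler_norm _))// (le_trans (ler_normB _ _))// lerD2l.
  by rewrite (le_trans h2)// ler_norm.
Qed.

Theorem lemma1 (R : realType) (T : R) (N : nat) (hT : 0 < T) (hN : (0 < N)%N)
    (z0 : nat -> torus R N -> R) (mu Rc z : nat -> spacetime R N -> R)
    (hz0 : forall n, z0 n \in Lfun (torus_measure R N) 2%:E)
    (hz0_ge0 : forall n, \forall x \ae torus_measure R N, 0 <= z0 n x)
    (hmu : forall n, mu n \in Lfun (spacetime_measure T N) +oo%E)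
    (hRc : forall n, Rc n \in Lfun (spacetime_measure T N) +oo%E)
    (hz : forall n, z n \in Lfun (spacetime_measure T N) 2%:E)
    (hz_ge0 : forall n, \forall p \ae spacetime_measure T N, 0 <= z n p)
    (hsol : forall n,
       is_solution T (mu n) (fun p => Rc n p * z n p) (z0 n) (z n))
    (hmu_inf : (0 < ereal_inf
       [set ess_inf (spacetime_measure T N) (EFin \o mu n) | n in [set: nat]])%E)
    (hRc_sup : (ereal_sup
       [set ess_sup (spacetime_measure T N) (EFin \o Rc n) | n in [set: nat]]
         < +oo)%E)
    (hz0_bnd : exists M : R, forall n,
       ('N[torus_measure R N]_2%:E [EFin \o z0 n] <= M%:E)%E)
    (hRc_bnd : exists M : R, forall n,
       ('N[spacetime_measure T N]_2%:E [EFin \o Rc n] <= M%:E)%E)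
    (hmu_cvg : exists s : nat -> nat, extraction s /\
       exists2 mulim : spacetime R N -> R,
         mulim \in Lfun (spacetime_measure T N) +oo%E &
         'N[spacetime_measure T N]_1%:E [EFin \o (mu (s k) \- mulim)%R]%E
           @[k --> \oo] --> 0%E) :
  exists s : nat -> nat, extraction s /\
    exists2 zlim : spacetime R N -> R,
      zlim \in Lfun (spacetime_measure T N) 2%:E &
      'N[spacetime_measure T N]_2%:E [EFin \o (z (s k) \- zlim)%R]%E
        @[k --> \oo] --> 0%E.
Proof.
have [c c0 muc] : exists2 c, 0 < c &
    forall n, \forall p \ae spacetime_measure T N, c <= mu n p.
  have [c c0 hc] : exists2 c : R, 0 < c & (c%:E <= ereal_inf
      [set ess_inf (spacetime_measure T N) (EFin \o mu n) | n in [set: nat]])%E.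
    move: hmu_inf; case: (ereal_inf _) => [r|_|//]; first by exists r.
    (* An infinite infimum admits any positive constant as lower bound. *)
    by exists 1 => //; rewrite leey.
  exists c => // n; have /ess_infP : (c%:E <= ess_inf (spacetime_measure T N) (EFin \o mu n))%E.
    by apply: le_trans hc _; apply: ereal_inf_lbound; exists n.
  by move=> h; apply: (ae_imp h) => p; rewrite /= lee_fin.
have [K RcK] : exists K, forall n, \forall p \ae spacetime_measure T N, Rc n p <= K.
  have [K hK] : exists K : R, (ereal_sup
      [set ess_sup (spacetime_measure T N) (EFin \o Rc n) | n in [set: nat]] <= K%:E)%E.
    move: hRc_sup; case: (ereal_sup _) => [r _|//|_]; first by exists r.
    by exists 0; rewrite leNye.
  exists K => n; have /ess_supP : (ess_sup (spacetime_measure T N) (EFin \o Rc n) <= K%:E)%E.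
    by apply: le_trans hK; apply: ereal_sup_ubound; exists n.
  by move=> h; apply: (ae_imp h) => p; rewrite /= lee_fin.
have [M hM] := hz0_bnd.
have [s0 [hs0 [mulim hmulim mu_cvg]]] := hmu_cvg.
pose Q := spacetime_measure T N.
have [B hB] := Lfuny_bnd hmulim.
(* Truncation makes the bounds on the limit hold everywhere, and [clip_dist] preserves the
   convergence. *)
pose mul p := clip c (Num.max c B) (mulim p).
pose w n p := exp_win T (- K) p.1 * `|z (s0 n) p|.
have /choice[mu' /choice[f W]] : forall n, exists mu' f,
    [/\ weak_evolution T (torus_measure R N) (enum_basis (@torus_cas R N))
      (enum_eig R N) (z0 (s0 n)) (w n) mu' f,
    forall p, c <= mu' p & \forall p \ae Q, mu' p = mu (s0 n) p].
  move=> n; exact: (solution_weak_evolution hT c0 (hz0 _) (hmu _) (hRc _) (hz _)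
    (hz_ge0 _) (muc _) (RcK _) (hsol _)).
have mmulim := Lfun_measurable hmulim.
have mmul : measurable_fun setT mul by exact: measurable_clip.
have cB : c <= Num.max c B by rewrite le_max lexx.
have bmul p : `|mul p| <= Num.max c B.
  by rewrite ger0_norm ?clip_le// (le_trans (ltW c0)) ?clip_ge.
have imul : intg Q mul := intg_bnd Q mmul bmul.
have imu' n : intg Q (mu' n).
  have [We cmu' _] := W n; have [Bn hBn] := we_mub We.
  apply: (intg_bnd Q (we_mmu We)) => p; rewrite ger0_norm; first exact: hBn.
  exact: le_trans (ltW c0) (cmu' p).
have imulim : intg Q mulim.
  apply: (intg_dom_ae mmulim _ hB); apply: (intg_bnd Q (M := `|B|)) => //.
have imu n : intg Q (mu (s0 n)).
  have [_ _ muE] := W n.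
  exact: (intg_ae (Lfun_measurable (hmu (s0 n))) muE (imu' n)).
have mu'_cvg : rint Q (fun p => `|mu' n p - mul p|) @[n --> \oo] --> 0.
  apply: (@squeeze_cvgr _ _ _ _ (fun=> 0) (fun n => rint Q (fun p => `|mu (s0 n) p - mulim p|))).
  - near=> n; rewrite rint_ge0//=; apply: rint_le_ae.
    + by apply: intg_norm; exact: intgB.
    + by apply: intg_norm; exact: intgB.
    have [_ cmu' muE] := W n.
    apply: (ae_imp (ae_and muE hB)) => p [h1 h2]; rewrite -h1.
    by apply: clip_dist => //; rewrite le_max (le_trans (ler_norm _) h2) orbT.
  - exact: cvg_cst.
  - exact: Lnorm1_cvg0 mu_cvg.
have [s1 hs1 [wl swl w_cvg]] : exists2 s1 : nat -> nat, extraction s1 &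
    exists2 wl, sqi Q wl & nrm2 Q (fun p => w (s1 n) p - wl p) @[n --> \oo] --> 0.
  apply: (evolution_compactness (u0 := fun n => z0 (s0 n)) (mu := mu') (f := f) (mul := mul)
    (B := Num.max c B) (C0 := M ^+ 2) hT (enum_basisP (torus_cas_basis R N))
    (@enum_eig_ge0 R N) (@enum_eig_infty R N)
    (enum_basisP (orthonormal_basis_prod (cas_basis hT) (torus_cas_basis R N))) c0) => //.
  - by move=> n p; have [_ h _] := W n.
  - by move=> p; exact: clip_ge.
  - by move=> p; exact: clip_le.
  - by move=> n; have [h _ _] := W n.
  - by move=> n; apply: Lnorm2_le => //; exact: Lfun2_sqi.
pose C := expR (`|K| * T).
pose zl p := wl p * exp_win T K p.1.
have szl : sqi Q zl.
  apply: (sqiM swl) (fun p => exp_win_bnd T K p.1).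
  exact: (measurableT_comp (measurable_exp_win T K)).
have szn n : sqi Q (z (s0 (s1 n))) by exact: Lfun2_sqi.
exists (s0 \o s1); split; first by move=> i j ij; apply: hs0; exact: hs1.
exists zl; first exact: sqi_Lfun2.
apply: Lnorm2_cvg0; first by move=> n; exact: (sqiB (szn n) szl).
apply: (@squeeze_cvgr _ _ _ _ (fun=> 0)
  (fun n => C ^+ 2 * nrm2 Q (fun p => w (s1 n) p - wl p))).
- near=> n; rewrite ip_ge0 /= /nrm2 !ip_sqr.
  have [sd1 sd2] := (sqiB (szn n) szl,
    sqiB (we_w (let: And3 h _ _ := W (s1 n) in h)) swl).
  rewrite -rintZ; last by case: sd2.
  apply: rint_le_ae; first by case: sd1.
    by apply: intgZ; case: sd2.
  have time := spacetime_ae_time T N.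
  apply: (ae_imp (ae_and time (hz_ge0 (s0 (s1 n))))) => p [[t0 tT] z1] /=.
  (* On [0, T[ the two exponential factors are inverse to each other, and z is nonnegative here. *)
  have -> : z (s0 (s1 n)) p = w (s1 n) p * exp_win T K p.1.
    rewrite /w !exp_winE// ger0_norm// mulrAC -expRD.
    by rewrite mulNr addNr expR0 mul1r.
  rewrite /zl -mulrBl exprMn mulrC ler_wpM2r ?sqr_ge0//.
  rewrite -(real_normK (num_real (exp_win _ _ _))) lerXn2r ?nnegrE ?expR_ge0//.
  exact: exp_win_bnd.
- exact: cvg_cst.
- by rewrite -[X in _ --> X](mulr0 (C ^+ 2)); apply: cvgM => //; exact: cvg_cst.
Unshelve. all: by end_near. Qed.
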